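(* Let $(x_{1,i})_{i\geq 1}$ be a sequence of independent random variables, each uniformly distributed in $[0,1)$, and let $(p_i)_{i\geq 1}$ be the sequence of all odd prime numbers. For all integers $n\geq 1$ and $i\geq 1$ define recursively $$x_{n+1,i}=\begin{cases} T_{p_i}(x_{n,i}), & \text{if } i=1 \text{ or } 2^{12\cdot 2^i}<n-1,\\ \langle 2^{\lceil\log_2(i)\rceil+1}x_{n,i}\rangle, & \text{if } i\geq 2 \text{ and } 2^{12\cdot 2^i}\geq n-1.\end{cases}$$ Then for every $\varepsilon>0$, with probability at least $1-\varepsilon$ the following holds: for all integers $N\geq 1$ and $d\geq 1$ simultaneously, the set of $N$ points $P=\{(x_{1,1},\ldots,x_{1,d}),\ldots,(x_{N,1},\ldots,x_{N,d})\}\subset[0,1)^d$ satisfies $$D_N^*(P)\leq \left(2576+357\log(\varepsilon^{-1})\right)\frac{\sqrt d}{\sqrt N}.$$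
   Context: $\log$ is the natural logarithm and $\log_2$ the logarithm to base 2. $\langle x\rangle$ denotes the fractional part of a real number $x$. The odd primes are listed in increasing order: $p_1=3,p_2=5,p_3=7,\ldots$. Von Neumann–Kakutani map: for an integer $p\geq 2$ and $x\in[0,1)$ with $p$-adic expansion $x=\sum_{j=0}^\infty \alpha(j)p^{-j-1}$, $\alpha(j)\in\{0,\ldots,p-1\}$ (the standard expansion, in which the digits are not eventually all equal to $p-1$), put $m=\min\{j\ge 0:\alpha(j)\neq p-1\}$ and $$T_p(x)=\frac{\alpha(m)+1}{p^{m+1}}+\sum_{j>m}\frac{\alpha(j)}{p^{j+1}}.$$ Star discrepancy: for points $y_1,\ldots,y_N\in[0,1)^d$ (counted with multiplicity), $$D_N^*(y_1,\ldots,y_N)=\sup_{\mathcal A\in\mathcal B^*}\left|\frac1N\sum_{n=1}^N\mathbf 1_{\mathcal A}(y_n)-\lambda(\mathcal A)\right|,$$ where $\mathcal B^*$ is the set of all boxes $\prod_{i=1}^d[0,\beta_i)\subset[0,1)^d$, $\mathbf 1_{\mathcal A}$ is the indicator function of $\mathcal A$, and $\lambda$ is Lebesgue measure on $[0,1)^d$. *)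

(* Defs.v *)
From HB Require Import structures.
From mathcomp Require Import all_boot all_order all_algebra.
From mathcomp Require Import all_classical all_reals all_analysis.
From mathcomp Require Import measurable_realfun.

Set Implicit Arguments.
Unset Strict Implicit.
Unset Printing Implicit Defensive.

Import Order.TTheory GRing.Theory Num.Theory.
Import numFieldNormedType.Exports.

Local Open Scope classical_set_scope.
Local Open Scope ring_scope.

Section odd_primes.
Local Open Scope nat_scope.

Fact prime_above_ex (n : nat) : exists q, (n < q) && prime q.
Proof. by have [q nq pq] := prime_above n; exists q; rewrite nq pq. Qed.

Definition next_prime (n : nat) : nat := ex_minn (prime_above_ex n).

(* 1-based: odd_prime 1 = 3, odd_prime 2 = 5, and so on; odd_prime 0 = 2 is
   never used. *)
Definition odd_prime (i : nat) : nat := iter i next_prime 2.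

End odd_primes.

Section maps.
Context {R : realType}.

Definition frac (x : R) : R := x - (Num.floor x)%:~R.

Definition standard_expansion (p : nat) (x : R) (alpha : nat -> nat) : Prop :=
  [/\ forall j, (alpha j < p)%N,
      series (fun j => (alpha j)%:R / p%:R ^+ j.+1) @ \oo --> x &
      ~ exists k, forall j, (k <= j)%N -> alpha j = p.-1].

(* For 2 <= p and 0 <= x < 1 the standard expansion exists and is unique; the
   default values of the two xget below are used only outside this range. *)
Definition padic_digits (p : nat) (x : R) : nat -> nat :=
  xget (fun=> 0%N) [set alpha | standard_expansion p x alpha].

Definition first_nonmax (p : nat) (alpha : nat -> nat) : nat :=
  xget 0%N [set m | alpha m != p.-1 /\ forall j, (j < m)%N -> alpha j = p.-1].

Definition vnk_map (p : nat) (x : R) : R :=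
  let alpha := padic_digits p x in
  let m := first_nonmax p alpha in
  (alpha m).+1%:R / p%:R ^+ m.+1
  + limn (fun n => \sum_(m.+1 <= j < n) (alpha j)%:R / p%:R ^+ j.+1 : R).

(* The map sending x_{n,i} to x_{n+1,i}; for i >= 1, up_log 2 i is the least e
   with i <= 2 ^ e, that is, the ceiling of the base-2 logarithm of i. *)
Definition coord_step (n i : nat) (x : R) : R :=
  if (i == 1%N) || (2 ^ (12 * 2 ^ i) < n.-1)%N
  then vnk_map (odd_prime i) x
  else frac (2 ^+ (up_log 2 i).+1 * x).

(* coord_orbit i x1 n is x_{n,i} for n >= 1 when x_{1,i} = x1; the value at
   n = 0 is never used. *)
Fixpoint coord_orbit (i : nat) (x1 : R) (n : nat) : R :=
  match n with
  | 0 => x1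
  | k.+1 => if k == 0%N then x1 else coord_step k i (coord_orbit i x1 k)
  end.

End maps.

Section star_discrepancy.
Context {R : realType}.

(* d-dimensional Lebesgue measure (on Borel sets), as an iterated product
   measure: sections along the first coordinate are integrated. *)
Fixpoint lebesgue_tuple (d : nat) : set (d.-tuple R) -> \bar R :=
  match d return set (d.-tuple R) -> \bar R with
  | 0 => fun A => (\1_A [tuple])%:E
  | k.+1 => fun A =>
      (\int[lebesgue_measure]_x
         lebesgue_tuple [set y : k.-tuple R | A [tuple of x :: y]])%E
  end.

Definition anchored_box (d : nat) (beta : d.-tuple R) : set (d.-tuple R) :=
  [set y | forall i, 0 <= tnth y i < tnth beta i].

Definition anchored_boxes (d : nat) : set (set (d.-tuple R)) :=
  [set anchored_box beta | beta in
    [set beta : d.-tuple R | forall i, 0 <= tnth beta i <= 1]].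

(* The point set is y 1, ..., y N, counted with multiplicity. *)
Definition star_discrepancy (d N : nat) (y : nat -> d.-tuple R) : R :=
  sup [set `| N%:R^-1 * (\sum_(1 <= n < N.+1) \1_A (y n))
              - fine (lebesgue_tuple A) | | A in @anchored_boxes d].

Lemma lebesgue_tuple_box (d : nat) (beta : d.-tuple R) :
  (forall i, 0 <= tnth beta i) ->
  lebesgue_tuple (anchored_box beta) = (\prod_(i < d) tnth beta i)%:E.
Proof.
elim: d beta => [|d IH] beta b0.
  by rewrite big_ord0 /= indicE mem_set// => -[].
have set0_leb k : lebesgue_tuple (@set0 (k.-tuple R)) = 0%E.
  elim: k => [|k IHk]; first by rewrite /= indicE in_set0.
  by rewrite /= (eq_integral (cst 0%E)) ?integral0// => x _; rewrite -[RHS]IHk.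
rewrite big_ord_recl /=.
rewrite (eq_integral (fun x : measurableTypeR R => ((\prod_(i < d) tnth beta (lift ord0 i))%:E
    * (\1_(`[0, tnth beta ord0[%classic) x)%:E)%E)); last first.
  move=> x _; rewrite indicE.
  have -> : \prod_(i < d) tnth beta (lift ord0 i)
          = \prod_(i < d) tnth [tuple of behead beta] i.
    by apply: eq_bigr => i _; rewrite tnth_behead; congr tnth; apply/val_inj;
       rewrite /= inordK// ltnS ltn_ord.
  have [xb|xb] := boolP (x \in `[0, tnth beta ord0[%classic).
    rewrite mule1 -IH; last first.
      by move=> i; rewrite tnth_behead.
    congr lebesgue_tuple; apply/seteqP; split => y /= yb i.
      have := yb (lift ord0 i); rewrite tnthS tnth_behead.
      by congr (_ <= _ < tnth _ _); apply/val_inj;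
         rewrite /= inordK// ltnS ltn_ord.
    case: (unliftP ord0 i) => [j ->|->].
      rewrite tnthS; have := yb j; rewrite tnth_behead.
      by congr (_ <= _ < tnth _ _); apply/val_inj;
         rewrite /= inordK// ltnS ltn_ord.
    by move: xb; rewrite inE /= in_itv /= tnth0.
  rewrite mule0; rewrite -[RHS](set0_leb d); congr lebesgue_tuple.
  apply/seteqP; split => y //= /(_ ord0); rewrite tnth0 => xb'.
  by move: xb; rewrite notin_setE /= in_itv /= xb'.
rewrite ge0_integralZl//=.
- rewrite integral_indic//= setIT lebesgue_measure_itv /= lte_fin.
  rewrite EFinM muleC; congr (_ * _)%E.
  case: ltP => [_|h]; first by rewrite oppr0 addr0.
  by congr EFin; apply/eqP; rewrite eq_le h b0.
- exact/measurable_EFinP/measurable_indic.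
- by rewrite lee_fin prodr_ge0.
Qed.

End star_discrepancy.

Section random_variables.
Context {d : measure_display} {T : measurableType d} {R : realType}.
Variable P : probability T R.

Definition independent_RVs {I : eqType} (D : set I) (X : I -> {RV P >-> R}) :=
  forall (J : seq I) (B : I -> set R),
    uniq J -> (forall i, i \in J -> D i) -> (forall i, measurable (B i)) ->
    P (\bigcap_(i in [set` J]) (X i @^-1` B i))
      = (\big[mule/1]_(i <- J) P (X i @^-1` B i))%E.

Definition uniform01 (X : {RV P >-> R}) : Prop :=
  (forall t, 0 <= X t < 1) /\
  forall A : set R, measurable A ->
    distribution P X A = uniform_prob (@ltr01 R) A.

End random_variables.

(* Main.v *)
(* Time is cut into blocks 2^m + 2 <= n < 2^(m+1) + 2. Inside a block every
   coordinate is of one fixed kind: either a T_p-orbit, which visits each p-adic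
   interval of length p^-k along one residue class mod p^k, or a lacunary orbit,
   whose values are given by overlapping windows of i.i.d. uniform digits. By the
   Chinese remainder theorem the T_p-coordinates together have discrepancy at
   most prod (p_i m), which is at most 2^(m/2) because they number only
   O(log m). Given these coordinates, the lacunary digits are fresh: for a pair of
   nested boxes whose lacunary corners have L-digit expansions, the visits at
   times of one residue class mod L are independent, so an exponential maximal
   inequality controls all N in the block at once. Chaining along bracketing
   covers of mesh 4^-k, with 2^O(kd) boxes at level k, then bounds all boxes by
   O(sqrt(d 2^m)). Once m >= 12 * 2^d all d coordinates are T_p-orbits and
   nothing random is left, so the union bound runs over only 12 * 2^d blocks for
   each d, and the failure probabilities are summable in d. *)

Require Import Defs.
From HB Require Import structures.
From mathcomp Require Import all_boot all_order all_algebra.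
From mathcomp Require Import all_classical all_reals all_analysis.
From mathcomp Require Import measurable_realfun.
From mathcomp Require Import ring lra zify.

Set Implicit Arguments.
Unset Strict Implicit.
Unset Printing Implicit Defensive.

Import Order.TTheory GRing.Theory Num.Theory.
Import numFieldNormedType.Exports.

Local Open Scope classical_set_scope.
Local Open Scope ring_scope.

(** * The von Neumann-Kakutani map *)

(** At the scale sqrt(d 2^m) the failure probability allotted to a block does not decay in m, so
    infinitely many random blocks per dimension could not be afforded. This is why every lacunary
    coordinate must eventually become a T_p-orbit. The change has to wait until the product of the
    factors p_i m is below 2^(m/2); Euclid's doubly exponential bound on the primes guarantees this
    from m = 12 * 2^d on. The growing bases, at least 2 i for coordinate i, keep the dimension out
    of the rounding: k + 2 digits at level k round all corners at a total cost of order 4^-k,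
    because the sum of (2 i)^-2 converges. Splitting time into k + 2 residue classes then costs only
    a factor k + 2, which the 2^-k gained at each chaining step absorbs. Centring at the conditional
    mean leaves a variance of the order of the volume between the two boxes, so 2^m 4^-k. Chaining
    stops at the level K with 4^-K about sqrt(d / 2^m), where the width of the last bracket already
    has the order claimed. The first O(d) points are covered by the trivial bound. *)

Section vnk_closed_form.
Context {R : realType}.
Variable p : nat.
Hypothesis p_gt1 : (1 < p)%N.
Implicit Types (x : R) (alpha : nat -> nat).

Let p_gt0 : 0 < p%:R :> R. Proof. by rewrite ltr0n ltnW. Qed.
Let p_neq0 : p%:R != 0 :> R. Proof. exact: lt0r_neq0. Qed.
Let pX_gt0 k : 0 < p%:R ^+ k :> R. Proof. exact: exprn_gt0. Qed.
Let pX_neq0 k : p%:R ^+ k != 0 :> R. Proof. exact: lt0r_neq0. Qed.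

Lemma ltn_expn_real (n : nat) : n%:R < p%:R ^+ n :> R.
Proof. by rewrite -natrX ltr_nat ltn_expl. Qed.

Lemma invX_small (e : R) : 0 < e -> exists n, p%:R ^- n < e.
Proof.
move=> e0; exists (Num.bound e^-1).
rewrite invf_plt ?posrE//.
apply: lt_trans (ltn_expn_real _).
by apply: archi_boundP; rewrite invr_ge0 ltW.
Qed.

Lemma digit_sum_floor x (n : nat) : 0 <= x < 1 ->
  series (fun j => ((Num.truncn (p%:R ^+ j.+1 * x)) %% p)%:R / p%:R ^+ j.+1) n
    = (Num.truncn (p%:R ^+ n * x))%:R / p%:R ^+ n :> R.
Proof.
move=> /andP[x0 x1]; rewrite /series /=.
elim: n => [|n IH].
  rewrite big_nil expr0 mul1r divr1.
  by apply/esym; rewrite (@truncn_def _ x 0)// mulr0n x0.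
rewrite big_nat_recr//= IH.
set a := Num.truncn (p%:R ^+ n.+1 * x).
have -> : Num.truncn (p%:R ^+ n * x) = (a %/ p)%N.
  apply: truncn_def.
  have /andP[ha hb] : a%:R <= p%:R ^+ n.+1 * x < a.+1%:R.
    by apply: truncn_itv; rewrite mulr_ge0// exprn_ge0.
  have Ep : p%:R ^+ n * x = (p%:R ^+ n.+1 * x) / p%:R.
    by rewrite exprS; field.
  rewrite Ep ler_pdivlMr// ltr_pdivrMr//.
  apply/andP; split.
    by apply: le_trans ha; rewrite -natrM ler_nat leq_divM.
  apply: lt_le_trans hb _; rewrite -natrM ler_nat.
  by rewrite ltn_ceil// ltnW.
rewrite {3}(divn_eq a p) natrD natrM exprS; field.
by rewrite p_neq0 pX_neq0.
Qed.

(** Digits are read off the floors [a n] of p^n x. If they were all [p.-1] from k on, then a (k + j)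
    + 1 = (a k + 1) p^j, so p^k x would be within p^-j of a k + 1 for every j, against p^k x < a k +
    1. *)
Lemma standard_expansion_ex x : 0 <= x < 1 ->
  exists alpha, standard_expansion p x alpha.
Proof.
move=> x01; have /andP[x0 x1] := x01.
pose a n := Num.truncn (p%:R ^+ n * x).
have aP n : (a n)%:R <= p%:R ^+ n * x < (a n).+1%:R.
  by apply: truncn_itv; rewrite mulr_ge0// exprn_ge0.
exists (fun j => a j.+1 %% p)%N; split.
- by move=> j; rewrite ltn_mod ltnW.
- apply/cvgrPdist_lt => e e0.
  have [n0 hn0] := invX_small e0.
  near=> n; rewrite digit_sum_floor//.
  have n0n : (n0 <= n)%N by near: n; exists n0.
  apply: le_lt_trans hn0.
  have /andP[h1 h2] := aP n.
  have -> : x - (Num.truncn (p%:R ^+ n * x))%:R / p%:R ^+ n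
     = (p%:R ^+ n * x - (a n)%:R) / p%:R ^+ n.
    by rewrite -/(a n); field.
  rewrite ger0_norm ?divr_ge0 ?subr_ge0//.
  apply: (@le_trans _ _ (1 / p%:R ^+ n)).
    by rewrite ler_pM2r ?invr_gt0// lerBlDl natr1 ltW.
  by rewrite mul1r lef_pV2 ?posrE// ler_eXn2l// ltr1n.
- case=> k hk.
  pose c := (a k).+1%:R - p%:R ^+ k * x.
  have c0 : 0 < c by rewrite subr_gt0; case/andP: (aP k).
  have [n hn] := invX_small c0.
  have step j : ((a (k + j)).+1 = (a k).+1 * p ^ j)%N.
    elim: j => [|j IH]; first by rewrite addn0 expn0 muln1.
    have Ea : a (k + j).+1 = (a (k + j) * p + p.-1)%N.
      rewrite (divn_eq (a (k + j).+1) p) hk ?leq_addr//; congr (_ * _ + _)%N.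
      apply/esym/truncn_def.
      have /andP[ha hb] := aP (k + j).+1.
      have Ep : p%:R ^+ (k + j) * x = (p%:R ^+ (k + j).+1 * x) / p%:R.
        by rewrite exprS; field.
      rewrite Ep ler_pdivlMr// ltr_pdivrMr//.
      apply/andP; split.
        by apply: le_trans ha; rewrite -natrM ler_nat leq_divM.
      apply: lt_le_trans hb _; rewrite -natrM ler_nat.
      by rewrite ltn_ceil// ltnW.
    rewrite addnS Ea -addnS prednK 1?ltnW// expnS mulnCA mulnC -IH.
    by rewrite mulnS addnC.
  have /andP[h1 h2] := aP (k + n)%N.
  move: hn; rewrite invf_plt ?posrE// => hn.
  have : 1 < c * p%:R ^+ n.
    by rewrite mulrC -ltr_pdivrMr ?div1r.
  apply/negP; rewrite -leNgt /c mulrBl -natrX -natrM -step.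
  by rewrite natrX mulrAC -exprD lerBlDr -natr1 addrC lerD2l.
Unshelve. all: by end_near.
Qed.

(** Where exactly the first m digits equal [p.-1] the map is a translation. This removes digits and
    limits from all that follows. Strictness on the right comes from a later digit [j0] that is not
    [p.-1]. *)
Lemma vnk_map_formula x : 0 <= x < 1 ->
  exists m, 1 - p%:R ^- m <= x < 1 - p%:R ^- m.+1 /\
    vnk_map p x = x - 1 + p%:R ^- m + p%:R ^- m.+1.
Proof.
move=> x01.
rewrite /vnk_map.
have [al cv nev] : standard_expansion p x (padic_digits p x).
  exact: (xgetPex _ (standard_expansion_ex x01)).
move: (padic_digits p x) al cv nev => alpha al cv nev.
have nm : exists m, alpha m != p.-1 /\ forall j, (j < m)%N -> alpha j = p.-1.
  have ex : exists m, alpha m != p.-1.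
    apply: contrapT => h; apply: nev; exists 0%N => j _.
    by apply/eqP/negPn/negP => hj; apply: h; exists j.
  exists (ex_minn ex); case: ex_minnP => m hm hmin; split=> // j jm.
  by apply/eqP; apply: contraTT jm => /hmin; rewrite -leqNgt.
have [] : alpha (first_nonmax p alpha) != p.-1 /\
    forall j, (j < first_nonmax p alpha)%N -> alpha j = p.-1.
  exact: (xgetPex 0%N nm).
move: (first_nonmax p alpha) => m hm hlt /=.
pose q k : R := p%:R ^- k.
have q0 k : 0 < q k by rewrite invr_gt0.
have qS k : q k = p%:R * q k.+1.
  by rewrite /q exprS; field; rewrite p_neq0 pX_neq0.
have aq n : (alpha n)%:R * q n.+1 <= q n - q n.+1.
  rewrite (qS n) -{3}[q n.+1]mul1r -mulrBl ler_pM2r// lerBrDr natr1 ler_nat.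
  exact: al.
have aq2 n : alpha n != p.-1 -> (alpha n)%:R * q n.+1 <= q n - 2 * q n.+1.
  move=> an; rewrite (qS n) -mulrBl ler_pM2r// lerBrDr -natrD ler_nat addn2.
  have := al n; move: an; lia.
set u := series _ in cv.
have uS n : u n.+1 = u n + (alpha n)%:R * q n.+1.
  by rewrite /u /series /= big_nat_recr.
have um : forall k, (k <= m)%N -> u k = 1 - q k.
  elim=> [_|k IH km]; first by rewrite /u /series /= big_nil /q expr0 invr1 subrr.
  rewrite uS IH 1?ltnW// hlt// [q k]qS -subn1 natrB 1?ltnW//.
  by rewrite mulrBl mul1r; lra.
have uup k n : u (k + n)%N <= u k + q k - q (k + n)%N.
  elim: n => [|n IH]; first by rewrite addn0 addrK.
  rewrite addnS uS; have := aq (k + n)%N; lra.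
have undec k n : u k <= u (k + n)%N.
  elim: n => [|n IH]; first by rewrite addn0.
  rewrite addnS uS (le_trans IH)// lerDl mulr_ge0//; exact: ltW.
have ux : limn u = x by apply: cvg_lim.
have ule k : u k <= x.
  rewrite -ux; apply: limr_ge; first exact: cvgP cv.
  near=> n; have kn : (k <= n)%N by near: n; exists k.
  by rewrite -(subnKC kn).
have uge c k : (forall n, (k <= n)%N -> u n <= c) -> x <= c.
  move=> hc; rewrite -ux; apply: limr_le; first exact: cvgP cv.
  by near=> n; apply: hc; near: n; exists k.
exists m; split.
  apply/andP; split; first by rewrite -um.
  have /existsNP[j0 /not_implyP[mj0 aj0]] :
      ~ forall j, (m.+1 <= j)%N -> alpha j = p.-1.
    by move=> h; apply: nev; exists m.+1.
  apply: (@le_lt_trans _ _ (1 - q m.+1 - q j0.+1)); last first.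
    by rewrite ltrBlDr ltrDl.
  apply: (uge _ j0.+1) => n jn; rewrite -(subnKC jn).
  have h1 := uup j0.+1 (n - j0.+1)%N.
  have h2 := uup m.+1 (j0 - m.+1)%N.
  rewrite (subnKC mj0) in h2.
  have h3 := aq2 j0 (introN eqP aj0).
  have h4 := aq2 m hm.
  have h5 := uS m; have h6 := uS j0.
  have h7 := um m (leqnn m).
  have h8 := q0 (j0.+1 + (n - j0.+1))%N.
  lra.
have -> : limn (fun n => \sum_(m.+1 <= j < n) (alpha j)%:R / p%:R ^+ j.+1 : R)
    = x - u m.+1.
  apply: cvg_lim => //.
  have : (fun n => u n - u m.+1) @ \oo --> x - u m.+1.
    by apply: cvgB => //; exact: cvg_cst.
  apply: cvg_trans; apply: near_eq_cvg; near=> n.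
  have mn : (m.+1 <= n)%N by near: n; exists m.+1.
  rewrite /u /series /= (big_cat_nat (leq0n m.+1) mn)//=.
  by rewrite addrAC subrr add0r.
rewrite uS um// -/(q m) -/(q m.+1) -natr1 mulrDl mul1r; lra.
Unshelve. all: by end_near.
Qed.

Lemma vnk_map_itv x : 0 <= x < 1 -> 0 <= vnk_map p x < 1.
Proof.
move=> /vnk_map_formula[m [/andP[h1 h2] ->]].
have h3 : 0 < p%:R ^- m.+1 :> R by rewrite invr_gt0.
have h4 : p%:R ^- m <= 1 :> R.
  by rewrite invf_le1// exprn_ege1// ler1n ltnW.
by apply/andP; split; lra.
Qed.

Lemma vnk_map_low x : 0 <= x -> x < 1 - p%:R^-1 -> vnk_map p x = x + p%:R^-1.
Proof.
move=> x0 x1.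
have pV0 : 0 < p%:R^-1 :> R by rewrite invr_gt0.
have [|[|m] [/andP[h1 h2] ->]] := @vnk_map_formula x; first by apply/andP; split=> //; lra.
  by rewrite expr0 expr1; lra.
exfalso; have : p%:R ^- m.+1 <= p%:R^-1 :> R.
  by rewrite lef_pV2 ?posrE// -[leLHS]expr1 ler_eXn2l// ltr1n.
by lra.
Qed.

(** The carry: a leading digit [p.-1] becomes 0 and the map acts on the remaining digits, which are
    those of p x - (p - 1). *)
Lemma vnk_map_high x : 1 - p%:R^-1 <= x -> x < 1 ->
  vnk_map p x = vnk_map p (p%:R * x - p.-1%:R) / p%:R.
Proof.
move=> x0 x1.
have pV0 : 0 < p%:R^-1 :> R by rewrite invr_gt0.
have pV1 : p%:R^-1 <= 1 :> R by rewrite invf_le1 ?ler1n// ltnW.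
have [|m [/andP[h1 h2] ->]] := @vnk_map_formula x; first by apply/andP; split=> //; lra.
have pP : p.-1%:R = p%:R - 1 :> R by rewrite -subn1 natrB// ltnW.
have qS k : p%:R ^- k = p%:R * p%:R ^- k.+1 :> R.
  by rewrite exprS; field; rewrite p_neq0 pX_neq0.
case: m h1 h2 => [|m] h1 h2; first by exfalso; move: h1 h2; rewrite expr1; lra.
set y := p%:R * x - p.-1%:R.
have y1 : 1 - p%:R ^- m <= y.
  have : p%:R * (1 - p%:R ^- m.+1) <= p%:R * x by rewrite ler_pM2l.
  by rewrite /y pP mulrBr -qS; lra.
have y2 : y < 1 - p%:R ^- m.+1.
  have : p%:R * x < p%:R * (1 - p%:R ^- m.+2) by rewrite ltr_pM2l.
  by rewrite /y pP mulrBr -qS; lra.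
have qle i j : (i <= j)%N -> p%:R ^- j <= p%:R ^- i :> R.
  by move=> ij; rewrite lef_pV2 ?posrE// ler_eXn2l// ltr1n.
have y01 : 0 <= y < 1.
  have q0 : 0 < p%:R ^- m.+1 :> R by rewrite invr_gt0.
  have := qle 0%N m (leq0n _); rewrite expr0 invr1.
  by move=> h; apply/andP; split; lra.
have [m' [/andP[h3 h4] ->]] := vnk_map_formula y01.
have -> : m' = m.
  case: (ltngtP m' m) => // mm.
    by exfalso; have := qle _ _ mm; lra.
  by exfalso; have := qle _ _ mm; lra.
rewrite /y pP (qS m.+1) (qS m) (qS m.+1).
by field; rewrite ?p_neq0 ?pX_neq0.
Qed.

End vnk_closed_form.

Lemma divmod_uniq (B t z u w : nat) : (z < B)%N -> (w < B)%N ->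
  (t * B + z = u * B + w)%N -> t = u /\ z = w.
Proof.
move=> zB wB h.
have B0 : (0 < B)%N by apply: leq_ltn_trans zB.
have tu : t = u.
  have := congr1 (fun n => n %/ B)%N h.
  by rewrite /= !divnMDl// !divn_small// !addn0.
by split=> //; move: h; rewrite tu => /addnI.
Qed.

(** * The odometer: the map as adding one to reversed digits *)

Section odometer.
Context {R : realType}.
Implicit Types x : R.

Lemma truncn_nat_add (n : nat) x : 0 <= x ->
  Num.truncn (n%:R + x) = (n + Num.truncn x)%N.
Proof.
move=> /truncn_itv/andP[h1 h2]; apply: truncn_def.
by rewrite -addnS !natrD lerD2l ltrD2l h1.
Qed.

Lemma truncn_divn p k x : (0 < p)%N -> 0 <= x ->
  (Num.truncn (p%:R ^+ k.+1 * x) %/ p)%N = Num.truncn (p%:R ^+ k * x).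
Proof.
move=> p0 x0; apply/esym/truncn_def.
have /andP[ha hb] : (Num.truncn (p%:R ^+ k.+1 * x))%:R <= p%:R ^+ k.+1 * x
    < (Num.truncn (p%:R ^+ k.+1 * x)).+1%:R.
  by apply: truncn_itv; rewrite mulr_ge0// exprn_ge0.
have p0R : 0 < p%:R :> R by rewrite ltr0n.
have Ep : p%:R ^+ k * x = (p%:R ^+ k.+1 * x) / p%:R.
  by rewrite exprS; field; exact: lt0r_neq0.
rewrite Ep ler_pdivlMr// ltr_pdivrMr//.
apply/andP; split.
  by apply: le_trans ha; rewrite -natrM ler_nat leq_divM.
by apply: lt_le_trans hb _; rewrite -natrM ler_nat ltn_ceil.
Qed.

(* The first k digits of x in base p, read with the leading digit as the least
   significant one, so that the von Neumann-Kakutani map becomes adding 1. *)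
Fixpoint odo (p k : nat) x : nat :=
  if k is k'.+1 then
    (Num.truncn (p%:R * x) + p * odo p k' (p%:R * x - (Num.truncn (p%:R * x))%:R))%N
  else 0%N.

Variable p : nat.
Hypothesis p_gt1 : (1 < p)%N.
Let p0R : 0 < p%:R :> R. Proof. by rewrite ltr0n ltnW. Qed.

Lemma truncn_mul_lt x : 0 <= x < 1 -> (Num.truncn (p%:R * x) < p)%N.
Proof.
move=> /andP[x0 x1]; rewrite truncn_lt_nat ?mulr_ge0//.
by rewrite gtr_pMr.
Qed.

Lemma shift_itv x : 0 <= x < 1 ->
  0 <= p%:R * x - (Num.truncn (p%:R * x))%:R < 1.
Proof.
move=> /andP[x0 x1].
have /andP[h1 h2] : (Num.truncn (p%:R * x))%:R <= p%:R * x
    < (Num.truncn (p%:R * x)).+1%:R.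
  by apply: truncn_itv; rewrite mulr_ge0// ltW.
by rewrite subr_ge0 h1 /= ltrBlDl natr1.
Qed.

Lemma odo_lt k x : 0 <= x < 1 -> (odo p k x < p ^ k)%N.
Proof.
elim: k x => [//|k IH] x x01 /=.
have := truncn_mul_lt x01; have := IH _ (shift_itv x01).
by rewrite expnS; nia.
Qed.

(** Induction along the carry: either the leading digit grows by 1, or it returns to 0 and the
    higher part grows by 1. Reduction mod p^k discards the carry out of the last digit. *)
Lemma odo_vnk k x : 0 <= x < 1 ->
  odo p k (vnk_map p x) = (odo p k x).+1 %[mod p ^ k].
Proof.
elim: k x => [|k IH] x x01; first by rewrite expn0 !modn1.
have /andP[x0 x1] := x01.
have px0 : 0 <= p%:R * x by rewrite mulr_ge0// ltW.
case: (ltP x (1 - p%:R^-1)) => xp.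
  have E : p%:R * vnk_map p x = p%:R * x + 1.
    by rewrite vnk_map_low// mulrDr divff// lt0r_neq0.
  have Et : Num.truncn (p%:R * x + 1) = (Num.truncn (p%:R * x)).+1.
    by rewrite addrC (truncn_nat_add 1).
  rewrite /= E Et -natr1 opprD addrACA subrr addr0.
  by rewrite addSn.
have pP : p.-1%:R = p%:R - 1 :> R by rewrite -subn1 natrB// ltnW.
have Et : Num.truncn (p%:R * x) = p.-1.
  apply: truncn_def; rewrite prednK 1?ltnW// pP.
  have : p%:R * (1 - p%:R^-1) <= p%:R * x by rewrite ler_pM2l.
  rewrite mulrBr mulr1 divff ?lt0r_neq0// => -> /=.
  by rewrite gtr_pMr.
have y01 := shift_itv x01.
rewrite /= Et vnk_map_high//.
set y := p%:R * x - _; rewrite Et -/y in y01.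
have /andP[T0 T1] := vnk_map_itv p_gt1 y01.
have -> : p%:R * (vnk_map p y / p%:R) = vnk_map p y.
  by rewrite mulrC mulfVK// lt0r_neq0.
have -> : Num.truncn (vnk_map p y) = 0%N by apply: truncn_def; rewrite T0.
rewrite subr0 add0n -addSn prednK 1?ltnW// -mulnS expnS -!muln_modr.
by rewrite (IH _ y01).
Qed.

Lemma iter_vnk_itv x j : 0 <= x < 1 -> 0 <= iter j (vnk_map p) x < 1.
Proof. by move=> x01; elim: j => [//|j IH] /=; apply: vnk_map_itv. Qed.

Lemma odo_iter k j x : 0 <= x < 1 ->
  odo p k (iter j (vnk_map p) x) = (odo p k x + j)%N %[mod p ^ k].
Proof.
move=> x01; elim: j => [|j IH]; first by rewrite addn0.
by rewrite /= odo_vnk ?iter_vnk_itv// -addn1 -modnDml IH modnDml addn1 addnS.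
Qed.

(** The floor of p^k x and [odo p k x] are written with the same k digits in opposite orders, so a
    value of one fixes the value of the other. *)
Lemma odo_cell k a : (a < p ^ k)%N -> exists2 c, (c < p ^ k)%N &
  forall x, 0 <= x < 1 -> (Num.truncn (p%:R ^+ k * x) == a) = (odo p k x == c).
Proof.
elim: k a => [|k IH] a ak.
  exists 0%N => // x /andP[x0 x1].
  move: ak; rewrite expn0 ltnS leqn0 => /eqP ->; rewrite expr0 mul1r.
  by rewrite truncn_eq// x0 x1 /= eqxx.
have pk : (0 < p ^ k)%N by rewrite expn_gt0 ltnW.
have [c cp hc] := IH (a %% p ^ k)%N (ltn_pmod _ pk).
have a1 : (a %/ p ^ k < p)%N by rewrite ltn_divLR// -expnS.
exists (a %/ p ^ k + p * c)%N; first by rewrite expnS; nia.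
move=> x x01 /=.
have t1 := truncn_mul_lt x01.
have y01 := shift_itv x01; have /andP[y0 y1] := y01.
set t := Num.truncn (p%:R * x) in t1 y01 y0 y1 *.
set y := p%:R * x - t%:R in y01 y0 y1 *.
have -> : Num.truncn (p%:R ^+ k.+1 * x) = (t * p ^ k + Num.truncn (p%:R ^+ k * y))%N.
  have -> : p%:R ^+ k.+1 * x = (t * p ^ k)%:R + p%:R ^+ k * y.
    by rewrite /y exprS natrM natrX; ring.
  apply: truncn_nat_add.
  by rewrite mulr_ge0// exprn_ge0.
have z1 : (Num.truncn (p%:R ^+ k * y) < p ^ k)%N.
  rewrite truncn_lt_nat; last by rewrite mulr_ge0// exprn_ge0// ltW.
  by rewrite natrX gtr_pMr// exprn_gt0.
set z := Num.truncn _ in z1 *.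
have o1 := odo_lt k y01.
rewrite {1}(divn_eq a (p ^ k)).
have hz := hc y y01; rewrite -/z in hz.
have am := ltn_pmod a pk.
apply/eqP/eqP => h.
  have [<- /eqP] := divmod_uniq z1 am h.
  by rewrite hz => /eqP ->.
move: h; rewrite addnC mulnC [RHS]addnC [(p * c)%N]mulnC => h.
have [/eqP] := divmod_uniq t1 a1 h.
by rewrite -hz => /eqP -> ->.
Qed.

(* Each cell of the partition into p^k intervals of length p^-k is visited
   exactly along one residue class mod p^k. *)
Definition residue_cells (o : nat -> R) :=
  (forall j, 0 <= o j < 1) /\
  forall k a, (a < p ^ k)%N ->
    exists c, forall j, (Num.truncn (p%:R ^+ k * o j) == a) = (j == c %[mod p ^ k]).

Lemma residue_cells_vnk x : 0 <= x < 1 ->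
  residue_cells (fun j => iter j (vnk_map p) x).
Proof.
move=> x01; split=> [j|k a ak]; first exact: iter_vnk_itv.
have [c cp hc] := odo_cell ak.
have ox := odo_lt k x01.
(* The residue sought is c minus [odo p k x]; adding p^k keeps the subtraction within the
   naturals. *)
exists (c + (p ^ k - odo p k x))%N => j.
rewrite hc ?iter_vnk_itv//.
rewrite -[X in X == c](modn_small (odo_lt k (iter_vnk_itv j x01))) odo_iter//.
rewrite -(eqn_modDl (odo p k x)) addnCA subnKC 1?ltnW// modnDr.
by rewrite (modn_small cp).
Qed.

End odometer.

(** * Joint discrepancy of several von Neumann-Kakutani orbits *)

Section residue_counting.
Context {R : realType}.

(* The terms with n = r mod L are enumerated by n = r + L q. *)
Lemma sum_residue_class (V : nmodType) (F : nat -> V) (L r N : nat) :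
  (r < L)%N ->
  \sum_(n < N | (n %% L == r)%N) F n
    = \sum_(q < (N + (L.-1 - r)) %/ L) F (r + L * q)%N.
Proof.
move=> rL; have L0 : (0 < L)%N by apply: leq_ltn_trans rL.
elim: N => [|N IH].
  rewrite big_ord0 add0n divn_small ?big_ord0//.
  by apply: leq_ltn_trans (leq_subr _ _) _; rewrite ltn_predL.
rewrite big_mkcond big_ord_recr /= -big_mkcond /= IH addSn.
set M := (N + (L.-1 - r))%N.
rewrite divnS//.
have -> : (L %| M.+1)%N = (N %% L == r)%N.
  have E : (M.+1 + r = N + L)%N by rewrite /M; lia.
  apply/idP/eqP.
    move=> /dvdnP[k hk]; have := congr1 (fun n => n %% L)%N E.
    by rewrite /= hk modnMDl modnDr modn_small.
  move=> h; apply/dvdnP; exists (N %/ L).+1.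
  by have := divn_eq N L; rewrite h mulSn; lia.
case: eqP => [h|_]; last by rewrite addr0 add0n.
rewrite add1n big_ord_recr /=; congr (_ + F _).
have M1 : (M = (N %/ L) * L + L.-1)%N.
  by rewrite /M {1}(divn_eq N L) h; lia.
have -> : (M %/ L = N %/ L)%N.
  by rewrite M1 divnMDl// [(L.-1 %/ L)%N]divn_small ?ltn_predL// addn0.
by rewrite {1}(divn_eq N L) h addnC mulnC.
Qed.

Lemma count_residue_classE (Q c N : nat) : (0 < Q)%N ->
  \sum_(j < N) (j == c %[mod Q])%:R = ((N + (Q.-1 - c %% Q)) %/ Q)%:R :> R.
Proof.
move=> Q0; have cQ := ltn_pmod c Q0.
rewrite -[RHS]mulr1 mulr_natl -[in RHS](card_ord (_ %/ _)) -sumr_const.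
rewrite -(@sum_residue_class _ (fun=> 1) _ _ N cQ) [RHS]big_mkcond /=.
by apply: eq_bigr => j _; case: eqP.
Qed.

Lemma count_residue_class (Q c N : nat) : (0 < Q)%N ->
  `|\sum_(j < N) (j == c %[mod Q])%:R - N%:R / Q%:R| <= 1 :> R.
Proof.
move=> Q0.
have cQ := ltn_pmod c Q0.
rewrite count_residue_classE//.
have Q0R : 0 < Q%:R :> R by rewrite ltr0n.
set M := (N + _)%N.
have h1 : (M %/ Q)%:R * Q%:R <= M%:R :> R by rewrite -natrM ler_nat leq_divM.
have h2 : M%:R < ((M %/ Q)%:R + 1) * Q%:R :> R.
  by rewrite natr1 -natrM ltr_nat ltn_ceil.
have h3 : N%:R <= M%:R :> R by rewrite ler_nat leq_addr.
have h4 : M%:R <= N%:R + Q%:R :> R by rewrite -natrD ler_nat /M; lia.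
have -> : (M %/ Q)%:R - N%:R / Q%:R = ((M %/ Q)%:R * Q%:R - N%:R) / Q%:R :> R.
  by field; exact: lt0r_neq0.
rewrite normrM (gtr0_norm (x := Q%:R^-1)) ?invr_gt0//.
by rewrite ler_pdivrMr// mul1r ler_norml; apply/andP; split; lra.
Qed.

Lemma count_residue_class_le1 (Q c N : nat) : (N <= Q)%N ->
  \sum_(j < N) (j == c %[mod Q])%:R <= 1 :> R.
Proof.
move=> NQ.
case: (posnP Q) => [Q0|Q0].
  by move: NQ; rewrite Q0 leqn0 => /eqP ->; rewrite big_ord0.
have cQ := ltn_pmod c Q0.
rewrite count_residue_classE//.
rewrite -[leRHS]/(1%:R) ler_nat -ltnS ltn_divLR//; lia.
Qed.

End residue_counting.

(** * Orbits with pairwise coprime bases *)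

Section halton.
Context {R : realType}.

Lemma sum_nat_eq (t u v : nat) :
  \sum_(u <= x < v) (t == x)%:R = (u <= t < v)%:R :> R.
Proof.
elim: v => [|v IH]; first by rewrite big_geq// ltn0 andbF.
case: (leqP u v) => uv; last first.
  by rewrite big_geq//; case: andP => // -[]; lia.
rewrite big_nat_recr//= IH ltnS [(t <= v)%N]leq_eqVlt.
case: (eqVneq t v) => [->|tv].
  by rewrite ltnn andbF uv /= add0r.
by rewrite addr0.
Qed.

(** W is the count predicted for A, with error E along every class mod p^k. One more digit of b adds
    at most p - 1 cells, each with error E. After m levels a cell is visited at most once, since N
    <= 2^m <= p^m. The total (1 + (p - 1) m) E + 1 is at most p m E because m >= 2 and E >= 1. *)
Lemma refine_coordinate (A : nat -> bool) (p : nat) (o : nat -> R) (b W E : R)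
    (m N : nat) :
  (1 < p)%N -> residue_cells p o -> 0 <= b <= 1 -> (2 <= m)%N ->
  (N <= 2 ^ m)%N -> 0 <= W <= N%:R -> 1 <= E ->
  (forall k c, `|\sum_(j < N) (A j && (j == c %[mod p ^ k]))%:R - W / p%:R ^+ k|
     <= E) ->
  `|\sum_(j < N) (A j && (o j < b))%:R - W * b| <= E * (p * m)%:R.
Proof.
move=> p1 [oi01 cells] /andP[b0 b1] m2 Nm /andP[W0 WN] E1 H.
have p0 : (0 < p)%N by apply: ltnW.
have p0R : 0 < p%:R :> R by rewrite ltr0n.
have pX k : 0 < p%:R ^+ k :> R by rewrite exprn_gt0.
have pX0 k : p%:R ^+ k != 0 :> R by exact: lt0r_neq0.
have o0 j : 0 <= o j by case/andP: (oi01 j).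
have o1 j : o j < 1 by case/andP: (oi01 j).
have po k j : 0 <= p%:R ^+ k * o j by rewrite mulr_ge0// exprn_ge0// ltW.
have pb k : 0 <= p%:R ^+ k * b by rewrite mulr_ge0// exprn_ge0// ltW.
pose a k := Num.truncn (p%:R ^+ k * b).
pose t k j := Num.truncn (p%:R ^+ k * o j).
have aD k : (a k.+1 %/ p = a k)%N by exact: truncn_divn.
have tD k j : (t k.+1 j %/ p = t k j)%N by exact: truncn_divn.
have ale k : (a k <= p ^ k)%N.
  rewrite -(@ler_nat R) natrX.
  apply: le_trans (_ : p%:R ^+ k * b <= _); first by rewrite truncn_le pb.
  by rewrite ler_piMr// exprn_ge0// ltW.
have tlt k j : (t k j < p ^ k)%N.
  by rewrite truncn_lt_nat// natrX gtr_pMr.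
have cell k x : (x < p ^ k)%N ->
    `|\sum_(j < N) (A j && (t k j == x))%:R - W / p%:R ^+ k| <= E.
  move=> xk; have [c hc] := cells k x xk.
  by under eq_bigr => j _ do rewrite hc.
pose F k : R := \sum_(j < N) (A j && (t k j < a k)%N)%:R.
have FS k : F k.+1 = F k + \sum_(a k * p <= x < a k.+1)
    \sum_(j < N) (A j && (t k.+1 j == x))%:R.
  rewrite exchange_big /= -big_split /=; apply: eq_bigr => j _.
  case: (A j) => /=; last by rewrite big1 ?addr0.
  rewrite sum_nat_eq -[t k j]tD ltn_divLR//.
  have := leq_divM (a k.+1) p; rewrite aD => h.
  case: (ltnP (t k.+1 j) (a k * p)) => h'.
    by rewrite (leq_trans h' h) addr0.
  by rewrite /= add0r.
have Fb k : `|F k - W * (a k)%:R / p%:R ^+ k| <= (1 + (p%:R - 1) * k%:R) * E.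
  elim: k => [|k IH].
    rewrite mulr0 addr0 mul1r.
    have [a0|a0] := posnP (a 0%N).
      rewrite /F a0 big1 => [|j _]; last by rewrite andbF.
      by rewrite mulr0 mul0r subr0 normr0; lra.
    have a1 : a 0%N = 1%N by have := ale 0%N; rewrite expn0; lia.
    rewrite a1 mulr1.
    suff -> : F 0%N = \sum_(j < N) (A j && (t 0%N j == 0%N))%:R by exact: cell.
    by apply: eq_bigr => j _; rewrite a1 ltnS leqn0.
  rewrite FS.
  have h1 := leq_divM (a k.+1) p; rewrite aD in h1.
  have h2 : (a k.+1 < (a k).+1 * p)%N by rewrite -[a k]aD ltn_ceil.
  have -> : W * (a k.+1)%:R / p%:R ^+ k.+1 = W * (a k)%:R / p%:R ^+ k
      + \sum_(a k * p <= x < a k.+1) W / p%:R ^+ k.+1.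
    rewrite sumr_const_nat -[X in _ = _ + X]mulr_natl natrB// natrM exprS.
    by field; rewrite pX0 lt0r_neq0.
  rewrite opprD addrACA; apply: le_trans (ler_normD _ _) _.
  apply: le_trans (lerD IH (_ : _ <= (p%:R - 1) * E)) _; last first.
    by rewrite -natr1 -mulrDl ler_wpM2r//; lra.
  rewrite -sumrB; apply: le_trans (ler_norm_sum _ _ _) _.
  apply: le_trans (_ : \sum_(a k * p <= x < a k.+1) E <= _).
    rewrite big_nat_cond [leRHS]big_nat_cond; apply: ler_sum => x /andP[/andP[_ xa] _].
    by apply: cell; apply: leq_trans xa (ale _).
  rewrite sumr_const_nat -[leLHS]mulr_natl ler_wpM2r//; first lra.
  rewrite lerBrDr natr1 ler_nat; move: h2; rewrite mulSn; lia.
have pmN : (N <= p ^ m)%N by rewrite (leq_trans Nm)// leq_exp2r// ltnW.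
have D1 : F m <= \sum_(j < N) (A j && (o j < b))%:R.
  apply: ler_sum => j _; case: (A j) => //=; rewrite ler_nat.
  case: (ltnP (t m j) (a m)) => // h.
  suff -> : o j < b by [].
  rewrite -(ltr_pM2l (pX m)).
  have /andP[_ h1] : (t m j)%:R <= p%:R ^+ m * o j < (t m j).+1%:R by exact: truncn_itv.
  apply: lt_le_trans h1 _; apply: le_trans (_ : (a m)%:R <= _).
    by rewrite ler_nat.
  by rewrite truncn_le pb.
have D2 : \sum_(j < N) (A j && (o j < b))%:R <= F m + 1.
  (* For b = 1 the number [a m] equals p^m and is not the index of a cell; no time satisfies the
     premise, and any residue will do. *)
  have [c hc] : exists c, forall j, t m j = a m -> j = c %[mod p ^ m].
    case: (ltnP (a m) (p ^ m)) => am.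
      have [c hc] := cells m (a m) am; exists c => j tj.
      by apply/eqP; rewrite -hc; apply/eqP.
    by exists 0%N => j tj; have := tlt m j; rewrite tj ltnNge am.
  apply: le_trans (lerD (lexx _) (count_residue_class_le1 c pmN)).
  rewrite -big_split /=; apply: ler_sum => j _.
  case: (A j) => /=; last by rewrite add0r.
  rewrite -natrD ler_nat.
  case: (ltnP (t m j) (a m)) => h; first by case: (_ < _)%R.
  case: (ltP (o j) b) => // ob; rewrite add0n lt0b.
  apply/eqP/hc/eqP; rewrite eqn_leq h andbT.
  by apply: le_truncn; rewrite ler_pM2l// ltW.
have G1 : W * (a m)%:R / p%:R ^+ m <= W * b.
  rewrite -mulrA ler_wpM2l// ler_pdivrMr// mulrC.
  by rewrite truncn_le pb.
have G2 : W * b <= W * (a m)%:R / p%:R ^+ m + 1.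
  have h : b <= (a m)%:R / p%:R ^+ m + p%:R ^- m.
    rewrite -[X in _ + X]mul1r -mulrDl ler_pdivlMr// mulrC natr1.
    by have /andP[_ /ltW] : (a m)%:R <= p%:R ^+ m * b < (a m).+1%:R by exact: truncn_itv.
  apply: le_trans (ler_wpM2l W0 h) _.
  rewrite mulrDr mulrA lerD2l ler_pdivrMr// mul1r (le_trans WN)//.
  by rewrite -natrX ler_nat.
have := Fb m; rewrite !ler_norml natrM => /andP[B1 B2].
have e1 : 2 <= m%:R :> R by rewrite (ler_nat _ 2).
have e2 : (1 + (p%:R - 1) * m%:R) * E + E <= E * (p%:R * m%:R).
  rewrite -[X in _ + X]mul1r -mulrDl mulrC ler_wpM2l//; first lra.
  by rewrite mulrBl mul1r; lra.
by apply/andP; split; lra.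
Qed.

(** The progression mod Q is carried along for the induction: lying in a p-adic cell is a congruence
    mod p^k, which the Chinese remainder theorem merges with it, so the other coordinates are
    counted along a progression mod Q p^k. Each coordinate multiplies the error by p m. *)
Lemma halton_ap (I : eqType) (p : I -> nat) (o : I -> nat -> R) (b : I -> R)
    (m N : nat) (s : seq I) (Q c : nat) :
  (2 <= m)%N -> (N <= 2 ^ m)%N ->
  (forall i, i \in s -> [/\ (1 < p i)%N, residue_cells (p i) (o i) & 0 <= b i <= 1]) ->
  pairwise (fun i j => coprime (p i) (p j)) s ->
  (0 < Q)%N -> all (fun i => coprime Q (p i)) s ->
  `|\sum_(j < N) ((j == c %[mod Q]) && all (fun i => o i j < b i) s)%:R
     - N%:R / Q%:R * \prod_(i <- s) b i| <= \prod_(i <- s) (p i * m)%:R :> R.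
Proof.
move=> m2 Nm; elim: s Q c => [|i s IH] Q c hs cop Q0 Qs.
  rewrite !big_nil mulr1; under eq_bigr do rewrite /= andbT.
  exact: count_residue_class.
have [p1 cells b01] := hs i (mem_head _ _).
have hs' j : j \in s -> [/\ (1 < p j)%N, residue_cells (p j) (o j) & 0 <= b j <= 1].
  by move=> js; apply: hs; rewrite inE js orbT.
move: cop Qs; rewrite /= => /andP[ci cs] /andP[Qi Qs].
have Q0R : 0 < Q%:R :> R by rewrite ltr0n.
have /andP[pr0 pr1] : 0 <= \prod_(j <- s) b j <= 1.
  rewrite big_seq; apply: (big_ind (fun x : R => 0 <= x <= 1)).
  - by rewrite ler01 lexx.
  - by move=> x y /andP[? ?] /andP[? ?]; rewrite mulr_ge0//= mulr_ile1.
  - by move=> j /hs'[].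
rewrite !big_cons mulrA mulrAC [leRHS]mulrC.
pose A j := (j == c %[mod Q]) && all (fun i => o i j < b i) s.
under eq_bigr => j _ do rewrite /= andbCA andbC -/(A j).
apply: refine_coordinate => //.
- rewrite !mulr_ge0 ?invr_ge0//= ?(ltW Q0R)//.
  rewrite -mulrA ler_piMr// mulrC ler_pdivrMr// mul1r (le_trans pr1)//.
  by rewrite ler1n.
- have : (1 <= \prod_(i <- s) (p i * m))%N.
    rewrite big_seq_cond prodn_cond_gt0// => j /andP[/hs'[pj _ _] _].
    by rewrite muln_gt0 (ltnW pj) ltnW.
  by rewrite -(ler_nat R) natr_prod.
move=> k c'.
have cop : coprime Q (p i ^ k) by rewrite coprimeXr.
have pk0 : (0 < p i ^ k)%N by rewrite expn_gt0 ltnW.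
have pkR : (p i)%:R ^+ k != 0 :> R by rewrite lt0r_neq0// exprn_gt0// ltr0n ltnW.
have := IH (Q * p i ^ k)%N (chinese Q (p i ^ k) c c') hs' cs.
rewrite muln_gt0 Q0 pk0 => /(_ isT).
have -> : all (fun j => coprime (Q * p i ^ k) (p j)) s.
  apply/allP => j js; rewrite coprimeMl (allP Qs j js)/= coprimeXl//.
  exact: (allP ci j js).
move=> /(_ isT).
have -> : N%:R / (Q * p i ^ k)%:R * \prod_(i <- s) b i
    = N%:R / Q%:R * (\prod_(i <- s) b i) / (p i)%:R ^+ k :> R.
  rewrite natrM natrX; field.
  by rewrite pkR lt0r_neq0.
suff -> : \sum_(j < N) ((j == chinese Q (p i ^ k) c c' %[mod Q * p i ^ k])
     && all (fun i => o i j < b i) s)%:R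
   = \sum_(j < N) (A j && (j == c' %[mod p i ^ k]))%:R :> R by [].
apply: eq_bigr => j _; rewrite chinese_remainder// /A.
rewrite chinese_modl// chinese_modr//.
by rewrite andbAC.
Qed.

End halton.

(** * The orbits within a block of times *)

Arguments odd_prime : simpl never.
Arguments coord_orbit : simpl never.

(** * Size of the product of the factors p_i m *)

Section odd_prime_bounds.
Local Open Scope nat_scope.

Lemma next_primeP n : [/\ n < next_prime n, prime (next_prime n) &
  forall q, n < q -> prime q -> next_prime n <= q].
Proof.
rewrite /next_prime; case: ex_minnP => q /andP[nq pq] hq; split=> // q' h h'.
by apply: hq; rewrite h h'.
Qed.

Lemma odd_prime_prime i : prime (odd_prime i).
Proof. by case: i => [//|i]; case: (next_primeP (odd_prime i)). Qed.

Lemma odd_primeS i : odd_prime i < odd_prime i.+1.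
Proof. by case: (next_primeP (odd_prime i)). Qed.

Lemma odd_prime_inj : injective odd_prime.
Proof.
have mono i j : i < j -> odd_prime i < odd_prime j.
  elim: j => // j IH; rewrite ltnS leq_eqVlt => /orP[/eqP ->|/IH h].
    exact: odd_primeS.
  exact: ltn_trans h (odd_primeS j).
move=> i j; case: (ltngtP i j) => // /mono h e; by rewrite e ltnn in h.
Qed.

Lemma odd_prime_coprime i j : i != j -> coprime (odd_prime i) (odd_prime j).
Proof.
move=> ij; rewrite prime_coprime ?odd_prime_prime//.
rewrite dvdn_prime2 ?odd_prime_prime//.
by apply: contra_neqN ij => /eqP/odd_prime_inj.
Qed.

Lemma odd_prime1 : odd_prime 1 = 3.
Proof.
have [h1 _ h2] := next_primeP 2.
have := h2 3 isT isT; rewrite -[next_prime 2]/(odd_prime 1); move: h1; rewrite -[next_prime 2]/(odd_prime 1); lia.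
Qed.

Lemma prime_dvd_prod_odd_prime s q : prime q -> q <= odd_prime s ->
  q %| \prod_(j < s.+1) odd_prime j.
Proof.
move=> pq; elim: s => [|s IH] qs.
  have := prime_gt1 pq; rewrite big_ord_recr big_ord0 /= mul1n.
  move=> q1; have -> : q = 2 by move: qs q1; rewrite /odd_prime /=; lia.
  by [].
rewrite big_ord_recr /=.
case: (leqP q (odd_prime s)) => h; first by rewrite dvdn_mulr// IH.
have [_ _ hmin] := next_primeP (odd_prime s).
have e : q = odd_prime s.+1 by apply/eqP; rewrite eqn_leq qs hmin.
by rewrite -e dvdn_mull.
Qed.

(* Euclid: a prime factor of p_0 ... p_s + 1 exceeds p_s. *)
Lemma odd_primeS_le s : odd_prime s.+1 <= (\prod_(j < s.+1) odd_prime j).+1.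
Proof.
set M := \prod_(j < s.+1) _.
have M0 : 0 < M by rewrite prodn_gt0// => j; exact: prime_gt0 (odd_prime_prime j).
have pd : prime (pdiv M.+1) by rewrite pdiv_prime.
have [_ _ hmin] := next_primeP (odd_prime s).
apply: leq_trans (_ : pdiv M.+1 <= _); last by rewrite pdiv_leq.
apply: hmin => //; rewrite ltnNge; apply/negP => h.
have := prime_dvd_prod_odd_prime pd h; rewrite -/M => d1.
have := dvdn_sub (pdiv_dvd M.+1) d1.
by rewrite subSnn dvdn1 => /eqP e; rewrite e in pd.
Qed.

(** By Euclid's bound the next prime is at most M + 1, where M is the product so far, and M (M + 1)
    + 1 <= (M + 1)^2: the bound squares at each step. *)
Lemma prod_odd_prime_le s : (\prod_(j < s.+1) odd_prime j).+1 <= 3 ^ 2 ^ s.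
Proof.
elim: s => [|s IH]; first by rewrite big_ord_recr big_ord0.
rewrite big_ord_recr /=.
have := odd_primeS_le s.
move: (odd_prime s.+1) (\prod_(j < s.+1) _) IH => p M IH h.
apply: leq_trans (_ : M.+1 * M.+1 <= _); first nia.
by rewrite expnS mul2n -addnn expnD leq_mul.
Qed.

(** Bernoulli's inequality for (1 - 1/(m + 1))^n, cleared of denominators. *)
Lemma expS_le n m : n <= m.+1 -> m.+1 ^ n * (m.+1 - n) <= m ^ n * m.+1.
Proof.
elim: n => [|n IH] nm; first by rewrite !expn0 subn0.
have {}IH := IH (ltnW nm).
rewrite !expnS.
have e : m.+1 * (m.+1 - n.+1) <= m * (m.+1 - n) by nia.
apply: leq_trans (_ : m.+1 ^ n * (m * (m.+1 - n)) <= _).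
  by rewrite -mulnA mulnCA leq_mul2l e orbT.
by rewrite mulnCA -mulnA leq_mul2l IH orbT.
Qed.

Lemma expS_double n m : 2 * n <= m.+1 -> m.+1 ^ n <= 2 * m ^ n.
Proof.
move=> nm; rewrite -(@leq_pmul2r m.+1)//.
apply: leq_trans (_ : 2 * (m.+1 ^ n * (m.+1 - n)) <= _).
  by rewrite mulnCA leq_mul2l; apply/orP; right; lia.
by rewrite -mulnA leq_mul2l expS_le//; lia.
Qed.

Lemma exp_le_exp2 n m0 m : 2 * n <= m0 -> m0 ^ n <= 2 ^ m0 -> m0 <= m ->
  m ^ n <= 2 ^ m.
Proof.
move=> h0 h; elim: m => [|m IH]; first by rewrite leqn0 => /eqP e; rewrite e in h.
rewrite leq_eqVlt => /orP[/eqP <- //|]; rewrite ltnS => mm.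
apply: leq_trans (expS_double _) _; first by lia.
by rewrite expnS leq_mul2l IH.
Qed.

(** The exponent m is shared in the ratio 1 : 2. The primes satisfy p^2 <= 9^(2^d) <= 2^(4 * 2^d), a
    third of the threshold 12 * 2^d; the powers of m are controlled by m^(3 d) <= 2^m. Cubing the
    goal avoids fractional exponents. *)
Lemma halton_const_all d m : 0 < d -> 12 * 2 ^ d <= m ->
  (\prod_(i < d) (odd_prime i.+1 * m)) ^ 2 <= 2 ^ m.
Proof.
move=> d0 dm.
have two : 0 < 2 ^ d by rewrite expn_gt0.
have dd : d * (d + 4) <= 4 * 2 ^ d.
  clear -d0; case: d d0 => [//|d] _; case: d => [//|d].
  elim: d => [//|d IH]; rewrite [2 ^ d.+3]expnS; nia.
have d2 : d < 2 ^ d by rewrite ltn_expl.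
have hm : m ^ (3 * d) <= 2 ^ m.
  apply: (@exp_le_exp2 _ (12 * 2 ^ d)) => //; first lia.
  apply: leq_trans (_ : (2 ^ (4 + d)) ^ (3 * d) <= _).
    by rewrite leq_exp2r ?muln_gt0// expnD leq_mul2r orbT.
  by rewrite -expnM leq_exp2l//; lia.
rewrite big_split /= prod_nat_const card_ord.
set p := \prod_(i < d) _.
have hp : p ^ 2 <= 2 ^ (4 * 2 ^ d).
  have : p <= 3 ^ 2 ^ d.
    apply: leq_trans (prod_odd_prime_le d); rewrite big_ord_recl /=.
    by apply: leqW; apply: leq_pmull.
  rewrite -(@leq_exp2r _ _ 2)// => /leq_trans; apply.
  by rewrite -expnM mulnC !expnM leq_exp2r.
rewrite -(@leq_exp2r _ _ 3)// expnMn expnMn.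
apply: leq_trans (_ : 2 ^ m * (2 ^ m) ^ 2 <= _); last by rewrite -expnS.
apply: leq_mul.
  apply: leq_trans (_ : (2 ^ (4 * 2 ^ d)) ^ 3 <= _); first by rewrite leq_exp2r.
  by rewrite -expnM leq_exp2l//; lia.
have -> : ((m ^ d) ^ 2) ^ 3 = (m ^ (3 * d)) ^ 2 by rewrite -!expnM; congr expn; lia.
by rewrite leq_exp2r.
Qed.

Definition halton_phase (m i : nat) : bool := (i == 1) || (12 * 2 ^ i <= m).

(** If the last coordinate, of index at least 2, is in its T_p phase, so are all smaller ones and
    [halton_const_all] applies to the full product. With coordinate 1 alone the claim is 9 m^2 <=
    2^m, which is where 10 comes from. *)
Lemma halton_const d m : 10 <= m -> 0 < d ->
  (\prod_(i < d | halton_phase m i.+1) (odd_prime i.+1 * m)) ^ 2 <= 2 ^ m.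
Proof.
move=> m10; elim: d => // d IH _.
rewrite big_mkcond big_ord_recr /= -big_mkcond /=.
case: d IH => [_|d IH].
  rewrite big_ord0 mul1n odd_prime1 /= expnMn.
  apply: (@leq_trans (9 * m ^ 2)) => //.
  elim: m m10 => // m IH; rewrite leq_eqVlt => /orP[/eqP <- //|]; rewrite ltnS => mm.
  rewrite expnS; apply: leq_trans (_ : 2 * (9 * m ^ 2) <= _).
    by rewrite -!expnS mulnCA leq_mul2l expS_double//; lia.
  by rewrite [in leqRHS]expnS leq_mul2l IH.
have [h|h] := boolP (halton_phase m d.+2); last by rewrite muln1 IH.
move: h; rewrite /halton_phase /= => h.
rewrite -[odd_prime d.+2]/(odd_prime (@ord_max d.+1).+1).
have -> : \prod_(i < d.+1 | (i.+1 == 1) || (12 * 2 ^ i.+1 <= m)) (odd_prime i.+1 * m)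
   = \prod_(i < d.+1) (odd_prime i.+1 * m).
  apply: eq_bigl => i; apply/orP; right; apply: leq_trans h.
  by rewrite leq_mul2l leq_exp2l// ltnS ltnW.
have := @halton_const_all d.+2 m isT h.
by rewrite [X in X ^ 2 <= _]big_ord_recr.
Qed.

End odd_prime_bounds.

(** * Explicit orbits inside a block, and their measurability *)

Section orbits.
Context {R : realType}.
Implicit Types x : R.

Local Notation frac := (@Defs.frac R).

Lemma frac_itv x : 0 <= frac x < 1.
Proof.
have /andP[h1 h2] := floor_itv x.
by rewrite /Defs.frac subr_ge0 h1/= ltrBlDl -(intrD _ _ 1).
Qed.

Lemma frac_id x : 0 <= x < 1 -> frac x = x.
Proof.
by move=> x01; rewrite /Defs.frac (@floor_def _ x 0) ?mulr0z ?subr0.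
Qed.

Lemma frac_addz x (z : int) : frac (x + z%:~R) = frac x.
Proof.
rewrite /Defs.frac floorDrz ?intr_int// intrKfloor intrD opprD addrACA.
by rewrite subrr addr0.
Qed.

Lemma frac_mul (b : nat) x : frac (b%:R * frac x) = frac (b%:R * x).
Proof.
have -> : b%:R * x = b%:R * frac x + (b%:Z * Num.floor x)%:~R.
  by rewrite intrM /Defs.frac mulrBr subrK.
by rewrite frac_addz.
Qed.

Definition lac_base (i : nat) : nat := 2 ^ (up_log 2 i).+1.

Lemma lac_base_ge i : (0 < i)%N -> (2 * i <= lac_base i)%N.
Proof. by move=> i0; rewrite /lac_base expnS leq_mul2l up_logP. Qed.

Lemma coord_orbit_itv i x n : (0 < i)%N -> 0 <= x < 1 ->
  0 <= coord_orbit i x n.+1 < 1.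
Proof.
move=> i0 x01; elim: n => [//|n IH].
rewrite -[coord_orbit i x n.+2]/(coord_step n.+1 i (coord_orbit i x n.+1)).
rewrite /coord_step; case: ifP => _; last exact: frac_itv.
by apply: vnk_map_itv => //; exact: prime_gt1 (odd_prime_prime i).
Qed.

Lemma coord_orbit_lacunary i x n : (1 < i)%N -> (n <= (2 ^ (12 * 2 ^ i)).+1)%N ->
  0 <= x < 1 -> coord_orbit i x n.+1 = frac ((lac_base i)%:R ^+ n * x).
Proof.
move=> i1 + x01; elim: n => [_|n IH]; first by rewrite expr0 mul1r frac_id.
rewrite ltnS => ni.
rewrite -[coord_orbit i x n.+2]/(coord_step n.+1 i (coord_orbit i x n.+1)).
rewrite /coord_step succnK ltnNge ni orbF gtn_eqF// IH; last exact: leqW.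
by rewrite -natrX -/(lac_base i) frac_mul exprS mulrA.
Qed.

Lemma coord_orbit_halton i x n j : (i == 1) || (2 ^ (12 * 2 ^ i) < n)%N ->
  coord_orbit i x (n + j).+1
    = iter j (vnk_map (odd_prime i)) (coord_orbit i x n.+1).
Proof.
move=> h; elim: j => [|j IH]; first by rewrite addn0.
rewrite addnS iterS -IH.
rewrite -[coord_orbit i x (n + j).+2]/(coord_step (n + j).+1 i (coord_orbit i x (n + j).+1)).
rewrite /coord_step succnK; case: ifP => // /negP[].
by case/orP: h => [-> //|h]; rewrite (leq_trans h) ?orbT// leq_addr.
Qed.

(* Blocks of times are 2 ^ m + 2 <= n < 2 ^ (m + 1) + 2, so that no coordinate
   changes its dynamics inside a block. *)
Definition block_start (m : nat) : nat := 2 ^ m + 2.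

Lemma block_halton m i x j : halton_phase m i ->
  coord_orbit i x (block_start m + j).+1
    = iter j (vnk_map (odd_prime i)) (coord_orbit i x (block_start m).+1).
Proof.
move=> h; apply: coord_orbit_halton; case/orP: h => [-> //|h].
apply/orP; right; rewrite /block_start addn2 ltnS leqW//.
by rewrite leq_exp2l.
Qed.

(** For m < 12 * 2^i the last exponent in the block, 2^(m+1) + 1, is at most 2^(12 * 2^i) + 1, the
    last one for which the lacunary formula holds. The offset 2 in [block_start] is chosen for
    this. *)
Lemma block_lacunary m i x j : (0 < i)%N -> ~~ halton_phase m i ->
  (j < 2 ^ m)%N -> 0 <= x < 1 ->
  coord_orbit i x (block_start m + j).+1
    = frac ((lac_base i)%:R ^+ (block_start m + j) * x).
Proof.
move=> i0; rewrite negb_or -ltnNge => /andP[i1 mi] jm x01.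
apply: coord_orbit_lacunary => //; first by rewrite ltn_neqAle eq_sym i1.
have : (2 ^ m.+1 <= 2 ^ (12 * 2 ^ i))%N by rewrite leq_exp2l.
by rewrite /block_start expnS; lia.
Qed.

(** Countably many intervals, with a translation on each. *)
Lemma measurable_vnk (p : nat) : (1 < p)%N ->
  measurable_fun (`[0%R, 1%R[%classic : set R) (vnk_map p : R -> R).
Proof.
move=> p1.
have p0 : 0 < p%:R :> R by rewrite ltr0n ltnW.
pose q k : R := p%:R ^- k.
have q0 k : 0 < q k by rewrite invr_gt0 exprn_gt0.
have qle i j : (i <= j)%N -> q j <= q i.
  by move=> ij; rewrite lef_pV2 ?posrE ?exprn_gt0// ler_eXn2l// ltr1n.
pose E k : set R := `[1 - q k, 1 - q k.+1[%classic.
have -> : `[0%R, 1%R[%classic = \bigcup_k E k.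
  apply/seteqP; split=> x /=.
    rewrite in_itv /= => x01.
    have [k [h _]] := vnk_map_formula p1 x01.
    by exists k => //=; rewrite /E /= in_itv.
  move=> [k _]; rewrite /E /= !in_itv /= => /andP[h1 h2].
  have := qle 0%N k (leq0n _); have := q0 k.+1; rewrite /q expr0 invr1 -/(q _) -/(q _).
  by move=> h3 h4; apply/andP; split; lra.
apply/measurable_fun_bigcup; first by move=> k; exact: measurable_itv.
move=> k; apply: (eq_measurable_fun (fun x => x - 1 + q k + q k.+1)).
  move=> x; rewrite inE /E /= in_itv /= => /andP[h1 h2].
  have x01 : 0 <= x < 1.
    have := qle 0%N k (leq0n _); have := q0 k.+1; rewrite {3}/q expr0 invr1.
    by move=> h3 h4; apply/andP; split; lra.
  have [k' [/andP[h3 h4] ->]] := vnk_map_formula p1 x01.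
  rewrite -/(q k') -/(q k'.+1) in h3 h4 *.
  suff -> : k = k' by [].
  by case: (ltngtP k k') => // kk; exfalso; have := qle _ _ kk; lra.
by apply: measurable_funS (_ : measurable_fun setT _) => //;
  do !apply: measurable_funD => //; apply: measurable_cst.
Qed.

Lemma measurable_frac_mul (c : R) : measurable_fun setT (fun x : R => frac (c * x)).
Proof.
have mc : measurable_fun setT (fun x : R => c * x) by exact: measurable_funM.
apply: measurable_funB => //.
apply: (@measurableT_comp _ _ _ _ _ _ (fun x : R => (Num.floor x)%:~R : R) _ _ _ mc).
apply: nondecreasing_measurable => // x y xy.
by rewrite ler_int le_floor.
Qed.

Lemma measurable_coord_orbit i n : (0 < i)%N ->
  measurable_fun (`[0%R, 1%R[%classic : set R) (fun x : R => coord_orbit i x n.+1).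
Proof.
move=> i0; elim: n => [|n IH]; first exact: measurable_id.
have im : (fun x : R => coord_orbit i x n.+1) @` `[0%R, 1%R[%classic `<=` `[0%R, 1%R[%classic.
  move=> _ [x /= + <-]; rewrite !in_itv /=; exact: coord_orbit_itv.
have -> : (fun x : R => coord_orbit i x n.+2) = coord_step n.+1 i \o (fun x => coord_orbit i x n.+1).
  by [].
set c := (i == 1%N) || (2 ^ (12 * 2 ^ i) < n)%N.
have -> : coord_step n.+1 i = if c then vnk_map (odd_prime i)
    else fun x : R => frac (2 ^+ (up_log 2 i).+1 * x).
  by apply/funext => x; rewrite /coord_step succnK -/c; case: c.
case: c.
  apply: (measurable_comp _ im (measurable_vnk _) IH); first exact: measurable_itv.
  exact: prime_gt1 (odd_prime_prime i).
apply: (@measurableT_comp _ _ _ _ _ _ (fun x : R => frac (2 ^+ (up_log 2 i).+1 * x)) _ _ _ IH).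
exact: measurable_frac_mul.
Qed.

End orbits.

(** * Bracketing covers *)

Section elementary_inequalities.
Context {R : realType}.

Lemma prod_sub_le (I : Type) (s : seq I) (a c : I -> R) :
  (forall i, 0 <= a i) -> (forall i, a i <= c i) -> (forall i, c i <= 1) ->
  \prod_(i <- s) c i - \prod_(i <- s) a i <= \sum_(i <- s) (c i - a i).
Proof.
move=> a0 ac c1.
elim: s => [|i s IH]; first by rewrite !big_nil subrr.
rewrite !big_cons.
set C := \prod_(j <- s) c j in IH *; set A := \prod_(j <- s) a j in IH *.
have A0 : 0 <= A by apply: prodr_ge0.
have AC : A <= C by apply: ler_prod => j _; rewrite a0 ac.
have C1 : C <= 1.
  rewrite -[leRHS](_ : \prod_(j <- s) 1 = 1); last by rewrite big1.
  by apply: ler_prod => j _; rewrite c1 (le_trans (a0 j) (ac j)).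
have -> : c i * C - a i * A = (c i - a i) * C + a i * (C - A) by ring.
apply: lerD; first by rewrite ler_piMr// subr_ge0.
apply: le_trans IH; rewrite ler_piMl ?subr_ge0//.
exact: le_trans (ac i) (c1 i).
Qed.

Lemma bernoulli_ge (y : R) n : 0 <= y <= 1 -> 1 - n%:R * y <= (1 - y) ^+ n.
Proof.
move=> /andP[y0 y1]; elim: n => [|n IH]; first by rewrite mul0r expr0 subr0.
rewrite exprS; apply: le_trans (ler_wpM2l _ IH); last by rewrite subr_ge0.
rewrite -natr1.
have : 0 <= n%:R * (y * y) by rewrite !mulr_ge0.
by nra.
Qed.

Lemma bernoulli_le (y : R) n : 0 <= y <= 1 -> (1 - y) ^+ n * (1 + n%:R * y) <= 1.
Proof.
move=> /andP[y0 y1]; elim: n => [|n IH]; first by rewrite mul0r expr0 addr0 mulr1.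
apply: le_trans IH; rewrite exprSr -mulrA ler_wpM2l ?exprn_ge0 ?subr_ge0//.
rewrite -natr1.
have : 0 <= n%:R * (y * y) by rewrite !mulr_ge0.
by nra.
Qed.

Lemma exp_one_plus_le (y : R) n : 0 <= y -> (1 + y) ^+ n * (1 - n%:R * y) <= 1.
Proof.
move=> y0; elim: n => [|n IH]; first by rewrite mul0r expr0 subr0 mulr1.
apply: le_trans IH; rewrite exprSr -mulrA ler_wpM2l ?exprn_ge0 ?addr_ge0//.
rewrite -natr1.
have : 0 <= n%:R * (y * y) by rewrite !mulr_ge0.
by nra.
Qed.

(** Comparison with the telescoping sum of 1/i - 1/(i + 1). A bound free of d is what the growth of
    the lacunary bases buys. *)
Lemma sum_inv_sq_le d : (0 < d)%N ->
  \sum_(i < d | (0 < i)%N) ((2 * i.+1)%:R ^+ 2)^-1 <= 4^-1 * (1 - d%:R^-1) :> R.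
Proof.
elim: d => // -[|d] IH _.
  by rewrite big_mkcond big_ord_recr big_ord0 /= invr1 subrr mulr0 addr0.
rewrite big_mkcond big_ord_recr -big_mkcond /=.
apply: le_trans (lerD (IH isT) (lexx _)) _.
have d0 : 0 < d.+1%:R :> R by rewrite ltr0n.
set x : R := d.+1%:R in d0 *.
have -> : (2 * d.+2)%:R = 2 * (x + 1) :> R by rewrite natrM natr1.
have -> : d.+2%:R = x + 1 :> R by rewrite natr1.
rewrite -subr_ge0.
have -> : 4^-1 * (1 - (x + 1)^-1) - (4^-1 * (1 - x^-1) + ((2 * (x + 1)) ^+ 2)^-1)
   = 4^-1 * (x * (x + 1) ^+ 2)^-1.
  by field; rewrite !lt0r_neq0//; lra.
by rewrite mulr_ge0// invr_ge0 mulr_ge0 ?exprn_ge0//; lra.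
Qed.

Lemma geometric_sum_le (z : R) n : 0 <= z < 1 -> \sum_(c < n) z ^+ c <= (1 - z)^-1.
Proof.
move=> /andP[z0 z1].
have z1' : 0 < 1 - z by rewrite subr_gt0.
rewrite -[leRHS]mul1r ler_pdivlMr// mulrC.
have -> : (1 - z) * \sum_(c < n) z ^+ c = 1 - z ^+ n.
  by rewrite -[1 - z]opprB mulNr -subrX1 opprB.
by rewrite gerBl exprn_ge0.
Qed.

End elementary_inequalities.

(** * Brackets whose lacunary corners lie on a digit grid *)

Section brackets.
Context {R : realType}.
Variables (d : nat) (hal : pred 'I_d) (b : 'I_d -> nat).
Hypothesis d_gt0 : (0 < d)%N.
Hypothesis b_ge : forall i, ~~ hal i -> (0 < i)%N /\ (2 * i.+1 <= b i)%N.
Implicit Types (x : 'I_d -> R) (k L : nat).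

Definition vol x : R := \prod_(i < d) x i.

Definition grid_floor L x : 'I_d -> R := fun i =>
  if hal i then x i else (Num.truncn ((b i)%:R ^+ L * x i))%:R / (b i)%:R ^+ L.

(** Rounding up is rounding 1 - x down, so the result stays at most 1 and inherits the estimates for
    [grid_floor]. *)
Definition grid_ceil L x : 'I_d -> R := fun i =>
  if hal i then x i else 1 - grid_floor L (fun i => 1 - x i) i.

Definition on_grid L x : Prop := forall i, ~~ hal i ->
  exists2 C : nat, (C <= b i ^ L)%N & x i = C%:R / (b i)%:R ^+ L.

Let bX_gt0 i L : ~~ hal i -> 0 < (b i)%:R ^+ L :> R.
Proof. by move=> /b_ge[i0 bi]; rewrite exprn_gt0// ltr0n; lia. Qed.

Lemma grid_floor_itv L x i : 0 <= x i -> 0 <= grid_floor L x i <= x i.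
Proof.
move=> x0; rewrite /grid_floor; case: ifPn => [|hi]; first by rewrite x0 lexx.
rewrite divr_ge0//=.
rewrite ler_pdivrMr ?bX_gt0// mulrC truncn_le.
by rewrite mulr_ge0// ltW// bX_gt0.
Qed.

Lemma grid_floor_gt L x i : 0 <= x i -> ~~ hal i ->
  x i - grid_floor L x i <= (b i)%:R ^- L.
Proof.
move=> x0 hi; rewrite /grid_floor (negbTE hi).
rewrite lerBlDr -[X in X + _]mul1r -mulrDl ler_pdivlMr ?bX_gt0// mulrC addrC natr1.
have h : 0 <= (b i)%:R ^+ L * x i by rewrite mulr_ge0// ltW// bX_gt0.
by have /andP[_ /ltW] := truncn_itv h.
Qed.

Lemma grid_ceil_itv L x i : x i <= 1 -> x i <= grid_ceil L x i <= 1.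
Proof.
move=> x1; rewrite /grid_ceil; case: ifPn => [|hi]; first by rewrite x1 lexx.
have h : 0 <= 1 - x i by rewrite subr_ge0.
have /andP[h1 h2] := @grid_floor_itv L (fun i => 1 - x i) i h.
by apply/andP; split; lra.
Qed.

Lemma grid_ceil_lt L x i : x i <= 1 -> ~~ hal i ->
  grid_ceil L x i - x i <= (b i)%:R ^- L.
Proof.
move=> x1 hi; have h : 0 <= 1 - x i by rewrite subr_ge0.
have := @grid_floor_gt L (fun i => 1 - x i) i h hi.
by rewrite /grid_ceil (negbTE hi); lra.
Qed.

Lemma on_grid_floor L x : (forall i, 0 <= x i <= 1) -> on_grid L (grid_floor L x).
Proof.
move=> x01 i hi; have /andP[x0 x1] := x01 i.
exists (Num.truncn ((b i)%:R ^+ L * x i)); last by rewrite /grid_floor (negbTE hi).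
rewrite -(ler_nat R) natrX.
apply: le_trans (_ : (b i)%:R ^+ L * x i <= _).
  by rewrite truncn_le mulr_ge0// ltW// bX_gt0.
by rewrite ler_piMr// ltW// bX_gt0.
Qed.

Lemma on_grid_ceil L x : (forall i, 0 <= x i <= 1) -> on_grid L (grid_ceil L x).
Proof.
move=> x01 i hi.
have [|C hC e] := @on_grid_floor L (fun i => 1 - x i) _ i hi.
  by move=> j; have /andP[? ?] := x01 j; apply/andP; split; lra.
exists (b i ^ L - C)%N; first by rewrite leq_subr.
rewrite /grid_ceil (negbTE hi) e natrB// natrX mulrBl divff// lt0r_neq0//.
exact: bX_gt0.
Qed.

Lemma on_gridS L x : on_grid L x -> on_grid L.+1 x.
Proof.
move=> h i hi; have [C hC ->] := h i hi.
have b0 := bX_gt0 1 hi; rewrite expr1 in b0.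
exists (C * b i)%N; first by rewrite expnSr leq_mul2r hC orbT.
rewrite natrM exprSr; field.
by rewrite !lt0r_neq0// bX_gt0.
Qed.

(** Of the k + 2 digits, two make the sum over coordinates converge, through (2 i)^-2, and the other
    k supply 4^-k, as every lacunary base is at least 4. *)
Lemma rounding_error k (a c : 'I_d -> R) :
  (forall i, 0 <= a i) -> (forall i, a i <= c i) -> (forall i, c i <= 1) ->
  (forall i, hal i -> a i = c i) ->
  (forall i, ~~ hal i -> c i - a i <= (b i)%:R ^- (k + 2)) ->
  vol c - vol a <= 4^-1 * 4 ^- k.
Proof.
move=> a0 ac c1 ach acn; apply: le_trans (prod_sub_le _ a0 ac c1) _.
apply: le_trans (_ : \sum_(i < d | (0 < i)%N) (((2 * i.+1)%:R ^+ 2)^-1 * 4 ^- k) <= _).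
  rewrite [leRHS]big_mkcond /=; apply: ler_sum => i _.
  have X0 : 0 <= ((2 * i.+1)%:R ^+ 2)^-1 * 4 ^- k :> R.
    by rewrite mulr_ge0// invr_ge0 exprn_ge0.
  have [hi|hi] := boolP (hal i).
    by rewrite ach// subrr; case: ifP.
  have [i0 bi] := b_ge hi; rewrite i0.
  apply: le_trans (acn i hi) _.
  have b4 : (4 <= b i)%N by lia.
  rewrite -invfM lef_pV2 ?posrE ?bX_gt0//.
  rewrite exprD mulrC ler_pM ?exprn_ge0//.
    by rewrite lerXn2r ?nnegrE// (ler_nat _ 4).
  by rewrite lerXn2r ?nnegrE// ler_nat.
rewrite -mulr_suml ler_wpM2r ?invr_ge0 ?exprn_ge0//.
apply: le_trans (sum_inv_sq_le d_gt0) _.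
by rewrite ler_piMr ?invr_ge0// gerBl invr_ge0.
Qed.

(** Before rounding, corners are taken from a multiplicative grid: one more step in every coordinate
    multiplies the volume by ratio^d >= 1 - mesh. As cutoff = d / mesh^2, a box with that many steps
    has volume at most 1 / (1 + 1/mesh) <= mesh. The mesh is half of 4^-k because rounding the two
    corners uses up the other half. *)
Definition mesh k : R := 2^-1 * 4 ^- k.
Definition ratio k : R := 1 - mesh k / d%:R.
Definition cutoff k : nat := (2 ^ (4 * k + 2) * d)%N.

Definition box_index k := {ffun 'I_d -> 'I_(cutoff k).+1}.
Definition index_sum k (j : box_index k) : nat := \sum_(i < d) j i.
Definition admissible k (j : box_index k) : bool := (index_sum j <= cutoff k)%N.

Definition up0 k (j : box_index k) : 'I_d -> R := fun i => ratio k ^+ j i.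
(* When the cutoff is attained the box up0 already has volume at most mesh k. *)
Definition lo0 k (j : box_index k) : 'I_d -> R := fun i =>
  if index_sum j == cutoff k then 0 else ratio k ^+ (j i).+1.

Definition lower k (j : box_index k) := grid_floor (k + 2) (lo0 j).
Definition upper k (j : box_index k) := grid_ceil (k + 2) (up0 j).

Let mesh_gt0 k : 0 < mesh k.
Proof. by rewrite mulr_gt0// invr_gt0 exprn_gt0. Qed.

Let mesh_le1 k : mesh k <= 2^-1.
Proof. by rewrite ler_piMr// invf_le1 ?exprn_gt0// exprn_ege1// (ler_nat _ 1 4). Qed.

Let d0 : 0 < d%:R :> R. Proof. by rewrite ltr0n. Qed.

Let md01 k : 0 <= mesh k / d%:R <= 1.
Proof.
rewrite divr_ge0 ?(ltW (mesh_gt0 k)) ?(ltW d0)//= ler_pdivrMr// mul1r.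
by apply: (@le_trans _ _ 1); [have := mesh_le1 k; lra|rewrite ler1n].
Qed.

Lemma ratio_itv k : 0 <= ratio k <= 1.
Proof. by have /andP[? ?] := md01 k; rewrite /ratio; apply/andP; split; lra. Qed.

Lemma up0_itv k (j : box_index k) i : 0 <= up0 j i <= 1.
Proof.
have /andP[r0 r1] := ratio_itv k.
by rewrite /up0 exprn_ge0//= exprn_ile1.
Qed.

Lemma lo0_itv k (j : box_index k) i : 0 <= lo0 j i <= up0 j i.
Proof.
have /andP[r0 r1] := ratio_itv k.
rewrite /lo0 /up0; case: ifP => _; first by rewrite lexx exprn_ge0.
by rewrite exprn_ge0//= exprS ler_piMl// exprn_ge0.
Qed.

Lemma lower_itv k (j : box_index k) i : 0 <= lower j i <= lo0 j i.
Proof. by apply: grid_floor_itv; case/andP: (lo0_itv j i). Qed.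

Lemma upper_itv k (j : box_index k) i : up0 j i <= upper j i <= 1.
Proof. by apply: grid_ceil_itv; case/andP: (up0_itv j i). Qed.

Lemma lower_le_upper k (j : box_index k) i : lower j i <= upper j i.
Proof.
have /andP[_ h1] := lower_itv j i; have /andP[_ h2] := lo0_itv j i.
have /andP[h3 _] := upper_itv j i.
exact: le_trans h1 (le_trans h2 h3).
Qed.

Lemma on_grid_lower k (j : box_index k) : on_grid (k + 2) (lower j).
Proof.
apply: on_grid_floor => i; have /andP[h1 h2] := lo0_itv j i.
by rewrite h1 (le_trans h2)//; case/andP: (up0_itv j i).
Qed.

Lemma on_grid_upper k (j : box_index k) : on_grid (k + 2) (upper j).
Proof. by apply: on_grid_ceil => i; exact: up0_itv. Qed.

Lemma vol_up0 k (j : box_index k) : vol (up0 j) = ratio k ^+ index_sum j.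
Proof. by rewrite /index_sum (big_morph _ (exprD (ratio k)) (expr0 _)). Qed.

Lemma up0_lo0_width k (j : box_index k) : vol (up0 j) - vol (lo0 j) <= mesh k.
Proof.
have /andP[r0 r1] := ratio_itv k.
have [e|ne] := eqVneq (index_sum j) (cutoff k).
  have -> : vol (lo0 j) = 0.
    rewrite /vol (bigD1 (Ordinal d_gt0))//= {1}/lo0 e eqxx mul0r //.
  rewrite subr0 vol_up0 e.
  have h := bernoulli_le (cutoff k) (md01 k).
  have K : (cutoff k)%:R * (mesh k / d%:R) = (mesh k)^-1.
    rewrite /cutoff /mesh natrM natrX addnC exprD exprM.
    have -> : (2 ^+ 4 : R) = 4 * 4 by ring.
    rewrite exprMn; field.
    by rewrite lt0r_neq0//= lt0r_neq0// exprn_gt0.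
  rewrite K -/(ratio k) in h.
  have m0 := mesh_gt0 k.
  have {}h : ratio k ^+ cutoff k * (mesh k)^-1 <= 1.
    apply: le_trans h; rewrite ler_wpM2l ?exprn_ge0// lerDr//.
  by move: h; rewrite ler_pdivrMr// mul1r.
have -> : vol (lo0 j) = ratio k ^+ (index_sum j + d).
  rewrite exprD -vol_up0 /vol.
  rewrite -[in X in _ * X](card_ord d) -prodr_const -big_split /=.
  by apply: eq_bigr => i _; rewrite /lo0 (negbTE ne) exprSr.
rewrite vol_up0 exprD -[X in X - _]mulr1 -mulrBr.
apply: le_trans (_ : 1 - ratio k ^+ d <= _).
  by rewrite ler_piMl ?exprn_ile1// subr_ge0 exprn_ile1.
have := bernoulli_ge d (md01 k).
rewrite mulrCA divff ?mulr1 -/(ratio k); last exact: lt0r_neq0.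
lra.
Qed.

Lemma upper_lower_width k (j : box_index k) : vol (upper j) - vol (lower j) <= 4 ^- k.
Proof.
have h1 : vol (upper j) - vol (up0 j) <= 4^-1 * 4 ^- k.
  apply: rounding_error => i.
  - by case/andP: (up0_itv j i).
  - by case/andP: (upper_itv j i).
  - by case/andP: (upper_itv j i).
  - by move=> hi; rewrite /upper /grid_ceil hi.
  - by move=> hi; apply: grid_ceil_lt => //; case/andP: (up0_itv j i).
have h2 : vol (lo0 j) - vol (lower j) <= 4^-1 * 4 ^- k.
  have l1 i : 0 <= lo0 j i by case/andP: (lo0_itv j i).
  apply: rounding_error => i.
  - by case/andP: (lower_itv j i).
  - by case/andP: (lower_itv j i).
  - have /andP[_ h2] := lo0_itv j i.
    by rewrite (le_trans h2)//; case/andP: (up0_itv j i).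
  - by move=> hi; rewrite /lower /grid_floor hi.
  - by move=> hi; apply: grid_floor_gt.
have := up0_lo0_width j; rewrite /mesh.
set e := 4 ^- k in h1 h2 *; lra.
Qed.

(** Among the admissible boxes [up0 j] that contain x, one with the largest index sum is taken. If
    its lower corner exceeded x in coordinate i, the exponent there could still be raised; at the
    cutoff the lower corner is 0. *)
Lemma bracket_exists k x : (forall i, 0 <= x i <= 1) ->
  exists2 j : box_index k, admissible j & forall i, lower j i <= x i <= upper j i.
Proof.
move=> x01.
have /andP[r0 r1] := ratio_itv k.
pose A (j : box_index k) := admissible j && [forall i, x i <= up0 j i].
have A0 : A [ffun=> ord0].
  rewrite /A /admissible /index_sum big1 => [|i _]; last by rewrite ffunE.
  by apply/forallP => i; rewrite /up0 ffunE expr0; case/andP: (x01 i).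
case: (@arg_maxnP _ _ A (@index_sum k) A0) => j /andP[Aj /forallP xj] jmax.
exists j => // i; apply/andP; split; last first.
  by apply: le_trans (xj i) _; case/andP: (upper_itv j i).
apply: le_trans (_ : lo0 j i <= _); first by case/andP: (lower_itv j i).
rewrite /lo0; case: eqP => [_|ne]; first by case/andP: (x01 i).
rewrite leNgt; apply/negP => xi.
have lt : (index_sum j < cutoff k)%N by rewrite ltn_neqAle; apply/andP; split; [apply/eqP|].
have ji : (j i < cutoff k)%N.
  by apply: leq_ltn_trans lt; rewrite /index_sum (bigD1 i)//= leq_addr.
pose j' : box_index k := [ffun i' => if i' == i then inord (j i).+1 else j i'].
have sj' : index_sum j' = (index_sum j).+1.
  have e1 : j' i = (j i).+1 :> nat by rewrite ffunE eqxx inordK.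
  rewrite /index_sum (bigD1 i)//= e1 [in RHS](bigD1 i)//= addSn.
  by congr (_ + _).+1; apply: eq_bigr => i' /negbTE i'i; rewrite ffunE i'i.
have : A j'.
  rewrite /A /admissible sj' lt; apply/forallP => i'.
  rewrite /up0 ffunE; case: eqP => [->|_]; last exact: xj.
  by rewrite inordK ?ltnS// ltW.
by move=> /jmax /=; rewrite sj' ltnn.
Qed.

(** Chernoff counting: the indicator of admissibility is at most z^(index sum - cutoff), whose sum
    factors into geometric series. With K = cutoff / d and z = K / (1 + K) this gives ((1 + K) (1 +
    1/K)^K)^d <= (4 (1 + K))^d <= (8 K)^d, with no factor such as d^d. The 4 arises as the square of
    (1 + 1/K)^(K/2) <= 2. *)
Lemma card_admissible k : (#|@admissible k| <= (2 ^ (4 * k + 5)) ^ d)%N.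
Proof.
pose kap := (2 ^ (4 * k + 2))%N.
have kap0 : 0 < kap%:R :> R by rewrite ltr0n expn_gt0.
have kap1 : 1 <= kap%:R :> R by rewrite ler1n expn_gt0.
set K : R := kap%:R in kap0 kap1.
pose z : R := K / (1 + K).
have K1 : 0 < 1 + K by lra.
have z0 : 0 < z by rewrite divr_gt0.
have z1 : z < 1 by rewrite ltr_pdivrMr// mul1r; lra.
have zz : (1 - z)^-1 = 1 + K by rewrite /z; field; rewrite !lt0r_neq0//; lra.
have zinv : z^-1 ^+ kap <= 4.
  have -> : z^-1 = 1 + K^-1 by rewrite /z; field; rewrite !lt0r_neq0.
  have e : kap = ((2 ^ (4 * k + 1)) * 2)%N by rewrite /kap -expnSr; congr expn; lia.
  set h := (2 ^ (4 * k + 1))%N in e.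
  have hK : h%:R * K^-1 = 2^-1.
    rewrite /K e natrM; field.
    by rewrite lt0r_neq0// ltr0n expn_gt0.
  rewrite e exprM.
  have hh : (1 + K^-1) ^+ h <= 2.
    have := @exp_one_plus_le R K^-1 h; rewrite hK invr_ge0 (ltW kap0) => /(_ isT).
    by lra.
  have h0 : 0 <= (1 + K^-1) ^+ h by rewrite exprn_ge0// addr_ge0// invr_ge0 ltW.
  by rewrite expr2; nra.
have : #|@admissible k|%:R <= (4 * (1 + K)) ^+ d.
  rewrite -sum1_card natr_sum.
  apply: le_trans (_ : \sum_(j : box_index k) (\prod_(i < d) z ^+ j i) * z^-1 ^+ cutoff k <= _).
    rewrite big_mkcond /=; apply: ler_sum => j _.
    have p0 : 0 <= \prod_(i < d) z ^+ j i by rewrite prodr_ge0// => i _; rewrite exprn_ge0// ltW.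
    have q0 : 0 <= z^-1 ^+ cutoff k by rewrite exprn_ge0// invr_ge0 ltW.
    case: ifP => [Aj|_]; last exact: mulr_ge0.
    rewrite -(big_morph _ (exprD z) (expr0 _)) -/(index_sum j).
    rewrite exprVn ler_pdivlMr ?exprn_gt0// mul1r.
    apply: ler_wiXn2l; rewrite ?(ltW z0) ?(ltW z1)//.
  rewrite -mulr_suml.
  rewrite -(bigA_distr_bigA (fun (i : 'I_d) (c : 'I_(cutoff k).+1) => z ^+ c)).
  rewrite prodr_const card_ord /cutoff exprM -exprMn.
  rewrite lerXn2r ?nnegrE ?mulr_ge0 ?sumr_ge0 ?exprn_ge0 ?invr_ge0 ?(ltW z0) ?(ltW K1)//.
    by move=> i _; rewrite exprn_ge0// ltW.
  rewrite mulrC; apply: ler_pM => //.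
  - by rewrite exprn_ge0// invr_ge0 ltW.
  - by rewrite sumr_ge0// => i _; rewrite exprn_ge0// ltW.
  by rewrite -zz; apply: geometric_sum_le; rewrite (ltW z0).
rewrite -(ler_nat R) => /le_trans; apply.
rewrite [leRHS]natrX lerXn2r ?nnegrE//.
  by rewrite mulr_ge0// ltW.
rewrite natrX.
have -> : 2 ^+ (4 * k + 5) = 8 * K.
  rewrite /K /kap natrX (_ : 8 = 2 ^+ 3); last by ring.
  by rewrite -exprD; congr (_ ^+ _); lia.
lra.
Qed.

End brackets.

Lemma vol_le1 (R : realType) (d : nat) (x : 'I_d -> R) :
  (forall i, 0 <= x i <= 1) -> vol x <= 1.
Proof.
move=> x01; have : 0 <= vol x <= 1; last by case/andP.
apply: (big_ind (fun y : R => 0 <= y <= 1)) => //.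
  by rewrite ler01 lexx.
by move=> y z /andP[? ?] /andP[? ?]; rewrite mulr_ge0//= mulr_ile1.
Qed.

(** * An exponential maximal inequality *)

Section finite_probability.
Context {R : realType} {disp : measure_display} {T : measurableType disp}.
Variable P : probability T R.

Definition Pr (A : set T) : R := fine (P A).

Lemma PrE A : measurable A -> P A = (Pr A)%:E.
Proof. by move=> mA; rewrite /Pr fineK// fin_num_measure. Qed.

Lemma Pr_ge0 A : 0 <= Pr A.
Proof. exact: fine_ge0. Qed.

Lemma le_Pr A B : measurable A -> measurable B -> A `<=` B -> Pr A <= Pr B.
Proof. by move=> mA mB AB; rewrite -lee_fin -!PrE// le_measure ?inE. Qed.

Lemma Pr_split A B : measurable A -> measurable B ->
  Pr A = Pr (A `\` B) + Pr (A `&` B).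
Proof.
move=> mA mB; have /(congr1 fine) := measureDI P mA mB.
by rewrite fineD// fin_num_measure//; [exact: measurableD|exact: measurableI].
Qed.

Lemma Pr_cover_le (I : eqType) (s : seq I) (F : I -> set T) (A : set T) :
  measurable A -> (forall i, i \in s -> measurable (F i)) ->
  (forall t, A t -> exists2 i, i \in s & F i t) ->
  Pr A <= \sum_(i <- s) Pr (F i).
Proof.
elim: s A => [|i s IH] A mA mF AF.
  suff -> : A = set0 by rewrite /Pr measure0 big_nil.
  by apply/seteqP; split=> // t /AF[].
have mFi : measurable (F i) by apply: mF; rewrite mem_head.
rewrite big_cons (Pr_split mA mFi) addrC; apply: lerD.
  by apply: le_Pr => //; first exact: measurableI.
apply: IH => [|j js|t [At nF]]; first exact: measurableD.
  by apply: mF; rewrite inE js orbT.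
have [j] := AF t At; rewrite inE => /orP[/eqP -> //|js Fj].
by exists j.
Qed.

Lemma Pr_partition (I : finType) (f : T -> I) (A : set T) : measurable A ->
  (forall i, measurable [set t | f t = i]) ->
  Pr A = \sum_i Pr (A `&` [set t | f t = i]).
Proof.
move=> mA mf.
suff H (s : seq I) B : uniq s -> measurable B -> (forall t, B t -> f t \in s) ->
    Pr B = \sum_(i <- s) Pr (B `&` [set t | f t = i]).
  by rewrite (H (index_enum I)) ?index_enum_uniq// => t _; rewrite mem_index_enum.
elim: s B => [|i s IH] B us mB Bs.
  suff -> : B = set0 by rewrite /Pr measure0 big_nil.
  by apply/seteqP; split=> // t /Bs.
move: us => /= /andP[nis us].
rewrite big_cons (Pr_split mB (mf i)) addrC; congr (_ + _).
rewrite IH//; last 2 first.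
- exact: measurableD.
- by move=> t [/Bs + /eqP/negbTE nf]; rewrite inE nf.
apply: eq_big_seq => j js; congr Pr; apply/seteqP; split=> t /=.
  by move=> [[Bt _] fj].
move=> [Bt fj]; split=> //; split=> // fi.
by move: nis; rewrite -fi fj js.
Qed.

(** The set is a finite union of cylinders. This settles the measurability of events quantified over
    partial sums. *)
Lemma measurable_finite_dependence (D : finType) (V : nat -> T -> D) (Q : nat)
    (A : set T) :
  (forall q x, measurable [set t | V q t = x]) ->
  (forall t t', (forall q, (q < Q)%N -> V q t = V q t') -> A t -> A t') ->
  measurable A.
Proof.
move=> mV hA.
pose W t : {ffun 'I_Q -> D} := [ffun q : 'I_Q => V q t].
have mW w : measurable [set t | W t = w].
  have -> : [set t | W t = w] = \bigcap_(q in [set: 'I_Q]) [set t | V q t = w q].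
    apply/seteqP; split=> t /=.
      by move=> <- q _ /=; rewrite ffunE.
    by move=> h; apply/ffunP => q; rewrite ffunE; exact: h.
  by apply: fin_bigcap_measurable => // q _; exact: mV.
have -> : A = \bigcup_(w in W @` A) [set t | W t = w].
  apply/seteqP; split=> t; first by move=> At; exists (W t) => //; exists t.
  move=> [_ [t' At' <-] /= e]; apply: hA At' => q qQ.
  have := congr1 (fun f : {ffun 'I_Q -> D} => f (Ordinal qQ)) e.
  by rewrite !ffunE.
by apply: fin_bigcup_measurable.
Qed.

End finite_probability.

Section maximal_inequality.
Context {R : realType} {disp : measure_display} {T : measurableType disp}.
Variable P : probability T R.

Lemma expR_le_quadratic (s : R) : `|s| <= 2^-1 -> expR s <= 1 + s + 2 * s ^+ 2.
Proof.
rewrite ler_norml => /andP[s1 s2].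
have h1 : 1 - s <= expR (- s) by apply: le_trans (expR_ge1Dx _); rewrite lexx.
have h2 : 0 < 1 - s by lra.
have h3 : expR s <= (1 - s)^-1.
  by rewrite -[expR s]invrK -expRN lef_pV2 ?posrE ?expR_gt0.
apply: le_trans h3 _; rewrite -[leLHS]mul1r ler_pdivrMr//.
have : 0 <= s ^+ 2 * (1 - 2 * s) by rewrite mulr_ge0 ?sqr_ge0//; lra.
by rewrite expr2; lra.
Qed.

(** The exponent carries the mean, as a bound for the variance, and not a constant: between two
    close boxes the mean is small, and chaining depends on that. *)
Lemma bernoulli_mgf (D : finType) (mu : D -> R) (g : D -> bool) (s : R) :
  (forall x, 0 <= mu x) -> \sum_x mu x = 1 -> `|s| <= 2^-1 ->
  \sum_x mu x * expR (s * ((g x)%:R - \sum_x mu x * (g x)%:R))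
    <= expR (2 * s ^+ 2 * \sum_x mu x * (g x)%:R).
Proof.
move=> mu0 mu1 hs; set v := \sum_x mu x * (g x)%:R.
have v0 : 0 <= v by apply: sumr_ge0 => x _; rewrite mulr_ge0.
have -> : \sum_x mu x * expR (s * ((g x)%:R - v))
    = expR (- (s * v)) * (1 + v * (expR s - 1)).
  rewrite -[X in X + _]mu1 {3}/v mulr_suml -big_split /= mulr_sumr.
  apply: eq_bigr => x _; rewrite mulrBr expRD.
  by case: (g x); rewrite ?mulr1 ?mulr0 ?expR0; ring.
have h : 1 + v * (expR s - 1) <= expR (v * (s + 2 * s ^+ 2)).
  apply: le_trans (_ : 1 + v * (s + 2 * s ^+ 2) <= _); last exact: expR_ge1Dx.
  rewrite lerD2l ler_wpM2l//; have := expR_le_quadratic hs; lra.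
apply: le_trans (ler_wpM2l (ltW (expR_gt0 _)) h) _.
by rewrite -expRD ler_expR; nra.
Qed.

Variables (D : finType) (V : nat -> T -> D) (mu : D -> R) (Z : set T) (Q : nat).
Hypothesis mV : forall q x, measurable [set t | V q t = x].
Hypothesis mZ : measurable Z.
Hypothesis mu_ge0 : forall x, 0 <= mu x.
Hypothesis mu_sum : \sum_x mu x = 1.

Definition cyl (w : seq D) : set T := [set t | [seq V q t | q <- iota 0 (size w)] = w].

(** Given Z, the first Q values of V are independent with law [mu]; the formulation by cylinders
    avoids conditional expectations. *)
Hypothesis law : forall w : seq D, (size w <= Q)%N ->
  Pr P (Z `&` cyl w) = Pr P Z * \prod_(x <- w) mu x.

Lemma cyl_rcons w x t : cyl (rcons w x) t <-> cyl w t /\ V (size w) t = x.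
Proof.
rewrite /cyl /= size_rcons -addn1 iotaD map_cat /= add0n cats1.
by split=> [/rcons_inj[-> ->]|[-> ->]].
Qed.

Lemma measurable_cyl w : measurable (cyl w).
Proof.
elim/last_ind: w => [|w x IH].
  by rewrite (_ : cyl [::] = setT)//; apply/seteqP; split.
rewrite (_ : cyl _ = cyl w `&` [set t | V (size w) t = x]).
  exact: measurableI.
by apply/seteqP; split=> t /cyl_rcons.
Qed.

Variables (g : nat -> D -> bool) (s : R).
Hypothesis s_le : `|s| <= 2^-1.

Let v q : R := \sum_x mu x * (g q x)%:R.

Let v_ge0 q : 0 <= v q.
Proof. by apply: sumr_ge0 => x _; rewrite mulr_ge0. Qed.

Definition excess (a : nat) (l : R) : set T :=
  [set t | exists2 Q', (a <= Q' <= Q)%N &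
     l <= s * \sum_(a <= q < Q') ((g q (V q t))%:R - \sum_x mu x * (g q x)%:R)].

Lemma measurable_excess a l : measurable (excess a l).
Proof.
apply: (@measurable_finite_dependence _ _ _ V Q) => // t t' tt' [Q' h1 h2].
exists Q' => //; apply: le_trans h2 _.
rewrite le_eqVlt; apply/orP; left; apply/eqP; congr (_ * _).
apply: eq_big_nat => q /andP[_ qQ]; rewrite tt'//.
by apply: leq_trans qQ _; case/andP: h1.
Qed.

Lemma excess_cyl_le0 w l : (size w <= Q)%N -> l <= 0 ->
  Pr P (Z `&` cyl w `&` excess (size w) l)
    <= Pr P Z * \prod_(x <- w) mu x
       * expR (2 * s ^+ 2 * \sum_(size w <= q < Q) v q - l).
Proof.
move=> wQ l0; have mZw : measurable (Z `&` cyl w).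
  by apply: measurableI => //; exact: measurable_cyl.
rewrite -law//; apply: (@le_trans _ _ (Pr P (Z `&` cyl w))).
  apply: le_Pr => //; apply: measurableI => //; exact: measurable_excess.
rewrite ler_peMr ?Pr_ge0// -expR0 ler_expR subr_ge0 (le_trans l0)//.
by rewrite mulr_ge0 ?sumr_ge0// mulr_ge0// sqr_ge0.
Qed.

(** A stopping argument as an induction over the remaining steps: once the next value x is seen, the
    threshold drops by its contribution, and [bernoulli_mgf] sums the bounds over x. A threshold l
    <= 0 is already reached by the empty sum, and there the bound is at least the mass of the
    cylinder. *)
Lemma excess_cyl_le n w l : (size w + n = Q)%N ->
  Pr P (Z `&` cyl w `&` excess (size w) l)
    <= Pr P Z * \prod_(x <- w) mu x
       * expR (2 * s ^+ 2 * \sum_(size w <= q < Q) v q - l).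
Proof.
elim: n w l => [|n IH] w l wn.
all: have [l0|l0] := leP l 0; first by apply: excess_cyl_le0 => //; rewrite -wn leq_addr.
  rewrite (_ : _ `&` excess _ _ = set0); last first.
    apply/seteqP; split=> // t [_ [Q' /andP[h1 h2]]].
    have -> : Q' = size w by lia.
    by rewrite big_geq// mulr0 leNgt l0.
  by rewrite /Pr measure0 !mulr_ge0 ?fine_ge0 ?expR_ge0 ?prodr_ge0.
have mw := measurable_cyl w.
have mZw : measurable (Z `&` cyl w) by exact: measurableI.
have wQ : (size w < Q)%N by lia.
apply: le_trans (_ : \sum_x Pr P (Z `&` cyl (rcons w x)
    `&` excess (size w).+1 (l - s * ((g (size w) x)%:R - v (size w)))) <= _).
  apply: Pr_cover_le.
  - by apply: measurableI => //; exact: measurable_excess.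
  - move=> x _; apply: measurableI; last exact: measurable_excess.
    by apply: measurableI => //; exact: measurable_cyl.
  move=> t [[Zt wt] [Q' /andP[h1 h2] h3]].
  exists (V (size w) t); first by rewrite mem_index_enum.
  split; first by split=> //; apply/cyl_rcons.
  have h4 : (size w < Q')%N.
    rewrite ltn_neqAle h1 andbT; apply/eqP => e.
    by move: h3; rewrite -e big_geq// mulr0 leNgt l0.
  exists Q'; first by rewrite h4.
  by move: h3; rewrite big_ltn// mulrDr -/(v _) -lerBlDl.
apply: le_trans (_ : \sum_x (Pr P Z * \prod_(y <- w) mu y
   * expR (2 * s ^+ 2 * \sum_((size w).+1 <= q < Q) v q - l))
   * (mu x * expR (s * ((g (size w) x)%:R - v (size w)))) <= _).
  apply: ler_sum => x _.
  have := IH (rcons w x) (l - s * ((g (size w) x)%:R - v (size w))).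
  rewrite size_rcons => /(_ _)/le_trans; apply; first by rewrite -wn addSnnS.
  rewrite -cats1 big_cat big_cons big_nil /= mulr1.
  rewrite opprB addrCA expRD le_eqVlt; apply/orP; left; apply/eqP; ring.
rewrite -mulr_sumr.
apply: le_trans (ler_wpM2l _ (bernoulli_mgf (g (size w)) mu_ge0 mu_sum s_le)) _.
  by rewrite !mulr_ge0 ?Pr_ge0 ?expR_ge0 ?prodr_ge0.
rewrite -/(v _) -[leLHS]mulrA -expRD [in leRHS]big_ltn// le_eqVlt; apply/orP; left; apply/eqP.
by congr (_ * expR _); ring.
Qed.

Lemma maximal_inequality l :
  Pr P (Z `&` excess 0 l)
    <= Pr P Z * expR (2 * s ^+ 2 * \sum_(q < Q) v q - l).
Proof.
have := @excess_cyl_le Q [::] l (add0n Q).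
rewrite big_nil mulr1 big_mkord (_ : cyl [::] = setT) ?setIT//.
by apply/seteqP; split.
Qed.

End maximal_inequality.

(** * Digits of independent uniform variables *)

Section uniform_digits.
Context {R : realType} {disp : measure_display} {T : measurableType disp}.
Variables (P : probability T R) (X : {RV P >-> R}).
Hypothesis X_unif : uniform01 X.

Let X01 t : 0 <= X t < 1. Proof. by case: X_unif. Qed.

Lemma measurable_RV_preimage (A : set R) : measurable A ->
  measurable [set t | A (X t)].
Proof. by move=> mA; rewrite -[X in measurable X]setTI; exact: measurable_funP. Qed.

Lemma Pr_uniform_itv a c : 0 <= a -> a <= c -> c <= 1 ->
  Pr P [set t | a <= X t < c] = c - a.
Proof.
move=> a0 ac c1.
have := X_unif.2 `[a, c[%classic (measurable_itv _).
rewrite /distribution /pushforward /= => E.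
have -> : [set t | a <= X t < c] = X @^-1` `[a, c[%classic.
  by apply/seteqP; split=> t /=; rewrite in_itv.
rewrite /Pr E /uniform_prob.
rewrite (eq_integral (cst 1%E)); last first.
  move=> x; rewrite inE /= in_itv /= => /andP[x1 x2].
  by rewrite /uniform_pdf (le_trans a0 x1) ltW ?(lt_le_trans x2 c1)// subr0 invr1.
rewrite integral_cst//= mul1e.
rewrite lebesgue_measure_itv /= lte_fin; case: ltP => h /=.
  by [].
by apply/esym/eqP; rewrite subr_eq0 eq_le h ac.
Qed.

Lemma Pr_cell (K a : nat) : (a < K)%N ->
  Pr P [set t | Num.truncn (K%:R * X t) = a] = K%:R^-1.
Proof.
move=> aK; have K0 : 0 < K%:R :> R by rewrite ltr0n (leq_ltn_trans _ aK).
have -> : [set t | Num.truncn (K%:R * X t) = a]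
    = [set t | a%:R / K%:R <= X t < a.+1%:R / K%:R].
  have e t : (Num.truncn (K%:R * X t) == a) = (a%:R / K%:R <= X t < a.+1%:R / K%:R).
    rewrite truncn_eq ?ler_pdivrMr ?ltr_pdivlMr ?[X t * _]mulrC//.
    by rewrite mulr_ge0// ?(ltW K0)//; case/andP: (X01 t).
  by apply/seteqP; split=> t /=; rewrite -e => /eqP.
rewrite Pr_uniform_itv.
- by rewrite -mulrBl -natr1 addrAC subrr add0r mul1r.
- by rewrite divr_ge0.
- by rewrite ler_pM2r ?invr_gt0// ler_nat.
- by rewrite ler_pdivrMr// mul1r ler_nat.
Qed.

(** With K = b^a and c = b^L this is the q-th group of L base-b digits of x after position a, read
    as one number below c. *)
Definition superdigit (K c q : nat) (x : R) : nat :=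
  Num.truncn (c%:R * Defs.frac ((K * c ^ q)%:R * x)).

Lemma superdigit_lt K c q x : (0 < c)%N -> (superdigit K c q x < c)%N.
Proof.
move=> c0; have /andP[h1 h2] := frac_itv ((K * c ^ q)%:R * x).
by rewrite /superdigit truncn_lt_nat ?mulr_ge0// gtr_pMr// ltr0n.
Qed.

Lemma truncn_mul_frac (c : nat) (y : R) : (0 < c)%N -> 0 <= y ->
  Num.truncn (c%:R * Defs.frac y) = (Num.truncn (c%:R * y) %% c)%N.
Proof.
move=> c0 y0.
have /andP[h1 h2] := frac_itv y.
have e : y = (Num.truncn y)%:R + Defs.frac y.
  rewrite /Defs.frac (@floor_def _ y (Num.truncn y)%:Z) -?pmulrn; first by rewrite addrC subrK.
  by rewrite addn1 truncn_itv.
have e' : c%:R * y = (c * Num.truncn y)%:R + c%:R * Defs.frac y.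
  by rewrite natrM -mulrDr -e.
rewrite e' truncn_nat_add; last by rewrite mulr_ge0.
rewrite mulnC modnMDl modn_small// truncn_lt_nat ?mulr_ge0//.
by rewrite gtr_pMr// ltr0n.
Qed.

Lemma truncn_mul_divn (c : nat) (y : R) : (0 < c)%N -> 0 <= y ->
  (Num.truncn (c%:R * y) %/ c)%N = Num.truncn y.
Proof.
move=> c0 y0; have := truncn_divn 0 c0 y0.
by rewrite expr1 expr0 mul1r.
Qed.

Lemma measurable_superdigit K c q n :
  measurable [set x : R | superdigit K c q x = n].
Proof.
have -> : [set x : R | superdigit K c q x = n]
    = (fun x : R => c%:R * Defs.frac ((K * c ^ q)%:R * x)) @^-1` `[n%:R, n.+1%:R[%classic.
  have e x : (superdigit K c q x == n) =
     (c%:R * Defs.frac ((K * c ^ q)%:R * x) \in `[n%:R, n.+1%:R[).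
    have /andP[h1 h2] := frac_itv ((K * c ^ q)%:R * x).
    by rewrite in_itv /= /superdigit truncn_eq// mulr_ge0.
  by apply/seteqP; split=> x /=; rewrite -e => /eqP.
rewrite -[X in measurable X]setTI; apply: measurable_funM => //.
exact: measurable_frac_mul.
Qed.

(** The floor of K c^n x is the floor of K x followed by n digits in base c, so prescribing all of
    them selects a single cell of length 1 / (K c^n). *)
Lemma superdigits_eq (K c : nat) (w : seq nat) (a : nat) (x : R) :
  (0 < c)%N -> all (fun y => (y < c)%N) w -> 0 <= x ->
  (Num.truncn (K%:R * x) = a /\
    forall q, (q < size w)%N -> superdigit K c q x = nth 0%N w q) <->
  Num.truncn ((K * c ^ size w)%:R * x) = foldl (fun z y => z * c + y)%N a w.
Proof.
move=> c0; elim/last_ind: w => [|w y IH] wc x0.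
  by rewrite /= expn0 muln1; split=> [[]|].
move: wc; rewrite all_rcons => /andP[yc wc].
have {}IH := IH wc x0.
rewrite size_rcons foldl_rcons.
have y0 : 0 <= (K * c ^ size w)%:R * x by rewrite mulr_ge0.
have e : Num.truncn ((K * c ^ (size w).+1)%:R * x)
    = (Num.truncn ((K * c ^ size w)%:R * x) * c + superdigit K c (size w) x)%N.
  have E : (K * c ^ (size w).+1)%:R * x = c%:R * ((K * c ^ size w)%:R * x).
    by rewrite expnS mulnCA natrM mulrA.
  by rewrite E /superdigit truncn_mul_frac// -(truncn_mul_divn c0 y0) -divn_eq.
rewrite e; split.
  move=> [h1 h2]; rewrite (h2 (size w))// nth_rcons ltnn eqxx.
  congr (_ * _ + _)%N; apply/IH; split=> // q qw.
  by rewrite h2 1?ltnW// ?ltnS ?(ltnW qw)// nth_rcons qw.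
move=> /(divmod_uniq (superdigit_lt _ _ _ c0) yc)[/IH[h1 h2] h3].
split=> // q; rewrite ltnS leq_eqVlt nth_rcons => /orP[/eqP ->|qw].
  by rewrite ltnn eqxx.
by rewrite qw h2.
Qed.

(** The leading part, the floor of K x, is summed out: its K values contribute cells of equal
    length. An entry of w at or above c gives 0 on both sides. *)
Lemma Pr_superdigits (K c : nat) (w : seq nat) : (0 < K)%N -> (0 < c)%N ->
  Pr P [set t | forall q, (q < size w)%N -> superdigit K c q (X t) = nth 0%N w q]
    = \prod_(y <- w) ((y < c)%N%:R / c%:R).
Proof.
move=> K0 c0; set A := (X in Pr P X).
have [wc|] := boolP (all (fun y => (y < c)%N) w); last first.
  move=> /allPn[y yw yc].
  have -> : A = set0.
    apply/seteqP; split=> // t /(_ (index y w)).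
    rewrite index_mem nth_index// => /(_ yw) e.
    by move: yc; rewrite -e superdigit_lt.
  by rewrite /Pr measure0 (big_rem y)//= (negbTE yc) mul0r mul0r.
have mA : measurable A.
  have -> : A = \bigcap_(q in `I_(size w))
      [set t | superdigit K c q (X t) = nth 0%N w q].
    by apply/seteqP; split.
  apply: fin_bigcap_measurable => // q _.
  exact: (measurable_RV_preimage (measurable_superdigit K c q _)).
have fK t : (Num.truncn (K%:R * X t) < K)%N.
  have /andP[h1 h2] := X01 t.
  by rewrite truncn_lt_nat ?mulr_ge0// gtr_pMr// ltr0n.
pose f t : 'I_K := Ordinal (fK t).
have fE (a : 'I_K) : [set t | f t = a] = [set t | Num.truncn (K%:R * X t) = a].
  by apply/seteqP; split=> t /=; [move=> <-|move=> h; apply/val_inj].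
rewrite (@Pr_partition _ _ _ P _ f)//; last first.
  move=> a; rewrite fE.
  have := @measurable_superdigit 1 K 0 a => /measurable_RV_preimage.
  rewrite (_ : mkset _ = [set t | Num.truncn (K%:R * X t) = a])//.
  by apply/seteqP; split=> t /=; rewrite /superdigit expn0 mul1r frac_id.
rewrite (eq_bigr (fun=> (K * c ^ size w)%:R^-1)) => [|a _].
  rewrite sumr_const card_ord.
  rewrite (eq_big_seq (fun=> c%:R^-1)) => [|y /(allP wc) ->]; last by rewrite mul1r.
  rewrite big_const_seq count_predT iter_mulr_1 exprVn.
  rewrite -[LHS]mulr_natl natrM natrX; field.
  by rewrite !lt0r_neq0 ?exprn_gt0 ?ltr0n.
rewrite -(@Pr_cell _ (foldl (fun z y => z * c + y)%N a w)); last first.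
  move: (ltn_ord a) wc; move: (nat_of_ord a) {f fK fE} => a'.
  elim/last_ind: w {A mA} => [|w y IH] aK; first by rewrite expn0 muln1.
  rewrite all_rcons size_rcons foldl_rcons => /andP[yc /IH h].
  by have := h aK; rewrite expnS; nia.
congr Pr; rewrite fE; apply/seteqP; split=> t /=.
  by move=> [h1 h2]; apply/superdigits_eq => //; case/andP: (X01 t).
move=> h.
have /(superdigits_eq K a c0 wc)[_ /(_ h)[h1 h2]] : 0 <= X t by case/andP: (X01 t).
by [].
Qed.

End uniform_digits.

Section rectangles.
Context {R : realType} {disp : measure_display} {T : measurableType disp}.
Variables (P : probability T R) (X : nat -> {RV P >-> R}).
Hypothesis X_indep : independent_RVs [set i | (1 <= i)%N] X.

Lemma Pr_rectangle (d : nat) (B : 'I_d -> set R) : (forall i, measurable (B i)) ->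
  Pr P [set t | forall i : 'I_d, B i (X i.+1 t)]
    = \prod_(i < d) Pr P [set t | B i (X i.+1 t)].
Proof.
move=> mB.
(* Independence is stated for families indexed by all naturals; indices outside 1, ..., d receive
   the whole line. *)
pose B' (j : nat) : set R := if insub j.-1 is Some i then B i else setT.
have B'E (i : 'I_d) : B' i.+1 = B i by rewrite /B' /= valK.
have mB' j : measurable (B' j) by rewrite /B'; case: insubP.
have := @X_indep (index_iota 1 d.+1) B' (iota_uniq _ _) _ mB'.
have h i : i \in index_iota 1 d.+1 -> [set i | (1 <= i)%N] i.
  by rewrite mem_index_iota => /andP[].
move=> /(_ h); rewrite big_add1 big_mkord /=.
under eq_bigr => i _ do rewrite B'E.
move=> /(congr1 fine).
have -> : (\prod_(i < d) P (X i.+1 @^-1` B i))%E = (\prod_(i < d) Pr P [set t | B i (X i.+1 t)])%:E.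
  rewrite -prodEFin; apply: eq_bigr => i _; rewrite -PrE//.
  exact: measurable_RV_preimage.
move=> /= <-; congr (fine (P _)); apply/seteqP; split=> t /=.
  move=> h' j /=; rewrite mem_index_iota => /andP[j0 jd].
  have jd' : (j.-1 < d)%N by case: j j0 jd.
  have := h' (Ordinal jd'); rewrite /= prednK// -(B'E (Ordinal jd')) /= prednK//.
move=> h' i; rewrite -B'E.
apply: (h' i.+1); change (is_true (i.+1 \in index_iota 1 d.+1)).
by rewrite mem_index_iota; apply/andP; split=> //; exact: (ltn_ord i).
Qed.

End rectangles.

(** * Discrepancy within a block *)

Section block_points.
Context {R : realType} {disp : measure_display} {T : measurableType disp}.
Variables (P : probability T R) (X : nat -> {RV P >-> R}).
Variables (d m : nat).
Implicit Types (x : 'I_d -> R) (n : nat) (t : T).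

Definition is_halton : pred 'I_d := fun i => halton_phase m i.+1.
Definition lac (i : 'I_d) : nat := lac_base i.+1.

Lemma lac_ge i : ~~ is_halton i -> (0 < i)%N /\ (2 * i.+1 <= lac i)%N.
Proof.
move=> hi; split; last exact: lac_base_ge.
by rewrite lt0n; apply: contra hi => /eqP i0; rewrite /is_halton /halton_phase i0.
Qed.

Definition point n t : 'I_d -> R :=
  fun i => coord_orbit i.+1 (X i.+1 t) (block_start m + n).+1.

Definition in_box x n t : bool := [forall i, point n t i < x i].

Definition in_halton x n t : bool := [forall i, is_halton i ==> (point n t i < x i)].

Definition lac_vol x : R := \prod_(i | ~~ is_halton i) x i.

(* Conditionally on the van der Corput coordinates, the expectation of in_box
   is the product in_halton * lac_vol. *)
Definition deviation (lo up : 'I_d -> R) n t : R :=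
  ((in_box up n t)%:R - (in_box lo n t)%:R)
  - ((in_halton up n t)%:R * lac_vol up - (in_halton lo n t)%:R * lac_vol lo).

End block_points.

Lemma sum_ord_lt (R : pzSemiRingType) (n C : nat) :
  \sum_(c < n) (c < C)%N%:R = (minn n C)%:R :> R.
Proof.
elim: n => [|n IH]; first by rewrite big_ord0 min0n.
rewrite big_ord_recr /= IH -natrD; congr (_%:R).
by case: ltnP => h; lia.
Qed.

(** * One nested pair of boxes along one residue class of times *)

Section block_pair.
Context {R : realType} {disp : measure_display} {T : measurableType disp}.
Variables (P : probability T R) (X : nat -> {RV P >-> R}).
Hypothesis X_indep : independent_RVs [set i | (1 <= i)%N] X.
Hypothesis X_unif : forall i, (1 <= i)%N -> uniform01 (X i).
Variables (d m L r : nat) (lo up : 'I_d -> R).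
Hypothesis rL : (r < L)%N.
Local Notation hal := (@is_halton d m).
Hypothesis lo_ge0 : forall i, 0 <= lo i.
Hypothesis lo_up : forall i, lo i <= up i.
Hypothesis up_le1 : forall i, up i <= 1.
Hypothesis lo_grid : on_grid hal (@lac d) L lo.
Hypothesis up_grid : on_grid hal (@lac d) L up.

Let X01 (i : 'I_d) t : 0 <= X i.+1 t < 1. Proof. by case: (X_unif (ltn0Sn i)). Qed.

(** A van der Corput coordinate gets a single cell, so its digit is constantly 0 and the digit
    vectors can be indexed by all d coordinates. M is a common range for the digits; the weights
    below vanish on the surplus values. *)
Let cells (i : 'I_d) : nat := if hal i then 1%N else (lac i ^ L)%N.
Let cells_gt0 i : (0 < cells i)%N.
Proof. by rewrite /cells; case: ifP => // _; rewrite expn_gt0 expn_gt0. Qed.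
Let M : nat := (\sum_i cells i)%N.
Let cells_le i : (cells i <= M)%N.
Proof. by rewrite /M (bigD1 i)//= leq_addr. Qed.
Let D : finType := {ffun 'I_d -> 'I_M.+1}.

Let dig (i : 'I_d) (q : nat) (y : R) : nat :=
  superdigit (lac i ^ (block_start m + r)) (cells i) q y.
Let dig_lt i q y : (dig i q y < cells i)%N.
Proof. exact: superdigit_lt. Qed.
Let dig_le i q y : (dig i q y < M.+1)%N.
Proof. by rewrite ltnS (leq_trans (ltnW (dig_lt i q y))). Qed.

Let pat (i : 'I_d) (n : nat) (y : R) : bool * bool :=
  if hal i then
    (coord_orbit i.+1 y (block_start m + n).+1 < lo i,
     coord_orbit i.+1 y (block_start m + n).+1 < up i)
  else (false, false).

(* U t is everything the van der Corput coordinates contribute to the block, and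
   V q t holds the L digits of every lacunary coordinate that decide membership
   in the boxes at time r + L q; for distinct q these digits are disjoint. *)
Let pattern : finType := {ffun 'I_d * 'I_(2 ^ m).+1 -> bool * bool}.
Let U t : pattern := [ffun z : 'I_d * 'I_(2 ^ m).+1 => pat z.1 z.2 (X z.1.+1 t)].
Let V q t : D := [ffun i => inord (dig i q (X i.+1 t))].
Let weight (i : 'I_d) (c : nat) : R := (c < cells i)%N%:R / (cells i)%:R.
Let mu (y : D) : R := \prod_i weight i (y i).

Let weight_ge0 i c : 0 <= weight i c.
Proof. by rewrite /weight divr_ge0. Qed.

Let mu_ge0 y : 0 <= mu y.
Proof. by apply: prodr_ge0. Qed.

Let cells0 i : (cells i)%:R != 0 :> R.
Proof. by rewrite pnatr_eq0 -lt0n. Qed.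

Let mu_sum : \sum_y mu y = 1.
Proof.
rewrite -(bigA_distr_bigA (fun (i : 'I_d) (c : 'I_M.+1) => weight i c)).
apply: big1 => i _; rewrite -mulr_suml sum_ord_lt (minn_idPr _) ?divff//.
exact: leqW.
Qed.

Let cnt (x : 'I_d -> R) (i : 'I_d) : nat := Num.truncn ((lac i)%:R ^+ L * x i).

Let cntE (x : 'I_d -> R) i : on_grid hal (@lac d) L x -> ~~ hal i ->
  (cnt x i <= lac i ^ L)%N /\ x i = (cnt x i)%:R / (lac i)%:R ^+ L.
Proof.
move=> gx hi; have [C hC e] := gx i hi.
have [_ li] := lac_ge hi.
have l0 : 0 < (lac i)%:R ^+ L :> R by rewrite exprn_gt0// ltr0n; lia.
suff -> : cnt x i = C by [].
by rewrite /cnt e mulrC mulfVK ?lt0r_neq0// natrK.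
Qed.

Let in_lac (x : 'I_d -> R) (y : D) : bool :=
  [forall i, ~~ hal i ==> (y i < cnt x i)%N].

Let mean_in_lac x : on_grid hal (@lac d) L x ->
  \sum_y mu y * (in_lac x y)%:R = lac_vol m x.
Proof.
move=> gx.
pose f (i : 'I_d) (c : 'I_M.+1) : R := weight i c * (hal i || (c < cnt x i)%N)%:R.
have -> : \sum_y mu y * (in_lac x y)%:R = \sum_(y : D) \prod_i f i (y i).
  apply: eq_bigr => y _; rewrite /f big_split /=; congr (_ * _).
  case: (boolP (in_lac x y)) => [/forallP h|].
    by rewrite big1// => i _; have := h i; case: (hal i) => //= ->.
  rewrite negb_forall => /existsP[i]; rewrite negb_imply => /andP[hi hc].
  by rewrite (bigD1 i)//= (negbTE hi) (negbTE hc) mul0r.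
rewrite -bigA_distr_bigA /lac_vol [RHS]big_mkcond /=.
apply: eq_bigr => i _; rewrite /f.
case: ifPn => hi.
  have [c1 c2] := cntE gx hi.
  have e : cells i = (lac i ^ L)%N by rewrite /cells (negbTE hi).
  rewrite (negbTE hi) /= (eq_bigr (fun c : 'I_M.+1 => (c < cnt x i)%N%:R / (cells i)%:R)).
    rewrite -mulr_suml sum_ord_lt (minn_idPr _); first by rewrite e natrX -c2.
    by rewrite leqW// (leq_trans c1)// -e.
  move=> c _; rewrite /weight; case: (ltnP c (cnt x i)) => h /=; last by rewrite mulr0 mul0r.
  by rewrite mulr1 e (leq_trans h).
move/negPn: hi => hi.
under eq_bigr => c _ do rewrite hi mulr1.
rewrite -mulr_suml sum_ord_lt (minn_idPr _) ?divff//.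
exact: leqW.
Qed.

Let measurable_cmp (i : 'I_d) n (c : R) (e : bool) :
  measurable [set y : R | 0 <= y < 1 /\
    (coord_orbit i.+1 y (block_start m + n).+1 < c) = e].
Proof.
have mo := @measurable_coord_orbit R i.+1 (block_start m + n) isT.
have I01 : measurable (`[0%R, 1%R[%classic : set R) by exact: measurable_itv.
case: e.
  have := mo I01 `]-oo, c[%classic (measurable_itv _).
  rewrite (_ : _ `&` _ = [set y : R | 0 <= y < 1 /\
    (coord_orbit i.+1 y (block_start m + n).+1 < c) = true])//.
have := mo I01 `[c, +oo[%classic (measurable_itv _).
rewrite (_ : _ `&` _ = [set y : R | 0 <= y < 1 /\
    (coord_orbit i.+1 y (block_start m + n).+1 < c) = false])//.
apply/seteqP; split=> y /=; rewrite !in_itv /= andbT => -[h1 h2]; split=> //.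
  by apply/negbTE; rewrite -leNgt.
by rewrite leNgt h2.
Qed.

(** The joint event splits into one Borel set per coordinate. It includes 0 <= y < 1 because the
    measurability of the orbits is established on that interval. *)
Let Bset (u : pattern) (w : seq D) (i : 'I_d) : set R :=
  [set y | [/\ 0 <= y < 1, forall n : 'I_(2 ^ m).+1, pat i n y = u (i, n) &
    forall q, (q < size w)%N -> dig i q y = nth 0%N [seq (z i : nat) | z : D <- w] q]].

Let measurable_Bset u w i : measurable (Bset u w i).
Proof.
have I01 : measurable (`[0%R, 1%R[%classic : set R) by exact: measurable_itv.
have -> : Bset u w i = (`[0%R, 1%R[%classic : set R)
   `&` \bigcap_(n in [set: 'I_(2 ^ m).+1]) [set y : R | 0 <= y < 1 /\ pat i n y = u (i, n)]
   `&` \bigcap_(q in `I_(size w))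
      [set y | dig i q y = nth 0%N [seq (z i : nat) | z : D <- w] q].
  apply/seteqP; split=> y.
    move=> [y01 h1 h2]; split; first by split=> [|n _ //]; rewrite /= in_itv.
    by move=> q /= qw; exact: h2.
  move=> [[/= y01 h1] h2]; rewrite in_itv /= in y01; split=> //.
  by move=> n; case: (h1 n Logic.I).
apply: measurableI; last first.
  by apply: fin_bigcap_measurable => // q _; exact: measurable_superdigit.
apply: measurableI => //; apply: fin_bigcap_measurable => // n _.
rewrite /pat; case: (hal i); last first.
  case: (u (i, n)) => -[] [].
  1-3: by rewrite (_ : mkset _ = set0)//; apply/seteqP; split=> // y [].
  rewrite (_ : mkset _ = (`[0%R, 1%R[%classic : set R))//.
  by apply/seteqP; split=> y /=; rewrite in_itv //= => -[].
case: (u (i, n)) => e1 e2.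
have := measurableI _ _ (@measurable_cmp i n (lo i) e1) (@measurable_cmp i n (up i) e2).
congr measurable; apply/seteqP; split=> y /=.
  by move=> [[-> ->] [_ ->]].
by move=> [-> [-> ->]].
Qed.

(** On each coordinate one of the two constraints is degenerate: a van der Corput coordinate has
    only the digit 0, a lacunary one only the pattern (false, false). So no independence between the
    orbit and the digits of one and the same variable is involved. *)
Let law_coord u w i :
  Pr P [set t | Bset u w i (X i.+1 t)]
    = Pr P [set t | Bset u [::] i (X i.+1 t)] * \prod_(y <- w) weight i (y i).
Proof.
have XU := X_unif (ltn0Sn i).
have [hi|hi] := boolP (hal i).
  have c1 : cells i = 1%N by rewrite /cells hi.
  have dig0 q y : dig i q y = 0%N by have := dig_lt i q y; rewrite c1; lia.
  have [w0|] := boolP (all (fun y : D => y i == 0%N :> nat) w).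
    rewrite (eq_big_seq (fun=> 1)) => [|y /(allP w0)/eqP y0]; last first.
      by rewrite /weight y0 c1 divr1.
    rewrite big1// mulr1; congr Pr; apply/seteqP; split=> t /= [h1 h2 h3]; split=> //.
    move=> q qw; rewrite dig0 (nth_map [ffun=> ord0])//.
    by apply/esym/eqP/(allP w0)/mem_nth.
  move=> /allPn[y yw y0].
  have wy : weight i (y i) = 0 by rewrite /weight c1 ltnS leqn0 (negbTE y0) mul0r.
  rewrite (big_rem y)//= wy mul0r mulr0.
  rewrite (_ : mkset _ = set0) ?/Pr ?measure0//.
  apply/seteqP; split=> // t [_ _ /(_ (seq.index y w))].
  rewrite index_mem yw dig0 (nth_map [ffun=> ord0]) ?index_mem// nth_index// => /(_ isT) e.
  by rewrite -e eqxx in y0.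
have patE n y : pat i n y = (false, false) by rewrite /pat (negbTE hi).
have [h|h] := pselect (forall n : 'I_(2 ^ m).+1, u (i, n) = (false, false)).
  rewrite (_ : [set t | Bset u [::] i (X i.+1 t)] = setT); last first.
    by apply/seteqP; split=> // t _; split=> // n; rewrite patE h.
  rewrite {2}/Pr probability_setT mul1r.
  have L0 : (0 < lac i ^ (block_start m + r))%N by rewrite expn_gt0 expn_gt0.
  rewrite -(big_map (fun y : D => y i : nat) predT (weight i)).
  rewrite -(Pr_superdigits XU _ L0 (cells_gt0 i)) size_map.
  congr Pr; apply/seteqP; split=> t /=; first by move=> [].
  by move=> h'; split=> // n; rewrite patE h.
have e0 w' : [set t | Bset u w' i (X i.+1 t)] = set0.
  apply/seteqP; split=> // t [_ h1 _]; apply: h => n.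
  by rewrite -h1 patE.
by rewrite !e0 /Pr measure0 mul0r.
Qed.

Let cylP w t : cyl V w t <-> forall q, (q < size w)%N -> V q t = nth [ffun=> ord0] w q.
Proof.
split=> [<- q|h].
  by rewrite size_map size_iota => qw; rewrite (nth_map 0%N) ?size_iota// nth_iota.
apply: (@eq_from_nth _ [ffun=> ord0]); rewrite size_map size_iota// => q qw.
by rewrite (nth_map 0%N) ?size_iota// nth_iota// h.
Qed.

Let rectangle u w :
  [set t | U t = u] `&` cyl V w = [set t | forall i : 'I_d, Bset u w i (X i.+1 t)].
Proof.
apply/seteqP; split=> t /=.
  move=> [<- /cylP h] i; split=> //; first by move=> n; rewrite ffunE.
  move=> q qw; rewrite (nth_map [ffun=> ord0])// -h// ffunE inordK//.
move=> h; split.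
  by apply/ffunP => -[i n]; rewrite ffunE; case: (h i).
apply/cylP => q qw; apply/ffunP => i; rewrite ffunE; apply/val_inj.
by case: (h i) => _ _ /(_ q qw); rewrite (nth_map [ffun=> ord0])//= => <-; rewrite inordK.
Qed.

Let law u w : Pr P ([set t | U t = u] `&` cyl V w)
  = Pr P [set t | U t = u] * \prod_(y <- w) mu y.
Proof.
have Uu : [set t | U t = u] = [set t | forall i : 'I_d, Bset u [::] i (X i.+1 t)].
  by rewrite -rectangle (_ : cyl V [::] = setT) ?setIT//; apply/seteqP; split.
rewrite rectangle Uu !(Pr_rectangle X_indep); try by move=> i; exact: measurable_Bset.
rewrite /mu exchange_big /= -big_split /=; apply: eq_bigr => i _.
exact: law_coord.
Qed.

Let measurable_U u : measurable [set t | U t = u].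
Proof.
have -> : [set t | U t = u] = \bigcap_(i in [set: 'I_d]) [set t | Bset u [::] i (X i.+1 t)].
  have -> : [set t | U t = u] = [set t | forall i : 'I_d, Bset u [::] i (X i.+1 t)].
    by rewrite -rectangle (_ : cyl V [::] = setT) ?setIT//; apply/seteqP; split.
  by apply/seteqP; split=> t /= h i; [move=> _|]; exact: h.
apply: fin_bigcap_measurable => // i _.
exact: (measurable_RV_preimage _ (@measurable_Bset u [::] i)).
Qed.

Let measurable_V q y : measurable [set t | V q t = y].
Proof.
have -> : [set t | V q t = y] = \bigcap_(i in [set: 'I_d]) [set t | dig i q (X i.+1 t) = y i].
  apply/seteqP; split=> t /=.
    by move=> <- i _ /=; rewrite ffunE inordK.
  by move=> h; apply/ffunP => i; rewrite ffunE; apply/val_inj; rewrite /= inordK//; exact: h.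
apply: fin_bigcap_measurable => // i _.
exact: (measurable_RV_preimage _ (@measurable_superdigit R _ _ _ _)).
Qed.

Let time q := (r + L * q)%N.
Let Q := ((2 ^ m + (L.-1 - r)) %/ L)%N.

Let time_lt q : (q < Q)%N -> (time q < 2 ^ m)%N.
Proof.
move=> qQ; have h : (q.+1 * L <= 2 ^ m + (L.-1 - r))%N.
  by rewrite -leq_divRL// (leq_ltn_trans _ rL).
by move: h; rewrite /time mulSn mulnC; lia.
Qed.

Let in_halton_pat t q : (q < Q)%N ->
  in_halton X m up (time q) t
    = [forall i, hal i ==> (U t (i, inord (time q))).2] /\
  in_halton X m lo (time q) t
    = [forall i, hal i ==> (U t (i, inord (time q))).1].
Proof.
move=> /time_lt qQ; split; apply: eq_forallb => i.
all: rewrite ffunE /= /pat /point inordK 1?leqW//.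
all: by case: (hal i).
Qed.

(** A lacunary corner has the form C / b^L, so lying below it is decided by the next L digits: their
    [superdigit] must be less than C. This is why corners are rounded to a grid, and what makes the
    visits along a class depend on disjoint digits. *)
Let in_boxE x t q : on_grid hal (@lac d) L x -> (q < Q)%N ->
  in_box X m x (time q) t = in_halton X m x (time q) t && in_lac x (V q t).
Proof.
move=> gx /time_lt qQ.
have key i : ~~ hal i -> (point X m (time q) t i < x i) = (V q t i < cnt x i)%N.
  move=> hi; have [c1 c2] := cntE gx hi.
  have [_ li] := lac_ge hi.
  have l0 : 0 < (lac i)%:R ^+ L :> R by rewrite exprn_gt0// ltr0n; lia.
  rewrite c2 ltr_pdivlMr// ffunE inordK// /point block_lacunary//.
  rewrite /dig /superdigit /cells (negbTE hi) truncn_lt_nat; last first.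
    by rewrite mulr_ge0//; case/andP: (frac_itv ((lac i ^ (block_start m + r)
      * (lac i ^ L) ^ q)%:R * X i.+1 t)).
  rewrite -expnM -expnD -addnA -/(time q) natrX natrX mulrC.
  by rewrite -/(lac i).
apply/forallP/andP => [h|[/forallP h1 /forallP h2] i].
  split; apply/forallP => i; apply/implyP => hi; first exact: h.
  by rewrite -key.
have [hi|hi] := boolP (hal i); first by have := h1 i; rewrite hi.
by rewrite key//; have := h2 i; rewrite hi.
Qed.

Let in_lac_mono y : in_lac lo y -> in_lac up y.
Proof.
move=> /forallP h; apply/forallP => i; apply/implyP => hi.
have := h i; rewrite hi /= => /leq_trans; apply; apply: le_truncn.
by rewrite ler_wpM2l// exprn_ge0.
Qed.

Let in_halton_mono n t : in_halton X m lo n t -> in_halton X m up n t.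
Proof.
move=> /forallP h; apply/forallP => i; apply/implyP => hi.
by have := h i; rewrite hi /= => /lt_le_trans; apply.
Qed.

Let natr_andb_diff (a b c e : bool) : (c ==> a) -> (e ==> b) ->
  ((a && b) && ~~ (c && e))%:R = a%:R * b%:R - c%:R * e%:R :> R.
Proof. by case: a; case: b; case: c; case: e => //= _ _; ring. Qed.

(** Nesting of the boxes turns the difference of two indicators into a single truth value, the form
    taken by the maximal inequality. The pattern u is frozen so that only the digits y are
    random. *)
Let g (u : pattern) (q : nat) (y : D) : bool :=
  ([forall i, hal i ==> (u (i, inord (time q))).2] && in_lac up y) &&
  ~~ ([forall i, hal i ==> (u (i, inord (time q))).1] && in_lac lo y).

Let gE t q y : (q < Q)%N ->
  (g (U t) q y)%:R = (in_halton X m up (time q) t)%:R * (in_lac up y)%:R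
    - (in_halton X m lo (time q) t)%:R * (in_lac lo y)%:R :> R.
Proof.
move=> qQ; have [e1 e2] := in_halton_pat t qQ.
rewrite /g -e1 -e2 natr_andb_diff//; apply/implyP.
  exact: in_halton_mono.
exact: in_lac_mono.
Qed.

Let mean_g t q : (q < Q)%N ->
  \sum_y mu y * (g (U t) q y)%:R
    = (in_halton X m up (time q) t)%:R * lac_vol m up
    - (in_halton X m lo (time q) t)%:R * lac_vol m lo.
Proof.
move=> qQ; rewrite -!mean_in_lac// !mulr_sumr -sumrB; apply: eq_bigr => y _.
by rewrite gE//; ring.
Qed.

Let deviationE t q : (q < Q)%N ->
  (g (U t) q (V q t))%:R - \sum_y mu y * (g (U t) q y)%:R
    = deviation X m lo up (time q) t.
Proof.
move=> qQ; rewrite mean_g// gE// /deviation !in_boxE// -!mulnb !natrM.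
by [].
Qed.

Definition class_excess (s l : R) : set T :=
  [set t | exists2 N, (N <= 2 ^ m)%N &
     l <= s * \sum_(n < N | (n %% L == r)%N) deviation X m lo up n t].

Let class_sum t N : (N <= 2 ^ m)%N -> exists2 Q', (Q' <= Q)%N &
  \sum_(n < N | (n %% L == r)%N) deviation X m lo up n t
    = \sum_(q < Q') deviation X m lo up (time q) t.
Proof.
move=> Nm; exists ((N + (L.-1 - r)) %/ L)%N; first by rewrite leq_div2r// leq_add2r.
exact: (sum_residue_class (fun n => deviation X m lo up n t) N rL).
Qed.

Let class_excess_excess s l t :
  class_excess s l t -> excess V mu Q (g (U t)) s 0 l t.
Proof.
move=> [N Nm h]; have [Q' Q'Q e] := class_sum t Nm.
exists Q' => //; apply: le_trans h _; rewrite e big_mkord.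
rewrite le_eqVlt; apply/orP; left; apply/eqP; congr (_ * _).
by apply: eq_bigr => q _; rewrite deviationE// (leq_trans _ Q'Q).
Qed.

Lemma measurable_class_excess s l : measurable (class_excess s l).
Proof.
apply: (@measurable_finite_dependence _ _ (pattern * D)%type
  (fun q t => (U t, V q t)) Q.+1).
  move=> q [u y].
  have -> : [set t | (U t, V q t) = (u, y)] = [set t | U t = u] `&` [set t | V q t = y].
    by apply/seteqP; split=> t /=; [move=> [-> ->]|move=> [-> ->]].
  exact: measurableI.
move=> t t' h [N Nm]; have [Q' Q'Q e] := class_sum t Nm.
have -> : \sum_(n < N | (n %% L == r)%N) deviation X m lo up n t
    = \sum_(n < N | (n %% L == r)%N) deviation X m lo up n t'.
  rewrite !(sum_residue_class (fun n => deviation X m lo up n _) N rL).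
  have Q'Q' : ((N + (L.-1 - r)) %/ L <= Q)%N by rewrite leq_div2r// leq_add2r.
  apply: eq_bigr => q _; have qQ : (q < Q)%N by exact: leq_trans Q'Q'.
  rewrite -!deviationE//.
  by have [-> ->] := h q (ltnW qQ).
by move=> hl; exists N.
Qed.

(** Total probability over the values of [U]: given [U t = u] the centring is deterministic and the
    maximal inequality applies. The means are nonnegative by nesting, so their sum over the class is
    at most the sum over the block. *)
Lemma Pr_class_excess s l W : `|s| <= 2^-1 ->
  (forall t, \sum_(n < 2 ^ m) ((in_halton X m up n t)%:R * lac_vol m up
      - (in_halton X m lo n t)%:R * lac_vol m lo) <= W) ->
  Pr P (class_excess s l) <= expR (2 * s ^+ 2 * W - l).
Proof.
move=> hs hW.
rewrite (@Pr_partition _ _ _ P _ U)//; last exact: measurable_class_excess.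
rewrite -[leRHS]mul1r -[X in X * _](_ : Pr P setT = 1); last by rewrite /Pr probability_setT.
rewrite (@Pr_partition _ _ _ P _ U)// mulr_suml; apply: ler_sum => u _.
rewrite setTI.
have mE : measurable (excess V mu Q (g u) s 0 l) by exact: measurable_excess.
apply: le_trans (_ : Pr P ([set t | U t = u] `&` excess V mu Q (g u) s 0 l) <= _).
  apply: le_Pr.
  - by apply: measurableI => //; exact: measurable_class_excess.
  - exact: measurableI.
  - by move=> t [h e]; split=> //; rewrite -e; exact: class_excess_excess.
(* The bound by W is available only at sample points, so a value u that is never attained is treated
   apart. *)
have [[t tu]|nu] := pselect (exists t, U t = u); last first.
  have -> : [set t | U t = u] = set0.
    by apply/seteqP; split=> // t e; apply: nu; exists t.
  by rewrite set0I /Pr measure0 mul0r.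
apply: le_trans (_ : Pr P [set t | U t = u]
    * expR (2 * s ^+ 2 * \sum_(q < Q) \sum_y mu y * (g u q y)%:R - l) <= _).
  by apply: maximal_inequality => //; move=> w _; exact: law.
apply: ler_wpM2l; first exact: Pr_ge0.
have s2 : 0 <= 2 * s ^+ 2 by rewrite mulr_ge0// sqr_ge0.
rewrite ler_expR lerD2r ler_wpM2l//.
apply: le_trans (hW t).
rewrite -tu (eq_bigr (fun q : 'I_Q => (in_halton X m up (time q) t)%:R * lac_vol m up
    - (in_halton X m lo (time q) t)%:R * lac_vol m lo)); last first.
  by move=> q _; rewrite mean_g.
rewrite -(sum_residue_class (fun n => (in_halton X m up n t)%:R * lac_vol m up
    - (in_halton X m lo n t)%:R * lac_vol m lo) _ rL).
rewrite big_mkcond /=; apply: ler_sum => n _; case: ifP => // _.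
rewrite subr_ge0.
have v0 : 0 <= lac_vol m lo by apply: prodr_ge0.
have vv : lac_vol m lo <= lac_vol m up.
  by apply: ler_prod => i _; rewrite lo_ge0 lo_up.
have := @in_halton_mono n t; case: (in_halton X m lo n t) => /=.
  by move=> ->//; rewrite !mul1r.
by rewrite mul0r mulr_ge0// (le_trans v0).
Qed.

End block_pair.

(** * Chaining from grid boxes to arbitrary boxes *)

Section block_chaining.
Context {R : realType} {disp : measure_display} {T : measurableType disp}.
Variables (P : probability T R) (X : nat -> {RV P >-> R}).
Hypothesis X_unif : forall i, (1 <= i)%N -> uniform01 (X i).
Variables (d m : nat).
Hypothesis d_gt0 : (0 < d)%N.
Hypothesis m_ge : (10 <= m)%N.
Local Notation hal := (@is_halton d m).
Local Notation lower := (@lower R d hal (@lac d) _).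
Local Notation upper := (@upper R d hal (@lac d) _).
Implicit Types (x : 'I_d -> R) (N k : nat) (t : T).

Let X01 (i : 'I_d) t : 0 <= X i.+1 t < 1. Proof. by case: (X_unif (ltn0Sn i)). Qed.

Let hal0 : hal (Ordinal d_gt0). Proof. by []. Qed.

Lemma point_itv n t (i : 'I_d) : 0 <= point X m n t i < 1.
Proof. exact: coord_orbit_itv. Qed.

Lemma halton_block x N t : (forall i, 0 <= x i <= 1) -> (N <= 2 ^ m)%N ->
  `|\sum_(n < N) (in_halton X m x n t)%:R - N%:R * \prod_(i | hal i) x i|
    <= Num.sqrt (2 ^+ m).
Proof.
move=> x01 Nm.
pose s := [seq i <- index_enum 'I_d | hal i].
have m2 : (2 <= m)%N by apply: leq_trans m_ge.
have hs (i : 'I_d) : i \in s -> [/\ (1 < odd_prime i.+1)%N,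
    residue_cells (odd_prime i.+1) (fun n => point X m n t i) & 0 <= x i <= 1].
  rewrite mem_filter => /andP[hi _].
  have p1 := prime_gt1 (odd_prime_prime i.+1).
  split=> //.
  have -> : (fun n => point X m n t i) = (fun n => iter n (vnk_map (odd_prime i.+1))
      (coord_orbit i.+1 (X i.+1 t) (block_start m).+1)).
    by apply/funext => n; rewrite /point block_halton.
  by apply: residue_cells_vnk => //; exact: coord_orbit_itv.
have us : uniq s by rewrite filter_uniq// index_enum_uniq.
have cs : pairwise (fun i j : 'I_d => coprime (odd_prime i.+1) (odd_prime j.+1)) s.
  apply: (@sub_in_pairwise _ predT [rel i j | i != j]) => [i j _ _ /= ij||].
  - by apply: odd_prime_coprime; rewrite eqSS.
  - by apply/allP.
  - by rewrite -uniq_pairwise.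
have c1 : all (fun i : 'I_d => coprime 1 (odd_prime i.+1)) s.
  by apply/allP => i _; exact: coprime1n.
have := halton_ap 0 m2 Nm hs cs (ltnSn 0) c1.
have E n : (n == 0 %[mod 1]) && all (fun i => point X m n t i < x i) s = in_halton X m x n t.
  rewrite !modn1 eqxx /= all_filter.
  apply/allP/forallP => h i; first by apply: h; rewrite mem_index_enum.
  by move=> _; exact: h.
rewrite divr1 !big_filter (eq_bigr (fun n : 'I_N => (in_halton X m x n t)%:R)); last first.
  by move=> n _; rewrite E.
move=> /le_trans; apply.
rewrite -(@ler_pXn2r _ 2)// ?nnegrE ?sqrtr_ge0//; last first.
  by apply: prodr_ge0 => i _.
rewrite sqr_sqrtr ?exprn_ge0// -natr_prod -!natrX ler_nat.
exact: halton_const m_ge d_gt0.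
Qed.

Lemma vol_split x : vol x = \prod_(i | hal i) x i * lac_vol m x.
Proof. by rewrite /vol (bigID hal). Qed.

Lemma lac_vol_itv x : (forall i, 0 <= x i <= 1) -> 0 <= lac_vol m x <= 1.
Proof.
move=> x01; apply: (big_ind (fun y : R => 0 <= y <= 1)) => //.
  by rewrite ler01 lexx.
by move=> y z /andP[? ?] /andP[? ?]; rewrite mulr_ge0//= mulr_ile1.
Qed.

Lemma halton_mean x N t : (forall i, 0 <= x i <= 1) -> (N <= 2 ^ m)%N ->
  `|\sum_(n < N) (in_halton X m x n t)%:R * lac_vol m x - N%:R * vol x|
    <= Num.sqrt (2 ^+ m).
Proof.
move=> x01 Nm; have /andP[v0 v1] := lac_vol_itv x01.
rewrite -mulr_suml vol_split mulrA -mulrBl normrM (ger0_norm v0).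
apply: le_trans (halton_block t x01 Nm).
by rewrite ler_piMr.
Qed.

Definition fluctuation N x t : R :=
  \sum_(n < N) ((in_box X m x n t)%:R - (in_halton X m x n t)%:R * lac_vol m x).

Lemma sum_deviation N lo up t :
  \sum_(n < N) deviation X m lo up n t = fluctuation N up t - fluctuation N lo t.
Proof. by rewrite /fluctuation -sumrB; apply: eq_bigr => n _; rewrite /deviation; ring. Qed.

Lemma fluctuation0 N t : fluctuation N (fun _ : 'I_d => 0) t = 0.
Proof.
apply: big1 => n _.
have h : point X m n t (Ordinal d_gt0) < 0 = false.
  by apply/negbTE; rewrite -leNgt; case/andP: (point_itv n t (Ordinal d_gt0)).
have -> : in_box X m (fun _ : 'I_d => 0) n t = false.
  by apply/negbTE/forallPn; exists (Ordinal d_gt0); rewrite h.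
have -> : in_halton X m (fun _ : 'I_d => 0) n t = false.
  by apply/negbTE/forallPn; exists (Ordinal d_gt0); rewrite hal0 h.
by rewrite mul0r subr0.
Qed.

Lemma sum_in_box N x t : \sum_(n < N) (in_box X m x n t)%:R
  = fluctuation N x t + \sum_(n < N) (in_halton X m x n t)%:R * lac_vol m x.
Proof. by rewrite /fluctuation -big_split; apply: eq_bigr => n _ /=; rewrite subrK. Qed.

Lemma sum_in_box_mono N x x' t : (forall i, x i <= x' i) ->
  \sum_(n < N) (in_box X m x n t)%:R <= \sum_(n < N) (in_box X m x' n t)%:R :> R.
Proof.
move=> xx'; apply: ler_sum => n _.
case: (boolP (in_box X m x n t)) => // /forallP h.
suff -> : in_box X m x' n t by [].
by apply/forallP => i; apply: lt_le_trans (xx' i).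
Qed.

Definition bracket k x : box_index d k :=
  odflt [ffun=> ord0] [pick j | admissible j && [forall i, lower j i <= x i <= upper j i]].

Lemma bracketP k x : (forall i, 0 <= x i <= 1) ->
  admissible (bracket k x) /\ forall i, lower (bracket k x) i <= x i <= upper (bracket k x) i.
Proof.
move=> x01; rewrite /bracket; case: pickP => [j /andP[Aj /forallP]|nj] //=.
have [j Aj hj] := bracket_exists d_gt0 (@lac_ge d m) k x01.
by have /negbT/negP[] := nj j; rewrite Aj; apply/forallP.
Qed.

(** The predecessor in the chain: the lower corner of the bracket one level up in coarseness. Level
    1 starts from the empty box, where the width bound 4 * 4^-k is 1. *)
Definition parent k x : 'I_d -> R :=
  if k is k'.+2 then lower (bracket k'.+1 x) else fun=> 0.

Lemma box_lower k (j : box_index d k) i : 0 <= lower j i <= 1.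
Proof.
have /andP[h1 h2] := lower_itv (R:=R) d_gt0 (@lac_ge d m) j i.
rewrite h1 (le_trans (lower_le_upper (R:=R) d_gt0 (@lac_ge d m) j i))//.
by case/andP: (upper_itv (R:=R) d_gt0 (@lac_ge d m) j i).
Qed.

Lemma box_upper k (j : box_index d k) i : 0 <= upper j i <= 1.
Proof.
have /andP[h1 h2] := lower_itv (R:=R) d_gt0 (@lac_ge d m) j i.
rewrite (le_trans h1 (lower_le_upper (R:=R) d_gt0 (@lac_ge d m) j i))//.
by case/andP: (upper_itv (R:=R) d_gt0 (@lac_ge d m) j i).
Qed.

Lemma parent_itv k x : (forall i, 0 <= x i <= 1) -> forall i, 0 <= parent k x i <= x i.
Proof.
move=> x01 i; case: k => [|[|k]] /=; try by rewrite lexx; case/andP: (x01 i).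
have [_ /(_ i)/andP[-> _]] := bracketP k.+1 x01.
by rewrite andbT; case/andP: (box_lower (bracket k.+1 x) i).
Qed.

Lemma parent_width k x : (0 < k)%N -> (forall i, 0 <= x i <= 1) ->
  vol x - vol (parent k x) <= 4 * 4 ^- k.
Proof.
case: k => [//|[|k]] _ x01 /=.
  rewrite expr1 divff// /vol [X in _ - X](bigD1 (Ordinal d_gt0))//= mul0r subr0.
  exact: vol_le1.
have [Aj hj] := bracketP k.+1 x01.
apply: le_trans (_ : 4 ^- k.+1 <= _); last first.
  by rewrite [X in _ / X]exprS invfM mulVKf.
apply: le_trans (upper_lower_width (R:=R) d_gt0 (@lac_ge d m) (bracket k.+1 x)).
rewrite lerD2r; apply: ler_prod => i _.
by case/andP: (x01 i) => -> _; case/andP: (hj i).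
Qed.

Lemma on_grid_parent k x : (0 < k)%N -> on_grid hal (@lac d) (k + 2) (parent k x).
Proof.
case: k => [//|[|k]] _ /=.
  by move=> i hi; exists 0%N => //; rewrite mul0r.
rewrite addSn; apply: (on_gridS d_gt0 (@lac_ge d m)).
exact (@on_grid_lower R d hal (@lac d) d_gt0 k.+1 (bracket k.+1 x)).
Qed.

Variables (K : nat) (e : nat -> R).
Hypothesis K_gt0 : (0 < K)%N.

Definition controlled t : Prop :=
  forall k (j : box_index d k) N, (0 < k <= K)%N -> admissible j -> (N <= 2 ^ m)%N ->
  `|\sum_(n < N) deviation X m (parent k (lower j)) (lower j) n t| <= e k /\
  `|\sum_(n < N) deviation X m (lower j) (upper j) n t| <= e k.

(** Telescoping along parents: the parent of a corner of level k + 1 is an admissible lower corner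
    of level k, until the zero box ends the chain. *)
Lemma chain_lower t k (j : box_index d k) N : controlled t ->
  (0 < k <= K)%N -> admissible j -> (N <= 2 ^ m)%N ->
  `|fluctuation N (lower j) t| <= \sum_(1 <= l < k.+1) e l.
Proof.
move=> ct; elim: k j => [//|k IH] j kK Aj Nm.
have [+ _] := ct k.+1 j N kK Aj Nm; rewrite sum_deviation.
set f := fluctuation N (lower j) t; set f' := fluctuation N _ t => h.
have h' : `|f'| <= \sum_(1 <= l < k.+1) e l.
  rewrite /f' /=; case: k IH j kK {Aj h f f'} => [_|k IH] j kK.
    by rewrite fluctuation0 normr0 big_geq.
  have [Ab _] := bracketP k.+1 (box_lower j).
  by apply: IH => //; rewrite /= ltnW//; case/andP: kK.
rewrite big_nat_recr//= -[f](subrK f') addrC.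
exact: le_trans (ler_normD _ _) (lerD h h').
Qed.

(** x is squeezed between the corners of its level K bracket. The four terms are the chain to the
    lower corner, the step to the upper one, the van der Corput error of the conditional mean, and
    the volume between the corners. *)
Lemma chain_bound t x N : controlled t -> (forall i, 0 <= x i <= 1) -> (N <= 2 ^ m)%N ->
  `|\sum_(n < N) (in_box X m x n t)%:R - N%:R * vol x|
    <= \sum_(1 <= l < K.+1) e l + e K + Num.sqrt (2 ^+ m) + 2 ^+ m * 4 ^- K.
Proof.
move=> ct x01 Nm.
have KK : (0 < K <= K)%N by rewrite K_gt0 leqnn.
have [Aj hj] := bracketP K x01.
set j := bracket K x in Aj hj.
have h1 := chain_lower ct KK Aj Nm.
have [_] := ct K j N KK Aj Nm; rewrite sum_deviation => h2.
have h3 := halton_mean t (box_lower j) Nm.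
have h4 := halton_mean t (box_upper j) Nm.
have m1 : \sum_(n < N) (in_box X m (lower j) n t)%:R <= \sum_(n < N) (in_box X m x n t)%:R :> R.
  by apply: sum_in_box_mono => i; case/andP: (hj i).
have m2 : \sum_(n < N) (in_box X m x n t)%:R <= \sum_(n < N) (in_box X m (upper j) n t)%:R :> R.
  by apply: sum_in_box_mono => i; case/andP: (hj i).
rewrite !sum_in_box in m1 m2.
have w := upper_lower_width (R:=R) d_gt0 (@lac_ge d m) j.
have v1 : vol (lower j) <= vol x.
  by apply: ler_prod => i _; case/andP: (box_lower j i) => -> _; case/andP: (hj i).
have v2 : vol x <= vol (upper j).
  by apply: ler_prod => i _; case/andP: (x01 i) => -> _; case/andP: (hj i).
have NH : N%:R <= 2 ^+ m :> R by rewrite -natrX ler_nat.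
have N0 : 0 <= N%:R :> R by [].
have q0 : 0 <= 4 ^- K :> R by rewrite invr_ge0 exprn_ge0.
have wN a b : a <= b -> b - a <= 4 ^- K -> N%:R * b - N%:R * a <= 2 ^+ m * 4 ^- K :> R.
  move=> ab ba; rewrite -mulrBr; apply: ler_pM => //; by rewrite subr_ge0.
have w1 := wN _ _ v1 (le_trans (lerB v2 (lexx _)) w).
have w2 := wN _ _ v2 (le_trans (lerB (lexx _) v1) w).
rewrite sum_in_box.
move: h1 h2 h3 h4; rewrite !ler_norml => /andP[a1 a2] /andP[b1 b2] /andP[c1 c2] /andP[d1 d2].
by apply/andP; split; lra.
Qed.

Lemma all_halton_bound t x N : (forall i, hal i) -> (forall i, 0 <= x i <= 1) ->
  (N <= 2 ^ m)%N ->
  `|\sum_(n < N) (in_box X m x n t)%:R - N%:R * vol x| <= Num.sqrt (2 ^+ m).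
Proof.
move=> ah x01 Nm; have := halton_mean t x01 Nm.
have -> : lac_vol m x = 1 by apply: big_pred0 => i; rewrite ah.
under eq_bigr => n _.
  rewrite mulr1 (_ : in_halton _ _ _ _ _ = in_box X m x n t); first over.
  by apply: eq_forallb => i; rewrite ah.
by [].
Qed.

End block_chaining.

Lemma Pr_setU_le (R : realType) (disp : measure_display) (T : measurableType disp)
    (P : probability T R) (A B : set T) : measurable A -> measurable B ->
  Pr P (A `|` B) <= Pr P A + Pr P B.
Proof.
move=> mA mB; have mAB := measurableU _ _ mA mB.
rewrite (Pr_split P mAB mB); apply: lerD; apply: le_Pr => //.
- exact: measurableD.
- by move=> t [[]].
- exact: measurableI.
Qed.

Lemma sum_inv_exp2 (R : realType) n :
  \sum_(k <- iota 0 n) 2 ^- k.+1 = 1 - 2 ^- n :> R.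
Proof.
elim: n => [|n IH]; first by rewrite big_nil expr0 invr1 subrr.
rewrite -[in LHS]addn1 iotaD big_cat big_cons big_nil IH add0n exprS /=; field.
by rewrite lt0r_neq0// exprn_gt0.
Qed.

Lemma add2_le_exp2 k : (0 < k)%N -> (k + 2 <= 2 ^ k.+1)%N.
Proof. by elim: k => // -[//|k] IH _; have := IH isT; rewrite [(2 ^ k.+3)%N]expnS; lia. Qed.

(** The budget of the union bound at level k, in powers of 2: the number of boxes, the 4 (k + 2) <=
    2^(k+3) events for each box, the target 2d + 5, and k more to sum over levels. The part without
    the factor d is absorbed thanks to d >= 2. *)
Lemma level_exponent_le k d : (2 <= d)%N ->
  ((4 * k + 5) * d + k.+3 + (2 * d + 5) + k <= (5 * k + 11) * d)%N.
Proof.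
move=> d2; have : (k * 2 + 4 * 2 <= k * d + 4 * d)%N by rewrite leq_add// leq_mul2l d2 orbT.
by nia.
Qed.

(** * Failure probability of one block *)

Section block_probability.
Context {R : realType} {disp : measure_display} {T : measurableType disp}.
Variables (P : probability T R) (X : nat -> {RV P >-> R}).
Hypothesis X_indep : independent_RVs [set i | (1 <= i)%N] X.
Hypothesis X_unif : forall i, (1 <= i)%N -> uniform01 (X i).
Variables (d m K : nat) (eps : R).
Hypothesis d_ge2 : (2 <= d)%N.
Hypothesis m_ge : (10 <= m)%N.
Hypothesis K_gt0 : (0 < K)%N.
Hypothesis K_le : (16 ^ K * d <= 2 ^ m)%N.
Hypothesis K_lt : (2 ^ m < 16 ^ K.+1 * d)%N.
Hypothesis eps_gt0 : 0 < eps.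
Hypothesis eps_lt1 : eps < 1.

Let d_gt0 : (0 < d)%N. Proof. exact: ltnW. Qed.
Local Notation hal := (@is_halton d m).
Local Notation lower := (@lower R d hal (@lac d) _).
Local Notation upper := (@upper R d hal (@lac d) _).

Let logeps : R := ln eps^-1.
(** 2^m sigma is the target scale sqrt(d 2^m), and 2^k sigma is the parameter s of the maximal
    inequality at level k. The hypotheses on K say 4^-(K+1) < sigma <= 4^-K. *)
Let sigma : R := Num.sqrt (d%:R / 2 ^+ m).
Let H : R := 2 ^+ m.

Let H_gt0 : 0 < H. Proof. exact: exprn_gt0. Qed.
Let d0 : 0 < d%:R :> R. Proof. by rewrite ltr0n. Qed.

Let logeps_ge0 : 0 <= logeps.
Proof. by rewrite ln_ge0// invf_ge1// ltW. Qed.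

Let sigma_gt0 : 0 < sigma. Proof. by rewrite sqrtr_gt0 divr_gt0. Qed.

Let sigma_sq : H * sigma ^+ 2 = d%:R.
Proof.
rewrite sqr_sqrtr; last by rewrite divr_ge0// ltW.
by rewrite mulrC divfK// lt0r_neq0.
Qed.

Let sigma_le : 4 ^+ K * sigma <= 1.
Proof.
rewrite -(@ler_pXn2r _ 2)// ?nnegrE//; last first.
  by rewrite mulr_ge0 ?exprn_ge0// ltW.
rewrite expr1n exprMn -exprM mulnC exprM.
rewrite -(ler_pM2l H_gt0) mulr1 mulrCA sigma_sq.
rewrite (_ : 4 ^+ 2 = 16%:R); last by ring.
by move: K_le; rewrite -(ler_nat R) natrM !natrX.
Qed.

Let sigma_gt : 1 < 4 ^+ K.+1 * sigma.
Proof.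
rewrite -(@ltr_pXn2r _ 2)// ?nnegrE//; last first.
  by rewrite mulr_ge0 ?exprn_ge0// ltW.
rewrite expr1n exprMn -exprM mulnC exprM.
rewrite -(ltr_pM2l H_gt0) mulr1 mulrCA sigma_sq.
rewrite (_ : 4 ^+ 2 = 16%:R); last by ring.
by move: K_lt; rewrite -(ltr_nat R) natrM !natrX.
Qed.

(** 1/2 is the largest parameter that the maximal inequality admits. It is met because 4^k sigma <=
    1 leaves a factor 2^k >= 2 to spare. *)
Let sigma_le_half k : (0 < k <= K)%N -> 2 ^+ k * sigma <= 2^-1.
Proof.
move=> /andP[k0 kK].
have h : 4 ^+ k * sigma <= 1.
  apply: le_trans sigma_le; rewrite ler_pM2r//.
  by rewrite ler_weXn2l// (ler_nat _ 1 4).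
have e : 4 ^+ k = 2 ^+ k * 2 ^+ k :> R by rewrite -exprMn; congr (_ ^+ _); ring.
have h2 : 2 <= 2 ^+ k :> R.
  by rewrite -[leLHS]expr1 ler_weXn2l// (ler_nat _ 1 2).
have h3 : 0 <= 2 ^+ k * sigma by rewrite mulr_ge0 ?exprn_ge0// ltW.
rewrite e -mulrA in h; nra.
Qed.

Let sqrtH_le k : (k <= K)%N -> Num.sqrt H <= H * 4 ^- k.
Proof.
move=> kK; rewrite ler_pdivlMr ?exprn_gt0//.
have -> : H = Num.sqrt H * Num.sqrt H by rewrite -expr2 sqr_sqrtr// ltW.
rewrite -{1}(_ : Num.sqrt H = Num.sqrt (Num.sqrt H * Num.sqrt H)); last first.
  by rewrite -expr2 sqr_sqrtr// ltW.
rewrite ler_wpM2l ?sqrtr_ge0//.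
rewrite -(@ler_pXn2r _ 2)// ?nnegrE ?exprn_ge0 ?sqrtr_ge0// sqr_sqrtr; last exact: ltW.
rewrite -exprM mulnC exprM (_ : 4 ^+ 2 = 16%:R); last by ring.
rewrite /H -!natrX ler_nat.
apply: leq_trans (_ : 16 ^ K <= _)%N; first by rewrite leq_exp2l.
by apply: leq_trans K_le; rewrite leq_pmulr.
Qed.

(** 5 k + 23 = 12 + (5 k + 11): the quadratic term 2 s^2 W of the exponent equals 12 d at every
    level, and 5 k + 11 pays for the union bound. [lam] is the resulting deviation in one residue
    class, [e] its total over the k + 2 classes. *)
Let level k : R := (5 * k + 23)%:R + logeps.
Let lam k : R := level k * (H * sigma) / 2 ^+ k.
Let e k : R := (k + 2)%:R * lam k.

Let step_lam k : 2 ^+ k * sigma * lam k = level k * d%:R.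
Proof.
rewrite /lam -sigma_sq; field.
by rewrite lt0r_neq0// exprn_gt0.
Qed.

Section pair.
Variables (k : nat) (lo up : 'I_d -> R).
Hypothesis k_itv : (0 < k <= K)%N.
Hypothesis lo_ge0 : forall i, 0 <= lo i.
Hypothesis lo_up : forall i, lo i <= up i.
Hypothesis up_le1 : forall i, up i <= 1.
Hypothesis lo_grid : on_grid hal (@lac d) (k + 2) lo.
Hypothesis up_grid : on_grid hal (@lac d) (k + 2) up.
Hypothesis width : vol up - vol lo <= 4 * 4 ^- k.

Let up01 i : 0 <= up i <= 1.
Proof. by rewrite up_le1 andbT (le_trans (lo_ge0 i)). Qed.

Let lo01 i : 0 <= lo i <= 1.
Proof. by rewrite lo_ge0 (le_trans (lo_up i)). Qed.

(** 6 = 4 + 2: the width of the pair, and the van der Corput error of each of the two boxes, which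
    is below H 4^-k as long as k <= K. *)
Let mean_le t : \sum_(n < 2 ^ m) ((in_halton X m up n t)%:R * lac_vol m up
      - (in_halton X m lo n t)%:R * lac_vol m lo) <= 6 * H * 4 ^- k.
Proof.
rewrite sumrB.
have := halton_mean X_unif d_gt0 m_ge t up01 (leqnn _).
have := halton_mean X_unif d_gt0 m_ge t lo01 (leqnn _).
rewrite !ler_norml => /andP[h1 h2] /andP[h3 h4].
have kK : (k <= K)%N by case/andP: k_itv.
have h5 := sqrtH_le kK.
have : H * (vol up - vol lo) <= H * (4 * 4 ^- k) by rewrite ler_pM2l.
rewrite mulrBr natrX in h1 h2 h3 h4 *.
rewrite -/H in h1 h2 h3 h4 *.
set q := 4 ^- k in h5 *.
lra.
Qed.

Definition bad_pair : set T := \bigcup_(r in `I_(k + 2))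
  (class_excess X m (k + 2) r lo up (2 ^+ k * sigma) (level k * d%:R) `|`
   class_excess X m (k + 2) r lo up (- (2 ^+ k * sigma)) (level k * d%:R)).

Lemma measurable_bad_pair : measurable bad_pair.
Proof.
apply: fin_bigcup_measurable => // r /= rk.
by apply: measurableU; exact: measurable_class_excess.
Qed.

Lemma Pr_bad_pair : Pr P bad_pair
  <= (2 * (k + 2))%:R * (eps / 2 ^+ ((5 * k + 11) * d)).
Proof.
have key s : s ^+ 2 = 4 ^+ k * sigma ^+ 2 -> `|s| <= 2^-1 -> forall r, (r < k + 2)%N ->
    Pr P (class_excess X m (k + 2) r lo up s (level k * d%:R))
      <= eps / 2 ^+ ((5 * k + 11) * d).
  move=> s2 hs r rk.
  have := Pr_class_excess X_indep X_unif rk lo_ge0 lo_up lo_grid up_grid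
    (level k * d%:R) hs mean_le.
  move=> /le_trans; apply.
  have -> : 2 * s ^+ 2 * (6 * H / 4 ^+ k) = 12 * d%:R.
    by rewrite s2 -sigma_sq; field; rewrite lt0r_neq0// exprn_gt0.
  have -> : 12 * d%:R - level k * d%:R = - ((5 * k + 11) * d)%:R - d%:R * logeps.
    by rewrite /level; ring.
  rewrite expRD mulrC; apply: ler_pM; rewrite ?expR_ge0//.
    rewrite -[leRHS](@lnK _ eps) ?posrE// ler_expR.
    have : logeps <= d%:R * logeps by rewrite ler_peMl// ler1n.
    by rewrite /logeps lnV ?posrE//; lra.
  rewrite expRN lef_pV2 ?posrE ?expR_gt0 ?exprn_gt0//.
  rewrite -[X in expR X]mulr1 expRM_natl lerXn2r ?nnegrE ?expR_ge0//.
  by apply: le_trans (expR_ge1Dx 1).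
have kk := sigma_le_half k_itv.
have s0 : 0 <= 2 ^+ k * sigma by rewrite mulr_ge0 ?exprn_ge0// ltW.
have sq : (2 ^+ k * sigma) ^+ 2 = 4 ^+ k * sigma ^+ 2.
  by rewrite exprMn -exprM mulnC exprM; congr (_ ^+ _ * _); ring.
apply: le_trans (_ : \sum_(r <- iota 0 (k + 2)) Pr P
  (class_excess X m (k + 2) r lo up (2 ^+ k * sigma) (level k * d%:R) `|`
   class_excess X m (k + 2) r lo up (- (2 ^+ k * sigma)) (level k * d%:R)) <= _).
  apply: Pr_cover_le; first exact: measurable_bad_pair.
    move=> r; rewrite mem_iota => /andP[_ rk].
    by apply: measurableU; exact: measurable_class_excess.
  move=> t [r /= rk h]; exists r => //; by rewrite mem_iota.
apply: le_trans (_ : \sum_(r <- iota 0 (k + 2)) (2 * (eps / 2 ^+ ((5 * k + 11) * d))) <= _).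
  rewrite big_seq [leRHS]big_seq; apply: ler_sum => r; rewrite mem_iota => /andP[_ rk].
  have m1 s : measurable (class_excess X m (k + 2) r lo up s (level k * d%:R)).
    exact: measurable_class_excess.
  apply: le_trans (Pr_setU_le P (m1 _) (m1 _)) _.
  set E1 := eps / _; rewrite (_ : 2 * E1 = E1 + E1); last by ring.
  apply: lerD; apply: key => //; rewrite ?sqrrN// ?normrN ger0_norm//.
by rewrite big_const_seq count_predT size_iota iter_addr_0 -[leLHS]mulr_natl natrM mulrCA mulrA.
Qed.

Lemma good_pair t N : ~ bad_pair t -> (N <= 2 ^ m)%N ->
  `|\sum_(n < N) deviation X m lo up n t| <= e k.
Proof.
move=> nb Nm.
have s0 : 0 < 2 ^+ k * sigma by rewrite mulr_gt0 ?exprn_gt0.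
have -> : \sum_(n < N) deviation X m lo up n t
   = \sum_(r < k + 2) \sum_(n < N | (n %% (k + 2) == r)%N) deviation X m lo up n t.
  under [RHS]eq_bigr => r _ do rewrite big_mkcond.
  rewrite exchange_big /=; apply: eq_bigr => n _.
  have nk : (n %% (k + 2) < k + 2)%N by rewrite ltn_mod addn2.
  rewrite (bigD1 (Ordinal nk))//= eqxx big1 ?addr0// => r rn.
  case: eqP => // h; move: rn; rewrite -(inj_eq val_inj) /= h eqxx//.
apply: le_trans (ler_norm_sum _ _ _) _.
apply: le_trans (_ : \sum_(r < k + 2) lam k <= _); last first.
  by rewrite sumr_const card_ord -[leLHS]mulr_natl.
apply: ler_sum => r _; rewrite ler_norml.
apply/andP; split; rewrite leNgt; apply/negP => h; apply: nb; exists r => //=.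
  right; exists N => //; rewrite -step_lam mulNr -mulrN ler_pM2l// ltW//.
  by rewrite ltrNr.
by left; exists N => //; rewrite -step_lam ler_pM2l// ltW.
Qed.

End pair.

Let level_bad k : set T := \bigcup_(j in [set j : box_index d k | admissible j])
  (bad_pair k (parent m k (lower j)) (lower j) `|` bad_pair k (lower j) (upper j)).

Let lower_pair k (j : box_index d k) : (0 < k <= K)%N ->
  let lo := parent m k (lower j) in let up := lower j in
  [/\ forall i, 0 <= lo i, forall i, lo i <= up i, forall i, up i <= 1,
     on_grid hal (@lac d) (k + 2) lo & on_grid hal (@lac d) (k + 2) up /\
     vol up - vol lo <= 4 * 4 ^- k].
Proof.
move=> /andP[k0 kK] /=.
have b := box_lower (R:=R) m d_gt0 j.
have p := parent_itv m d_gt0 k b.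
split; try by move=> i; case/andP: (b i); case/andP: (p i).
- exact: on_grid_parent.
- split; first by exact (@on_grid_lower R d hal (@lac d) d_gt0 k j).
  exact: parent_width.
Qed.

Let upper_pair k (j : box_index d k) : (0 < k <= K)%N ->
  let lo := lower j in let up := upper j in
  [/\ forall i, 0 <= lo i, forall i, lo i <= up i, forall i, up i <= 1,
     on_grid hal (@lac d) (k + 2) lo & on_grid hal (@lac d) (k + 2) up /\
     vol up - vol lo <= 4 * 4 ^- k].
Proof.
move=> /andP[k0 kK] /=.
have b := box_lower (R:=R) m d_gt0 j.
have b' := box_upper (R:=R) m d_gt0 j.
split.
- by move=> i; case/andP: (b i).
- by move=> i; exact: (lower_le_upper (R:=R) d_gt0 (@lac_ge d m)).
- by move=> i; case/andP: (b' i).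
- exact (@on_grid_lower R d hal (@lac d) d_gt0 k j).
- split; first by exact (@on_grid_upper R d hal (@lac d) d_gt0 (@lac_ge d m) k j).
  apply: le_trans (upper_lower_width (R:=R) d_gt0 (@lac_ge d m) j) _.
  by rewrite ler_peMl ?invr_ge0 ?exprn_ge0// (ler_nat _ 1 4).
Qed.

Let measurable_pairs k (j : box_index d k) : (0 < k <= K)%N ->
  measurable (bad_pair k (parent m k (lower j)) (lower j)) /\
  measurable (bad_pair k (lower j) (upper j)).
Proof.
move=> kK; have [a1 a2 a3 a4 [a5 a6]] := lower_pair j kK.
have [b1 b2 b3 b4 [b5 b6]] := upper_pair j kK.
by split; exact: measurable_bad_pair.
Qed.

Let measurable_level_bad k : (0 < k <= K)%N -> measurable (level_bad k).
Proof.
move=> kK; apply: fin_bigcup_measurable => [|j _]; first exact: finite_finset.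
by have [h1 h2] := measurable_pairs j kK; exact: measurableU.
Qed.

Let Pr_level_bad k : (0 < k <= K)%N ->
  Pr P (level_bad k) <= eps / 2 ^+ (2 * d + 5) / 2 ^+ k.
Proof.
move=> kK.
pose s := [seq j <- index_enum (box_index d k) | admissible j].
pose E : R := eps / 2 ^+ ((5 * k + 11) * d).
have E0 : 0 <= E by rewrite divr_ge0 ?exprn_ge0// ltW.
apply: le_trans (_ : \sum_(j <- s) Pr P
   (bad_pair k (parent m k (lower j)) (lower j) `|` bad_pair k (lower j) (upper j)) <= _).
  apply: Pr_cover_le; first exact: measurable_level_bad.
    by move=> j _; have [h1 h2] := measurable_pairs j kK; exact: measurableU.
  by move=> t [j /= Aj h]; exists j => //; rewrite mem_filter Aj mem_index_enum.
apply: le_trans (_ : \sum_(j <- s) ((2 * (2 * (k + 2)))%:R * E) <= _).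
  apply: ler_sum => j _.
  have [a1 a2 a3 a4 [a5 a6]] := lower_pair j kK.
  have [b1 b2 b3 b4 [b5 b6]] := upper_pair j kK.
  have [h1 h2] := measurable_pairs j kK.
  apply: le_trans (Pr_setU_le P h1 h2) _.
  rewrite [(2 * _)%N]mul2n -addnn natrD mulrDl.
  by apply: lerD; exact: Pr_bad_pair.
rewrite big_const_seq count_predT iter_addr_0 -[leLHS]mulr_natl mulrA -natrM.
set S := (size s * _)%N.
have ss : (size s <= 2 ^ ((4 * k + 5) * d))%N.
  apply: leq_trans (_ : #|@admissible d k| <= _)%N; last first.
    by have := @card_admissible R d d_gt0 k; rewrite -expnM.
  by rewrite -sum1_size big_filter -sum1_card.
have kk : (k + 2 <= 2 ^ k.+1)%N by apply: add2_le_exp2; case/andP: kK.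
have h : (S * 2 ^ (2 * d + 5) * 2 ^ k <= 2 ^ ((5 * k + 11) * d))%N.
  apply: leq_trans (_ : 2 ^ ((4 * k + 5) * d) * (2 * (2 * 2 ^ k.+1)) * 2 ^ (2 * d + 5) * 2 ^ k <= _)%N.
    by rewrite !leq_mul.
  by rewrite -!expnS -!expnD leq_exp2l// level_exponent_le.
clearbody S; move: h; rewrite -(ler_nat R) !natrM !natrX => h.
rewrite /E mulrA ler_pdivrMr ?exprn_gt0//.
rewrite mulrAC ler_pdivlMr ?exprn_gt0// [eps / _ * _]mulrAC ler_pdivlMr ?exprn_gt0//.
rewrite [X in X <= _](_ : _ = eps * (S%:R * 2 ^+ (2 * d + 5) * 2 ^+ k)); last by ring.
by rewrite ler_pM2l.
Qed.

(** A closed form with its tail: the series of (l + 2)(5 l + 23) / 2^l and of (l + 2) / 2^l, over l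
    >= 1, sum to 142 and 4. *)
Let sum_e k : (k <= K)%N -> \sum_(1 <= l < k.+1) e l
  <= (142 + 4 * logeps) * (H * sigma)
     - ((5 * (k * k) + 53 * k + 142)%:R + (k + 4)%:R * logeps) * (H * sigma) / 2 ^+ k.
Proof.
elim: k => [|k IH] kK.
  by rewrite big_geq// expr0 divr1 !muln0 !add0n subrr.
rewrite big_nat_recr//=; apply: le_trans (lerD (IH (ltnW kK)) (lexx _)) _.
rewrite /e /lam /level exprS le_eqVlt; apply/orP; left; apply/eqP.
rewrite !natrD !natrM -[k.+1%:R]natr1; field.
by rewrite lt0r_neq0// exprn_gt0.
Qed.

(** The tail subtracted in [sum_e] exceeds [e K], so the last step to the upper corner costs nothing
    extra. *)
Let sum_e_le : \sum_(1 <= l < K.+1) e l + e K <= (142 + 4 * logeps) * (H * sigma).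
Proof.
apply: le_trans (lerD (sum_e (leqnn K)) (lexx _)) _.
rewrite -addrA gerDl addrC subr_le0 /e /lam /level.
rewrite mulrA mulrA ler_pM2r ?invr_gt0 ?exprn_gt0// ler_pM2r; last exact: mulr_gt0.
rewrite mulrDr lerD//.
  by rewrite -natrM ler_nat; nia.
by rewrite ler_wpM2r// ler_nat leq_add2l.
Qed.

(** 147 = 142 + 1 + 4: chaining, the van der Corput error, and the last bracket, whose contribution
    2^m 4^-K is at most 4 sqrt(d 2^m) because 2^m < 16^(K+1) d. *)
Lemma block_event : exists2 B : set T, measurable B /\ Pr P B <= eps / 2 ^+ (2 * d + 5) &
  forall t, ~ B t -> forall (x : 'I_d -> R) N, (forall i, 0 <= x i <= 1) -> (N <= 2 ^ m)%N ->
  `|\sum_(n < N) (in_box X m x n t)%:R - N%:R * vol x|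
    <= (147 + 4 * ln eps^-1) * Num.sqrt (d%:R * 2 ^+ m).
Proof.
pose B : set T := \bigcup_(k in `I_K) level_bad k.+1.
have mB : measurable B.
  by apply: fin_bigcup_measurable => // k kK; exact: measurable_level_bad.
exists B.
  split=> //; apply: le_trans (_ : \sum_(k <- iota 0 K) Pr P (level_bad k.+1) <= _).
    apply: Pr_cover_le => // [k|t [k /= kK h]].
      by rewrite mem_iota => /andP[_ kK]; exact: measurable_level_bad.
    by exists k => //; rewrite mem_iota.
  apply: le_trans (_ : \sum_(k <- iota 0 K) (eps / 2 ^+ (2 * d + 5) * 2 ^- k.+1) <= _).
    rewrite big_seq [leRHS]big_seq; apply: ler_sum => k; rewrite mem_iota => /andP[_ kK].
    exact: Pr_level_bad.
  rewrite -mulr_sumr ler_piMr ?divr_ge0 ?exprn_ge0 ?(ltW eps_gt0)//.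
  rewrite sum_inv_exp2.
  by rewrite gerBl invr_ge0 exprn_ge0.
move=> t nB x N x01 Nm.
have ct : controlled X d m K e t.
  move=> k j N' kK Aj N'm.
  have nk : ~ level_bad k t.
    by move=> h; apply: nB; exists k.-1; [case: k kK {j Aj h}|case: k kK j Aj h].
  split.
    have [a1 a2 a3 a4 [a5 a6]] := lower_pair j kK.
    by apply: good_pair => // h; apply: nk; exists j => //; left.
  have [a1 a2 a3 a4 [a5 a6]] := upper_pair j kK.
  by apply: good_pair => // h; apply: nk; exists j => //; right.
apply: le_trans (chain_bound X_unif d_gt0 m_ge K_gt0 ct x01 Nm) _.
have A : Num.sqrt (d%:R * 2 ^+ m) = H * sigma.
  rewrite -[RHS]ger0_norm ?mulr_ge0 ?(ltW H_gt0) ?(ltW sigma_gt0)//.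
  by rewrite -sqrtr_sqr exprMn expr2 -mulrA sigma_sq mulrC.
have h1 : Num.sqrt (2 ^+ m) <= H * sigma.
  rewrite -A; apply: ler_wsqrtr.
  by rewrite ler_peMl ?exprn_ge0// ler1n.
have h2 : 2 ^+ m * 4 ^- K <= 4 * (H * sigma).
  rewrite -/H mulrCA ler_pM2l// -[leLHS]mul1r ler_pdivrMr ?exprn_gt0//.
  by move: sigma_gt; rewrite exprS; lra.
have := sum_e_le; rewrite A -/logeps; lra.
Qed.

End block_probability.

(** * All blocks and all dimensions *)

Section assembly.
Context {R : realType} {disp : measure_display} {T : measurableType disp}.
Variables (P : probability T R) (X : nat -> {RV P >-> R}).
Hypothesis X_indep : independent_RVs [set i | (1 <= i)%N] X.
Hypothesis X_unif : forall i, (1 <= i)%N -> uniform01 (X i).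
Variable eps : R.
Hypothesis eps_gt0 : 0 < eps.
Hypothesis eps_lt1 : eps < 1.

Let C0 : R := 147 + 4 * ln eps^-1.

Let C0_ge1 : 1 <= C0.
Proof.
have : 0 <= ln eps^-1 by rewrite ln_ge0// invf_ge1// ltW.
by rewrite /C0; lra.
Qed.

Definition block_bound (d m : nat) (t : T) : Prop :=
  forall (x : 'I_d -> R) N, (forall i, 0 <= x i <= 1) -> (N <= 2 ^ m)%N ->
  `|\sum_(n < N) (in_box X m x n t)%:R - N%:R * vol x|
    <= C0 * Num.sqrt (d%:R * 2 ^+ m).

(** K is the integer part of the base 16 logarithm of 2^m / d. The condition 1024 d <= 2^m makes it
    positive and forces m >= 10. The empty set serves the remaining pairs (d, m), so that a choice
    function exists on all pairs. *)
Lemma block_exception (d m : nat) : exists B : set T,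
  [/\ measurable B, Pr P B <= eps / 2 ^+ (2 * d + 5) &
   ((2 <= d)%N -> (1024 * d <= 2 ^ m)%N -> forall t, ~ B t -> block_bound d m t)].
Proof.
have [/andP[d2 dm]|nc] := boolP ((2 <= d)%N && (1024 * d <= 2 ^ m)%N); last first.
  exists set0; split=> //; last by move=> d2 dm; rewrite d2 dm in nc.
  by rewrite /Pr measure0 divr_ge0 ?exprn_ge0// ltW.
have d0 : (0 < d)%N by apply: ltnW.
have q1024 : (1024 <= 2 ^ m %/ d)%N by rewrite leq_divRL.
have /(trunc_log_bounds (p := 16) isT)/andP[k1 k2] : (0 < 2 ^ m %/ d)%N by apply: leq_trans q1024.
set K := trunc_log 16 _ in k1 k2.
have m10 : (10 <= m)%N.
  rewrite -(@leq_exp2l 2)// (leq_trans _ dm)//.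
  by rewrite -[X in (X <= _)%N]muln1 leq_mul2l.
have K0 : (0 < K)%N.
  rewrite lt0n; apply/eqP => K0.
  by move: (leq_trans q1024 (ltnW k2)); rewrite K0.
have K1 : (16 ^ K * d <= 2 ^ m)%N by rewrite -leq_divRL.
have K2 : (2 ^ m < 16 ^ K.+1 * d)%N by rewrite -ltn_divLR.
have [B [mB PB] hB] := block_event X_indep X_unif d2 m10 K0 K1 K2 eps_gt0 eps_lt1.
by exists B; split=> // _ _ t /hB.
Qed.

(** For each d the 12 * 2^d blocks fail with total probability at most 12 * 2^d eps / 2^(2d+5) <=
    eps / 2^(d+1), which sums to eps over d. *)
Lemma exceptional_set : exists E : set T, [/\ measurable E,
  ((1 - eps)%:E <= P E)%E &
  forall t, E t -> forall d m, (2 <= d)%N -> (m < 12 * 2 ^ d)%N ->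
    (1024 * d <= 2 ^ m)%N -> block_bound d m t].
Proof.
have /choice[B hB] : forall dm : nat * nat, exists B : set T,
  [/\ measurable B, Pr P B <= eps / 2 ^+ (2 * dm.1 + 5) &
   ((2 <= dm.1)%N -> (1024 * dm.1 <= 2 ^ dm.2)%N ->
     forall t, ~ B t -> block_bound dm.1 dm.2 t)].
  by move=> dm; exact: block_exception.
have mB dm : measurable (B dm) by case: (hB dm).
pose F d : set T := \bigcup_(m in `I_(12 * 2 ^ d)) B (d, m).
have mF d : measurable (F d) by apply: fin_bigcup_measurable.
have PF d : (P (F d) <= (eps / (2 ^ d.+1)%:R)%:E)%E.
  rewrite PrE// lee_fin.
  apply: le_trans (_ : \sum_(m <- iota 0 (12 * 2 ^ d)) Pr P (B (d, m)) <= _).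
    apply: Pr_cover_le => // t [m /= md h]; exists m => //.
    by rewrite mem_iota.
  apply: le_trans (_ : \sum_(m <- iota 0 (12 * 2 ^ d)) eps / 2 ^+ (2 * d + 5) <= _).
    by apply: ler_sum => m _; case: (hB (d, m)).
  rewrite big_const_seq count_predT size_iota iter_addr_0 -[leLHS]mulr_natl.
  rewrite mulrCA ler_pM2l// ler_pdivrMr ?exprn_gt0// mulrC ler_pdivlMr ?ltr0n ?expn_gt0//.
  rewrite -natrX -natrM ler_nat.
  have -> : (2 ^ (2 * d + 5) = 32 * (2 ^ d * 2 ^ d))%N.
    by rewrite expnD mulnC mul2n -addnn expnD.
  by rewrite expnS; lia.
exists (~` \bigcup_d F d); split.
- by apply: measurableC; exact: bigcup_measurable.
- rewrite probability_setC; last exact: bigcup_measurable.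
  rewrite EFinB; apply: leeB => //.
  apply: le_trans (measure_sigma_subadditive P _ _ _ (F := F)) _ => //.
    exact: bigcup_measurable.
  apply: le_trans (_ : (\sum_(0 <= d <oo) (0 + (eps / (2 ^ d.+1)%:R)%:E) <= _)%E).
    by apply: lee_nneseries => // d _; rewrite add0e; exact: PF.
  apply: le_trans (epsilon_trick predT _ (ltW eps_gt0)) _ => //.
  by rewrite eseries0// add0e.
move=> t Et d m d2 md dm; case: (hB (d, m)) => _ _ /(_ d2 dm); apply.
by move=> Bt; apply: Et; exists d => //; exists m.
Qed.

(** Outside the random range either d = 1 or m >= 12 * 2^d; in both cases all coordinates are
    T_p-orbits and the bound is deterministic. *)
Lemma block_bound_all t d m : (0 < d)%N -> (1024 * d <= 2 ^ m)%N ->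
  ((2 <= d)%N -> (m < 12 * 2 ^ d)%N -> (1024 * d <= 2 ^ m)%N -> block_bound d m t) ->
  block_bound d m t.
Proof.
move=> d0 dm hb.
have m10 : (10 <= m)%N.
  rewrite -(@leq_exp2l 2)// (leq_trans _ dm)//.
  by rewrite -[X in (X <= _)%N]muln1 leq_mul2l.
have [/andP[d2 md]|nc] := boolP ((2 <= d)%N && (m < 12 * 2 ^ d)%N); first exact: hb.
have ah i : @is_halton d m i.
  rewrite /is_halton /halton_phase; move: nc; rewrite negb_and -!leqNgt.
  case/orP => h; first by have := ltn_ord i; case: (nat_of_ord i) => //; lia.
  by apply/orP; right; apply: leq_trans h; rewrite leq_mul2l leq_exp2l// ltn_ord.
move=> x N x01 Nm; apply: le_trans (all_halton_bound X_unif d0 m10 t ah x01 Nm) _.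
apply: (@le_trans _ _ (Num.sqrt (d%:R * 2 ^+ m))).
  by apply: ler_wsqrtr; rewrite ler_peMl ?exprn_ge0// ler1n.
by rewrite ler_peMl ?sqrtr_ge0.
Qed.

(** * From blocks to all N, at a fixed outcome *)

Variables (t : T) (d : nat).
Hypothesis d_gt0 : (0 < d)%N.
Hypothesis bounds : forall m, (1024 * d <= 2 ^ m)%N -> block_bound d m t.

Let visit (x : 'I_d -> R) (n : nat) : bool :=
  [forall i : 'I_d, coord_orbit i.+1 (X i.+1 t) n.+1 < x i].

Let error (x : 'I_d -> R) (N : nat) : R := \sum_(n < N) (visit x n)%:R - N%:R * vol x.

Let errorD x (m N : nat) : (1024 * d <= 2 ^ m)%N -> (forall i, 0 <= x i <= 1) ->
  (N <= 2 ^ m)%N ->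
  `|error x (block_start m + N)|
    <= `|error x (block_start m)| + C0 * Num.sqrt (d%:R * 2 ^+ m).
Proof.
move=> dm x01 Nm.
apply: le_trans (lerD (lexx _) (bounds dm x01 Nm)).
have -> : error x (block_start m + N)
  = error x (block_start m) + (\sum_(n < N) (in_box X m x n t)%:R - N%:R * vol x).
  by rewrite /error big_split_ord /= natrD mulrDl opprD addrACA.
exact: ler_normD.
Qed.

Let error_le x N : (forall i, 0 <= x i <= 1) -> `|error x N| <= N%:R.
Proof.
move=> x01; rewrite /error.
have v0 : 0 <= vol x by apply: prodr_ge0 => i _; case/andP: (x01 i).
have v1 := vol_le1 x01.
have N0 : 0 <= N%:R :> R by [].
have s0 : 0 <= \sum_(n < N) (visit x n)%:R :> R by apply: sumr_ge0.
have s1 : \sum_(n < N) (visit x n)%:R <= N%:R :> R.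
  apply: (@le_trans _ _ (\sum_(n < N) 1)); last by rewrite sumr_const card_ord.
  by apply: ler_sum => n _; rewrite lern1 leq_b1.
have w0 : 0 <= N%:R * vol x by exact: mulr_ge0.
have w1 : N%:R * vol x <= N%:R by rewrite ler_piMr.
by rewrite ler_norml; apply/andP; split; lra.
Qed.

(** 7/5 is a rational lower bound for the square root of 2. It makes the blocks before m sum
    geometrically, with the factor 1 / (7/5 - 1) = 5/2. *)
Let sqrt_step m : 7 / 5 * Num.sqrt (d%:R * 2 ^+ m) <= Num.sqrt (d%:R * 2 ^+ m.+1) :> R.
Proof.
have a0 : 0 <= d%:R * 2 ^+ m :> R by rewrite mulr_ge0 ?exprn_ge0.
rewrite -(@ler_pXn2r _ 2)// ?nnegrE ?mulr_ge0 ?sqrtr_ge0 ?invr_ge0//.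
rewrite exprMn !sqr_sqrtr// ?mulr_ge0 ?exprn_ge0//.
rewrite [2 ^+ m.+1]exprS [leRHS]mulrCA ler_wpM2r// expr2; lra.
Qed.

Let error_block_start x m1 m : (1024 * d <= 2 ^ m1)%N -> (m1 <= m)%N ->
  (forall i, 0 <= x i <= 1) ->
  `|error x (block_start m)|
    <= (block_start m1)%:R + 5 / 2 * (C0 * Num.sqrt (d%:R * 2 ^+ m)).
Proof.
move=> dm1 + x01; have C1 := C0_ge1.
have pos n : 0 <= C0 * Num.sqrt (d%:R * 2 ^+ n) by rewrite mulr_ge0 ?sqrtr_ge0//; lra.
elim: m => [|m IH] mm.
  have -> : m1 = 0%N by lia.
  by apply: le_trans (error_le _ x01) _; rewrite lerDl mulr_ge0//; lra.
case: (ltnP m m1) => mm1.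
  have -> : m1 = m.+1 by lia.
  by apply: le_trans (error_le _ x01) _; rewrite lerDl mulr_ge0//; lra.
have dm : (1024 * d <= 2 ^ m)%N by rewrite (leq_trans dm1)// leq_exp2l.
have -> : block_start m.+1 = (block_start m + 2 ^ m)%N by rewrite /block_start expnS; lia.
have h1 := errorD dm x01 (leqnn _).
have h2 := IH mm1.
have h3 : 7 / 5 * (C0 * Num.sqrt (d%:R * 2 ^+ m)) <= C0 * Num.sqrt (d%:R * 2 ^+ m.+1).
  by rewrite mulrCA; apply: ler_wpM2l; [lra|exact: sqrt_step].
lra.
Qed.

(** B^2 <= 2050 d N, and 46^2 = 2116. *)
Lemma small_le_sqrt (N B : nat) : (B <= N)%N -> (B <= 2050 * d)%N ->
  B%:R <= 46 * Num.sqrt (d%:R * N%:R) :> R.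
Proof.
move=> BN Bd.
rewrite -(@ler_pXn2r _ 2)// ?nnegrE ?mulr_ge0 ?sqrtr_ge0//.
rewrite exprMn sqr_sqrtr ?mulr_ge0// mulrA expr2.
apply: ler_pM => //; last by rewrite ler_nat.
apply: (@le_trans _ _ (2050 * d)%:R); first by rewrite ler_nat.
by rewrite natrM ler_wpM2r//; lra.
Qed.

(** Before [block_start m1], at most 2050 d points, the trivial bound N is used and costs 46. Beyond
    it, 7/2 = 5/2 + 1 counts the complete blocks and the current one. *)
Let error_final x N : (forall i, 0 <= x i <= 1) ->
  `|error x N| <= (46 + 7 / 2 * C0) * Num.sqrt (d%:R * N%:R).
Proof.
move=> x01.
pose m1 := (up_log 2 d + 10)%N.
have ul1 : (d <= 2 ^ up_log 2 d)%N by apply: up_logP.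
have ul2 : (2 ^ up_log 2 d <= 2 * d)%N.
  have [d1|d1] := leqP d 1; first by have -> : d = 1%N by lia.
  have /andP[+ _] := up_log_bounds (ltnSn 1) d1.
  have : (0 < up_log 2 d)%N by rewrite up_log_gt0.
  by case: (up_log 2 d) => // u _ /= h; rewrite expnS leq_mul2l ltnW.
have m1d : (1024 * d <= 2 ^ m1)%N by rewrite /m1 expnD mulnC leq_mul2r ul1 orbT.
have Bd : (block_start m1 <= 2050 * d)%N.
  by rewrite /block_start /m1 expnD; lia.
have C1 := C0_ge1.
have s0 : 0 <= Num.sqrt (d%:R * N%:R) :> R by exact: sqrtr_ge0.
have C0s : 0 <= C0 * Num.sqrt (d%:R * N%:R) by rewrite mulr_ge0//; lra.
have [NB|BN] := leqP N (block_start m1).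
  apply: le_trans (error_le _ x01) _.
  apply: le_trans (small_le_sqrt (leqnn N) (leq_trans NB Bd)) _.
  by rewrite ler_wpM2r//; lra.
(* The block containing time N has index given by the base 2 logarithm of N - 2, as blocks start at
   2^M + 2. *)
have N2 : (0 < N - 2)%N by move: BN; rewrite /block_start; lia.
have /andP[k1 k2] := trunc_log_bounds (ltnSn 1) N2.
set M := trunc_log 2 (N - 2) in k1 k2.
have m1M : (m1 <= M)%N.
  rewrite -ltnS -(@ltn_exp2l 2)//; apply: leq_ltn_trans k2.
  by move: BN; rewrite /block_start; lia.
have MN : (block_start M <= N)%N by rewrite /block_start; lia.
have dM : (1024 * d <= 2 ^ M)%N by rewrite (leq_trans m1d)// leq_exp2l.
have N'M : (N - block_start M <= 2 ^ M)%N.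
  by move: k2; rewrite /block_start expnS; lia.
have h1 := errorD dM x01 N'M; rewrite subnKC// in h1.
have h2 := error_block_start m1d m1M x01.
have h3 := small_le_sqrt (ltnW BN) Bd.
have h4 : C0 * Num.sqrt (d%:R * 2 ^+ M) <= C0 * Num.sqrt (d%:R * N%:R).
  rewrite ler_wpM2l//; first lra.
  apply: ler_wsqrtr; rewrite ler_wpM2l// -natrX ler_nat.
  by apply: leq_trans k1 _; exact: leq_subr.
rewrite mulrDl -mulrA; lra.
Qed.

Lemma star_discrepancy_le N : (0 < N)%N ->
  star_discrepancy N (fun n => [tuple coord_orbit i.+1 (X i.+1 t) n | i < d])
    <= (46 + 7 / 2 * C0) * (Num.sqrt d%:R / Num.sqrt N%:R).
Proof.
move=> N0; have N0R : 0 < N%:R :> R by rewrite ltr0n.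
apply: ge_sup.
  eexists; exists (anchored_box [tuple (0 : R) | i < d]); last reflexivity.
  by exists [tuple (0 : R) | i < d] => //= i; rewrite tnth_mktuple lexx ler01.
move=> _ [_ [beta /= b01 <-] <-].
pose x (i : 'I_d) := tnth beta i.
have -> : fine (lebesgue_tuple (anchored_box beta)) = vol x.
  by rewrite lebesgue_tuple_box// => i; case/andP: (b01 i).
have -> : \sum_(1 <= n < N.+1) \1_(anchored_box beta)
     ([tuple coord_orbit i.+1 (X i.+1 t) n | i < d]) = \sum_(n < N) (visit x n)%:R :> R.
  rewrite big_add1 big_mkord; apply: eq_bigr => n _; rewrite indicE; congr (_%:R).
  congr nat_of_bool; apply/idP/forallP.
    by rewrite inE => h i; have := h i; rewrite tnth_mktuple => /andP[].
  move=> h; rewrite inE => i; rewrite tnth_mktuple; apply/andP; split; last exact: h.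
  have [X01 _] := X_unif (ltn0Sn i).
  by have /andP[] := @coord_orbit_itv R i.+1 (X i.+1 t) n isT (X01 t).
have -> : N%:R^-1 * \sum_(n < N) (visit x n)%:R - vol x = N%:R^-1 * error x N.
  by rewrite /error mulrBr mulKf// lt0r_neq0.
rewrite normrM ger0_norm ?invr_ge0// mulrC ler_pdivrMr//.
apply: le_trans (error_final N b01) _.
rewrite -[leRHS]mulrA; apply: ler_wpM2l; first by have := C0_ge1; lra.
have sN : 0 < Num.sqrt N%:R :> R by rewrite sqrtr_gt0.
rewrite sqrtrM// -[leRHS]mulrA; apply: ler_wpM2l; first exact: sqrtr_ge0.
by rewrite -[X in _^-1 * X](sqr_sqrtr (ltW N0R)) expr2 mulKf// lt0r_neq0.
Qed.

End assembly.

Theorem theorem1p1 (R : realType) (disp : measure_display)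
    (T : measurableType disp) (P : probability T R) (X : nat -> {RV P >-> R})
    (X_indep : independent_RVs [set i | (1 <= i)%N] X)
    (X_unif : forall i, (1 <= i)%N -> uniform01 (X i))
    (eps : R) (eps_gt0 : 0 < eps) :
  exists E : set T,
    [/\ measurable E,
        ((1 - eps)%:E <= P E)%E &
        forall t, E t -> forall N d : nat, (1 <= N)%N -> (1 <= d)%N ->
          star_discrepancy N
            (fun n => [tuple coord_orbit i.+1 (X i.+1 t) n | i < d])
          <= (2576 + 357 * ln eps^-1) * (Num.sqrt d%:R / Num.sqrt N%:R)].
Proof.
have [eps_ge1|eps_lt1] := leP 1 eps.
  exists set0; split=> //.
  by rewrite measure0 lee_fin subr_le0.
have [E [mE PE hE]] := exceptional_set X_indep X_unif eps_gt0 eps_lt1.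
exists E; split=> // t Et N d N0 d0.
have bb m : (1024 * d <= 2 ^ m)%N -> block_bound X eps d m t.
  by move=> dm; apply: block_bound_all => //; exact: hE.
apply: le_trans (star_discrepancy_le X_unif eps_gt0 eps_lt1 d0 bb N0) _.
(* 46 + 7/2 (147 + 4 log(1/eps)) = 560.5 + 14 log(1/eps), which lies below the claimed constant
   since the logarithm is nonnegative. *)
have l0 : 0 <= ln eps^-1 by rewrite ln_ge0// invf_ge1// ltW.
by rewrite ler_wpM2r ?divr_ge0 ?sqrtr_ge0//; lra.
Qed.
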